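(* Let $M$ be a compact connected $C^1$ manifold, equipped with a Riemannian metric $g$. Then $M$ with the geodesic metric $\rho_g$ is cube-decomposable.
   Context: Manifolds may have boundary; charts take values in $\mathbb{R}^m$ or in a closed half-space of $\mathbb{R}^m$. A Riemannian metric on a $C^1$ manifold is a continuous field of inner products on the tangent spaces; the geodesic metric $\rho_g(x,y)$ is the infimum of the $g$-lengths of (piecewise $C^1$) paths joining $x$ and $y$. $B(x,R)$ denotes the open ball. A family of dyadic cubes of a metric space $(X,\rho)$ is a collection of subsets $Q_\alpha^k\subset X$, $k\in\mathbb{N}_0$, $\alpha\in I_k$ ($I_k$ index sets), for which there exist a ball constant $C>0$ and a scaling value $\delta\in(0,1)$ such that: (a) $X=\bigsqcup_{\alpha\in I_k}Q_\alpha^k$ for each $k\in\mathbb{N}_0$; (b) for each $l\ge k$, $\alpha\in I_l$, $\beta\in I_k$, either $Q_\alpha^l\subset Q_\beta^k$ or $Q_\alpha^l\cap Q_\beta^k=\emptyset$; (c) for each $Q_\alpha^k$ there is a point $x_\alpha^k\in Q_\alpha^k$ with $B(x_\alpha^k,C^{-1}\delta^k)\subseteq Q_\alpha^k\subseteq B(x_\alpha^k,C\delta^k)$. The family is connected if, in addition, (d) each $Q_\alpha^k$ is a connected subset of $X$. $X$ is cube-decomposable if it has a connected family of dyadic cubes. *)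

(* Defs.v *)
From HB Require Import structures.
From mathcomp Require Import all_boot all_order all_algebra.
From mathcomp Require Import all_classical all_reals all_analysis.
Set Implicit Arguments.
Unset Strict Implicit.
Unset Printing Implicit Defensive.
Import Order.TTheory GRing.Theory Num.Theory.
Import numFieldNormedType.Exports.
Local Open Scope classical_set_scope.
Local Open Scope ring_scope.

(** * Metric spaces given by a distance function *)

Record is_metric (R : realType) (X : Type) (d : X -> X -> R) : Prop := {
  metric_refl : forall x, d x x = 0;
  metric_separated : forall x y, d x y = 0 -> x = y;
  metric_symmetric : forall x y, d x y = d y x;
  metric_triang : forall y x z, d x z <= d x y + d y z }.

(* A copy of [X] carrying the distance [d] and the topology induced by it,
   whatever topology [X] may already have. *)
Definition metric_space (R : realType) (X : choiceType) (d : X -> X -> R)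
  (dP : is_metric d) : Type := X.

HB.instance Definition _ (R : realType) (X : choiceType) (d : X -> X -> R)
  (dP : is_metric d) := Choice.copy (metric_space dP) X.
HB.instance Definition _ (R : realType) (X : choiceType) (d : X -> X -> R)
    (dP : is_metric d) :=
  isMetric.Build R (metric_space dP) (metric_refl dP)
    (@metric_separated _ _ _ dP) (metric_symmetric dP) (metric_triang dP).

(** * Dyadic cubes *)

Record dyadic_cubes (R : realType) (X : metricType R)
    (I : nat -> Type) (Q : forall k, I k -> set X) : Prop := {
  dyadic_cover : forall k, \bigcup_a Q k a = [set: X];
  dyadic_disjoint : forall k (a b : I k), a <> b -> Q k a `&` Q k b = set0;
  dyadic_nested : forall k l (a : I l) (b : I k), (k <= l)%N ->
    Q l a `<=` Q k b \/ Q l a `&` Q k b = set0;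
  dyadic_balls : exists C delta : R, [/\ 0 < C, 0 < delta < 1 &
    forall k (a : I k), exists2 x, Q k a x &
      ball x (C^-1 * delta ^+ k) `<=` Q k a /\
      Q k a `<=` ball x (C * delta ^+ k)] }.

Definition cube_decomposable (R : realType) (X : metricType R) : Prop :=
  exists (I : nat -> Type) (Q : forall k, I k -> set X),
    dyadic_cubes Q /\ forall k (a : I k), connected (Q k a).

(** * Maps of class C^1 on arbitrary subsets of normed spaces *)

Definition C1_near (R : realType) (V W : normedModType R) (f : V -> W) (x : V)
    : Prop :=
  \forall y \near x, differentiable f y /\
    forall v, {for y, continuous (fun z => 'd f z v)}.

(* [F] is a C^1 extension of [f], restricted to [A], to a full neighbourhood
   of [x]; this is how smoothness is understood at boundary points. *)
Definition C1_extension (R : realType) (V W : normedModType R) (A : set V)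
    (f : V -> W) (x : V) (F : V -> W) : Prop :=
  C1_near F x /\ \forall y \near x, A y -> F y = f y.

Definition C1_on (R : realType) (V W : normedModType R) (A : set V)
    (f : V -> W) : Prop :=
  forall x, A x -> exists F, C1_extension A f x F.

(** * C^1 manifolds with boundary *)

Definition closed_half_space (R : realType) (m : nat) (H : set 'rV[R]_m)
    : Prop :=
  exists (u : 'cV[R]_m) (c : R), u != 0 /\ H = [set x | c <= (x *m u) 0 0].

(* [chart_inv] is only meaningful on the image of [chart_dom]. *)
Record chart (R : realType) (m : nat) (M : topologicalType) := Chart {
  chart_dom : set M;
  chart_map : M -> 'rV[R]_m;
  chart_inv : 'rV[R]_m -> M;
  chart_model : set 'rV[R]_m;
  chart_modelP : chart_model = [set: 'rV[R]_m] \/ closed_half_space chart_model;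
  chart_dom_open : open chart_dom;
  chart_image_open : exists2 U, open U &
    chart_map @` chart_dom = chart_model `&` U;
  chart_mapK : {in chart_dom, cancel chart_map chart_inv};
  chart_map_continuous : {within chart_dom, continuous chart_map};
  chart_inv_continuous :
    {within chart_map @` chart_dom, continuous chart_inv} }.

Definition transition (R : realType) (m : nat) (M : topologicalType)
    (c1 c2 : chart R m M) : 'rV[R]_m -> 'rV[R]_m :=
  chart_map c2 \o chart_inv c1.

Definition transition_dom (R : realType) (m : nat) (M : topologicalType)
    (c1 c2 : chart R m M) : set 'rV[R]_m :=
  chart_map c1 @` (chart_dom c1 `&` chart_dom c2).

Record C1_manifold (R : realType) (m : nat) := C1Manifold {
  manifold_space :> topologicalType;
  manifold_hausdorff : hausdorff_space manifold_space;
  manifold_second_countable : @second_countable manifold_space;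
  atlas : set (chart R m manifold_space);
  atlas_cover : forall p, exists2 c, atlas c & chart_dom c p;
  atlas_C1 : forall c1 c2, atlas c1 -> atlas c2 ->
    C1_on (transition_dom c1 c2) (transition c1 c2) }.

Definition chart_at (R : realType) (m : nat) (M : C1_manifold R m) (p : M)
    (c : chart R m M) : Prop :=
  atlas c /\ chart_dom c p.

(** * Tangent spaces and Riemannian metrics *)

(* A tangent vector at [p] is the family of its coordinate vectors in all the
   charts around [p], any two of which are related by the differential of the
   transition map; the coordinates in the other charts are set to 0.  At a
   boundary point the differential is that of any C^1 extension: they all agree
   since the model half-space is the closure of its interior. *)
Definition tangent_family (R : realType) (m : nat) (M : C1_manifold R m) :=
  chart R m M -> 'rV[R]_m.

HB.instance Definition _ (R : realType) (m : nat) (M : C1_manifold R m) :=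
  GRing.Lmodule.copy (tangent_family M) (chart R m M -> 'rV[R]_m).

Definition tangent_space (R : realType) (m : nat) (M : C1_manifold R m)
    (p : M) : set (tangent_family M) :=
  [set v | (forall c1 c2, chart_at p c1 -> chart_at p c2 ->
             exists2 F, C1_extension (transition_dom c1 c2) (transition c1 c2)
                          (chart_map c1 p) F &
               v c2 = 'd F (chart_map c1 p) (v c1)) /\
           (forall c, ~ chart_at p c -> v c = 0)].

Record inner_product_on (R : realType) (V : lmodType R) (T : set V)
    (b : V -> V -> R) : Prop := {
  inner_symmetric : forall v w, T v -> T w -> b v w = b w v;
  inner_linear : forall (a : R) u v w, T u -> T v -> T w ->
    b (a *: u + v) w = a * b u w + b v w;
  inner_positive : forall v, T v -> v != 0 -> 0 < b v v }.

(* [riem p] is only meaningful on the tangent space at [p].  Continuity of the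
   field means that its coefficient matrix in each chart is continuous. *)
Record riemannian_metric (R : realType) (m : nat) (M : C1_manifold R m) := {
  riem :> M -> tangent_family M -> tangent_family M -> R;
  riem_inner : forall p, inner_product_on (tangent_space p) (riem p);
  riem_continuous : forall c, atlas c -> exists2 G : M -> 'M[R]_m,
    {within chart_dom c, continuous G} &
    forall p v w, chart_dom c p -> tangent_space p v -> tangent_space p w ->
      riem p v w = (v c *m G p *m (w c)^T) 0 0 }.

(** * Geodesic distance *)

Definition C1_path_on (R : realType) (m : nat) (M : C1_manifold R m)
    (a b : R) (gamma : R -> M) : Prop :=
  forall c, atlas c ->
    C1_on (`[a, b] `&` gamma @^-1` chart_dom c) (chart_map c \o gamma).

(* The subdivision is [a :: s]. *)
Definition piecewise_C1_path (R : realType) (m : nat) (M : C1_manifold R m)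
    (a b : R) (gamma : R -> M) : Prop :=
  [/\ a < b, {within `[a, b], continuous gamma} &
    exists s : seq R, [/\ path <%R a s, last a s = b &
      forall i, (i < size s)%N ->
        C1_path_on (nth 0 (a :: s) i) (nth 0 (a :: s) i.+1) gamma]].

(* At an interior point of a C^1 piece this is a vector tangent at [gamma t];
   at the finitely many subdivision points it may be meaningless, which does
   not affect the length. *)
Definition velocity (R : realType) (m : nat) (M : C1_manifold R m)
    (gamma : R -> M) (t : R) : tangent_family M :=
  fun c => if `[< chart_at (gamma t) c >]
           then derive1 (chart_map c \o gamma) t else 0.

Definition path_length (R : realType) (m : nat) (M : C1_manifold R m)
    (g : riemannian_metric M) (a b : R) (gamma : R -> M) : R :=
  \int[lebesgue_measure]_(t in `[a, b])
    Num.sqrt (g (gamma t) (velocity gamma t) (velocity gamma t)).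

(* [inf] of the empty set is 0: if some pair of distinct points were joined by
   no path, this would fail to be a metric. *)
Definition geodesic_distance (R : realType) (m : nat) (M : C1_manifold R m)
    (g : riemannian_metric M) (x y : M) : R :=
  inf [set L | exists (a b : R) (gamma : R -> M),
    [/\ piecewise_C1_path a b gamma, gamma a = x, gamma b = y &
        L = path_length g a b gamma]].

(* Main.v *)
Require Import Defs.
From mathcomp Require Import all_boot all_order all_algebra.
From mathcomp Require Import all_classical all_reals all_analysis.
From mathcomp Require Import measurable_realfun.
From mathcomp Require Import ring lra.
Set Implicit Arguments.
Unset Strict Implicit.
Unset Printing Implicit Defensive.
Import Order.TTheory GRing.Theory Num.Theory.
Import numFieldNormedType.Exports.
Local Open Scope classical_set_scope.
Local Open Scope ring_scope.

(* The manifold is embedded in a Euclidean space by a map Phi which in each chart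
   is strictly differentiable with injective differential, and is cut into the
   Voronoi cells, for the Euclidean distance of the images, of a finite
   sufficiently fine separated set.  In a chart a cell is an intersection of
   conditions that are affine up to a small relative error, hence star-shaped
   with respect to every point of a small ball; dividing by the gauge then gives
   a bi-Lipschitz parametrization of the interior of the cell by the open cube
   |x| < 1.  The images of the dyadic subcubes of the latter are the dyadic cubes,
   once each remaining point is given to one of the cubes whose closure contains
   it: a set between a connected set and its closure is connected.

   All this takes place in any metric that charts compare with the norm.  For the
   geodesic distance the upper bound comes from straight segments in charts, and
   the lower bound from the length of a path up to its first exit from a ball. *)

(** * Dyadic cubes from bi-Lipschitz copies of the cube *)

(** The metric [g] is merely continuous, so the shape of Voronoi cells for the geodesic distance
    itself would be hard to control. The difference of two squared Euclidean distances is instead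
    affine in the ambient point, so that the only error of a cell condition read in a chart comes
    from the strict differentiability of [Phi]; it is small against the size of the cell once the
    charts are shrunk. Strict differentiability lets both points vary and is tested on points of the
    manifold only, which treats boundary points like the others; convexity of the half-space keeps
    segments inside the chart. Star-shapedness with respect to a whole ball, and not just to one
    point, is what makes the gauge Lipschitz. Only one scale of cells is built: all cubes come from
    the dyadic subdivision of one cube, so connectedness at small scales costs no further geometry,
    and finiteness of the set of cells gives one Lipschitz constant for all. *)

Lemma ler_norm_dist (R : realType) (V : normedModType R) (x y : V) (e : R) :
  `|x - y| < e -> `|y| <= `|x| + e.
Proof. by move=> /ltW; rewrite distrC -lerBlDl; exact: le_trans (lerB_dist _ _). Qed.

Lemma continuous_of_lipschitz (R : realType) (V W : normedModType R) (f : V -> W) (L : R) :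
  (forall x y, `|f x - f y| <= L * `|x - y|) -> continuous f.
Proof.
move=> fL x; apply/cvgrPdist_lt => e e0.
pose K := `|L| + 1; have K0 : 0 < K by rewrite ltr_wpDl.
apply/nbhs_ballP; exists (e / K) => /=; first by rewrite divr_gt0.
move=> y; rewrite -ball_normE /= => xy.
apply: (@le_lt_trans _ _ (K * `|x - y|)); last by rewrite mulrC -ltr_pdivlMr.
apply: le_trans (fL _ _) _; rewrite ler_wpM2r// /K.
by rewrite (le_trans (ler_norm _))// lerDl.
Qed.

Lemma nbhs_forall (T : topologicalType) (I : finType) (x : T)
    (P : I -> set T) :
  (forall i, nbhs x (P i)) -> nbhs x [set y | forall i, P i y].
Proof. by move=> H; apply: (@filter_forall _ _ _ (nbhs x) _). Qed.

Section Vectors.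
Variables (R : realType) (m : nat).
Implicit Types x y : 'rV[R]_m.

(** Row vectors carry the sup norm, so norm balls are cubes throughout. The sign condition on [e]
    matters for [m = 0], where there are no coordinates. *)
Lemma rv_norm_le x (e : R) : 0 <= e -> (`|x| <= e) = [forall j, `|x 0 j| <= e].
Proof.
move=> e0; rewrite [leLHS]/Num.norm /= mx_normrE.
apply/idP/forallP => [/bigmax_leP[_ H] j|H]; first exact: (H (0, j)).
by apply/bigmax_leP; split=> // -[i j] _ /=; rewrite ord1.
Qed.

Lemma rv_norm_lt x (e : R) : 0 < e -> (`|x| < e) = [forall j, `|x 0 j| < e].
Proof.
move=> e0; rewrite [ltLHS]/Num.norm /= mx_normrE.
apply/idP/forallP => [/bigmax_ltP[_ H] j|H]; first exact: (H (0, j)).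
by apply/bigmax_ltP; split=> // -[i j] _ /=; rewrite ord1.
Qed.

Lemma rv_coord_le x j : `|x 0 j| <= `|x|.
Proof. by have := lexx `|x|; rewrite {1}rv_norm_le// => /forallP. Qed.

Lemma rv_normP x : x = 0 \/ exists j, `|x| = `|x 0 j|.
Proof.
have [->|x0] := eqVneq x 0; [by left|right].
have : mx_norm x != 0 by rewrite (normr_eq0 x).
by case/mx_norm_neq0 => -[i j] /= H; exists j; rewrite -(ord1 i).
Qed.

End Vectors.

Section MetricClosure.
Variables (R : realType) (X : metricType R).

Lemma closure_mdistP (A : set X) z :
  closure A z <-> forall e, 0 < e -> exists2 w, A w & mdist z w < e.
Proof.
split=> [cl e e0|H B /nbhs_ballP[e /= e0 eB]].
  have [|w [Aw]] := cl (ball z e); first exact: nbhsx_ballx.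
  by rewrite ballEmdist /= => zw; exists w.
have [w Aw zw] := H e e0; exists w; split=> //; apply: eB.
by rewrite ballEmdist.
Qed.

(** A finite union of closures is closed; once it contains [A] it contains [closure A]. *)
Lemma closure_finU (S : finType) (A : set X) (B : S -> set X) :
  (forall x, A x -> exists s, closure (B s) x) ->
  forall x, closure A x -> exists s, closure (B s) x.
Proof.
move=> AB x clA; apply: contrapT => H.
have {}H s : ~ closure (B s) x by move=> ?; apply: H; exists s.
have : nbhs x [set y | forall s, ~ closure (B s) y].
  apply: nbhs_forall => s.
  by apply: open_nbhs_nbhs; split; [exact/closed_openC/closed_closure|exact: H].
by move=> /clA[y [/AB[s sy] /(_ s)]].
Qed.

(** The ball is the union of its radii, whose images are connected and share the point [h c]. As [h]
    is controlled on the ball only, continuity along a radius is stated within [[0, 1]]. *)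
Lemma connected_lipschitz_ball (m : nat) (h : 'rV[R]_m -> X) (c : 'rV[R]_m)
    (r L : R) :
  (forall x y, `|x - c| < r -> `|y - c| < r ->
     mdist (h x) (h y) <= L * `|x - y|) ->
  connected (h @` [set x | `|x - c| < r]).
Proof.
move=> lip; have [r0|r0] := leP r 0.
  suff -> : [set x | `|x - c| < r] = set0 by rewrite image_set0; exact: connected0.
  by rewrite -subset0 => x /=; rewrite ltNge (le_trans r0).
have -> : h @` [set x | `|x - c| < r] =
   \bigcup_(x in [set x | `|x - c| < r])
     ((fun t : R => h (c + t *: (x - c))) @` `[0, 1]).
  apply/seteqP; split=> z /=.
    move=> [x xr <-]; exists x => //=; exists 1; rewrite /= ?in_itv /= ?lexx ?ler01 //.
    by rewrite scale1r addrC subrK.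
  move=> [x /= xr [t]]; rewrite in_itv /= => /andP[t0 t1 <-].
  exists (c + t *: (x - c)) => //; rewrite addrC addKr normrZ ger0_norm//.
  by rewrite (le_lt_trans _ xr)// ler_piMl.
apply: bigcup_connected.
  exists (h c) => x /= xr; exists 0; rewrite /= ?in_itv /= ?lexx ?ler01 //.
  by rewrite scale0r addr0.
move=> x /= xr; apply: connected_continuous_connected.
  exact: segment_connected.
apply/subspace_continuousP => t /=; rewrite in_itv /= => /andP[t0 t1].
move=> B /nbhs_ballP[e /= e0 eB].
pose K := `|L| * `|x - c| + 1.
have K0 : 0 < K by rewrite ltr_wpDl// mulr_ge0.
have inb s : 0 <= s -> s <= 1 -> `|c + s *: (x - c) - c| < r.
  move=> s0 s1; rewrite addrC addKr normrZ ger0_norm//.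
  by rewrite (le_lt_trans _ xr)// ler_piMl.
apply/nbhs_ballP; exists (e / K) => /=; first by rewrite divr_gt0.
move=> s; rewrite /ball /= => ts; rewrite in_itv /= => /andP[s0 s1].
apply: eB; rewrite ballEmdist /=.
apply: le_lt_trans (lip _ _ (inb _ t0 t1) (inb _ s0 s1)) _.
rewrite opprD addrACA subrr add0r -scalerBl normrZ.
apply: (@le_lt_trans _ _ (K * `|t - s|)).
  rewrite mulrCA mulrC ler_wpM2r//.
  rewrite (@le_trans _ _ (`|L| * `|x - c|))// ?ler_wpM2r ?ler_norm//.
  by rewrite /K lerDl.
by rewrite mulrC -ltr_pdivlMr.
Qed.

End MetricClosure.

(** * Dyadic subdivision of the unit cube *)

Section Cubes.
Variables (R : realType) (m : nat) (T : Type).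

(* A cube of generation [k.+1] is a cube of generation [k] with a vector of signs
   telling in which orthant around its centre the smaller cube lies. *)
Fixpoint cube_index (k : nat) : Type :=
  if k is k'.+1 then (cube_index k' * {ffun 'I_m -> bool})%type else T.

Fixpoint cube_root k : cube_index k -> T :=
  if k is k'.+1 then fun i => cube_root i.1 else id.

Definition sign_vector (s : {ffun 'I_m -> bool}) : 'rV[R]_m :=
  \row_j (if s j then 1 else -1).

(** A cube of generation [k] is the open ball of radius [2^-1 ^+ k] around this point, generation 0
    being the unit ball around 0; hence the shift by half the radius of the parent, in each
    coordinate. *)
Fixpoint cube_center k : cube_index k -> 'rV[R]_m :=
  if k is k'.+1 then
    fun i => cube_center i.1 + 2^-1 ^+ k'.+1 *: sign_vector i.2
  else fun=> 0.

Lemma cube_centerS k (i : cube_index k) s :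
  cube_center ((i, s) : cube_index k.+1) =
  cube_center i + 2^-1 ^+ k.+1 *: sign_vector s.
Proof. by []. Qed.

Let half_gt0 k : 0 < 2^-1 ^+ k :> R.
Proof. by rewrite exprn_gt0// invr_gt0. Qed.

Let halfE k : 2^-1 ^+ k = 2^-1 ^+ k.+1 + 2^-1 ^+ k.+1 :> R.
Proof. by rewrite exprS -mulrDl [X in X * _](_ : _ = 1) ?mul1r//; lra. Qed.

Let norm_sign s : `|sign_vector s| <= 1.
Proof.
rewrite rv_norm_le//; apply/forallP => j; rewrite mxE.
by case: ifP; rewrite ?normrN normr1.
Qed.

Lemma cube_center_step k (i : cube_index k.+1) :
  `|cube_center i - cube_center i.1| <= 2^-1 ^+ k.+1.
Proof.
rewrite /= addrC addKr normrZ ger0_norm; last exact: ltW.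
by rewrite ler_piMr//; exact: ltW.
Qed.

Lemma cube_sub_parent k (i : cube_index k.+1) x :
  `|x - cube_center i| < 2^-1 ^+ k.+1 -> `|x - cube_center i.1| < 2^-1 ^+ k.
Proof.
move=> H; rewrite -(subrK (cube_center i) x) -addrA.
by rewrite (le_lt_trans (ler_normD _ _))// halfE ltr_leD// cube_center_step.
Qed.

Lemma cube_center_bound k (i : cube_index k) :
  `|cube_center i| + 2^-1 ^+ k <= 1.
Proof.
elim: k i => [|k IH] i; first by rewrite normr0 add0r expr0.
apply: le_trans (IH i.1); rewrite [in leRHS]halfE addrA lerD2r.
rewrite -[X in `|X| <= _](subrK (cube_center i.1)).
by rewrite (le_trans (ler_normD _ _))// [leRHS]addrC lerD2r cube_center_step.
Qed.

Lemma cube_in_unit k (i : cube_index k) x :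
  `|x - cube_center i| < 2^-1 ^+ k -> `|x| < 1.
Proof.
move=> H; apply: lt_le_trans (cube_center_bound i).
rewrite -[X in `|X| < _](subrK (cube_center i)) (le_lt_trans (ler_normD _ _))//.
by rewrite [ltRHS]addrC ltrD2r.
Qed.

(** The parents agree by induction. Each sign can then be read off, since in an open child every
    coordinate of [x] lies strictly on one side of that of the parent's center. *)
Lemma cube_disjoint k (a b : cube_index k) x :
  cube_root a = cube_root b ->
  `|x - cube_center a| < 2^-1 ^+ k -> `|x - cube_center b| < 2^-1 ^+ k ->
  a = b.
Proof.
elim: k a b => [//|k IH] [a s] [b t] rab ha hb.
have ab : a = b.
  by apply: IH rab _ _; [exact: (cube_sub_parent ha)|exact: (cube_sub_parent hb)].
subst b; congr (_, _); apply/ffunP => j.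
move: ha hb; rewrite !rv_norm_lt// => /forallP/(_ j) + /forallP/(_ j).
rewrite !mxE /=; have := half_gt0 k.+1; set h := _ ^+ _ => h0.
case: (s j); case: (t j); rewrite // !ltr_norml; lra.
Qed.

(** The child is closed in the conclusion because the points on the cutting hyperplanes lie in no
    open child. *)
Lemma cube_children_cover k (i : cube_index k) x :
  `|x - cube_center i| < 2^-1 ^+ k ->
  exists s, `|x - cube_center ((i, s) : cube_index k.+1)| <= 2^-1 ^+ k.+1.
Proof.
move=> H; exists [ffun j => cube_center i 0 j <= x 0 j].
rewrite rv_norm_le; last exact: ltW.
apply/forallP => j; move: H; rewrite rv_norm_lt// => /forallP/(_ j).
rewrite cube_centerS !mxE ffunE (halfE k).
have := half_gt0 k.+1; set h := _ ^+ _ => h0.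
by rewrite ltr_norml ler_norml; case: (leP (cube_center i 0 j)) => c; lra.
Qed.

End Cubes.

(** * Transport of the dyadic cubes to a metric space *)

Section CubesInMetricSpace.
Variables (R : realType) (m : nat) (X : metricType R) (T : Type).
Variables (h : T -> 'rV[R]_m -> X) (L : R).
Hypothesis L_gt0 : 0 < L.
Hypothesis h_lip : forall q x y, `|x| < 1 -> `|y| < 1 ->
  mdist (h q x) (h q y) <= L * `|x - y|.
(** A lower Lipschitz bound and the openness of the image in one condition: a small ball of [X]
    around [h q x] is filled by the images of points near [x]. *)
Hypothesis h_inner : forall q x r, 0 < r -> `|x| + r <= 1 ->
  forall z, mdist (h q x) z < r / L -> exists2 y, `|y - x| < r & h q y = z.
Hypothesis h_inj : forall q q' x x', `|x| < 1 -> `|x'| < 1 ->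
  h q x = h q' x' -> q = q' /\ x = x'.
Hypothesis h_cover : forall z,
  exists q, closure (h q @` [set x | `|x| < 1]) z.

Let half k : R := 2^-1 ^+ k.

Let half_gt0 k : 0 < half k.
Proof. by rewrite exprn_gt0// invr_gt0. Qed.

Definition open_cube k (i : cube_index m T k) : set X :=
  h (cube_root i) @` [set x | `|x - cube_center R i| < half k].

Lemma open_cube_inner k (i : cube_index m T k) x :
  open_cube i x -> exists2 e, 0 < e & forall z, mdist x z < e -> open_cube i z.
Proof.
move=> [y /= yi <-]; pose r := half k - `|y - cube_center R i|.
have r0 : 0 < r by rewrite subr_gt0.
exists (r / L); first by rewrite divr_gt0.
move=> z /h_inner[//||w wy <-].
  have := cube_center_bound R i; rewrite -/(half k).
  have := ler_normD (y - cube_center R i) (cube_center R i).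
  by rewrite subrK /r; lra.
exists w => //=; have := ler_normD (w - y) (y - cube_center R i).
by rewrite addrA subrK; move: wy; rewrite /r; lra.
Qed.

Lemma open_cube_inj k (a b : cube_index m T k) x :
  open_cube a x -> open_cube b x -> a = b.
Proof.
move=> [y /= ya <-] [z /= zb /h_inj[||rab zy]]; [exact: cube_in_unit zb|exact: cube_in_unit ya|].
by subst z; apply: cube_disjoint ya zb.
Qed.

Lemma open_cube_closure k (a b : cube_index m T k) x :
  closure (open_cube a) x -> open_cube b x -> a = b.
Proof.
move=> clx /open_cube_inner[e e0 be].
have [w aw /be bw] := (closure_mdistP _ _).1 clx _ e0.
exact: open_cube_inj aw bw.
Qed.

Lemma closure_open_cube_children k (i : cube_index m T k) x :
  closure (open_cube i) x ->
  exists s, closure (open_cube ((i, s) : cube_index m T k.+1)) x.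
Proof.
apply: closure_finU => {}x [y /= yi <-].
have [s ys] := cube_children_cover yi; exists s.
have y1 := cube_in_unit yi.
set c := cube_center R _ in ys.
apply/closure_mdistP => e e0.
(* Moving [y] by the fraction [t] towards the center of the closed child brings it into the open
   child and moves its image by at most [L * t <= e / 2]. *)
pose t := Num.min 2^-1 (e / (2 * L)).
have t0 : 0 < t by rewrite lt_min invr_gt0 ltr0n divr_gt0// mulr_gt0.
have t1 : t <= 2^-1 by rewrite /t ge_min lexx.
have te : t <= e / (2 * L) by rewrite /t ge_min lexx orbT.
have E : y + t *: (c - y) - c = (1 - t) *: (y - c).
  by apply/rowP => j; rewrite !mxE; ring.
have H : `|y + t *: (c - y) - c| < half k.+1.
  rewrite E normrZ ger0_norm; last lra.
  have h0 := half_gt0 k.+1.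
  apply: (@le_lt_trans _ _ ((1 - t) * half k.+1)); last by rewrite gtr_pMl//; lra.
  by rewrite ler_wpM2l//; lra.
exists (h (cube_root i) (y + t *: (c - y))); first by exists (y + t *: (c - y)).
apply: le_lt_trans (h_lip _ y1 (cube_in_unit H)) _.
rewrite opprD addrA subrr add0r normrN normrZ gtr0_norm//.
have hs : `|c - y| <= 1.
  rewrite distrC (le_trans ys)// exprn_ile1 ?invr_ge0// ?invf_le1//; lra.
apply: (@le_lt_trans _ _ (L * (e / (2 * L)))).
  rewrite ler_wpM2l ?(ltW L_gt0)// (le_trans _ te)// ler_piMr// ltW//.
have -> : L * (e / (2 * L)) = e / 2 by field; rewrite lt0r_neq0.
by lra.
Qed.

(* A point lying on the boundary of several open cubes of a generation is given
   to one of the children of its cube of the previous generation. *)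
Fixpoint cube_address (x : X) (k : nat) :
    {i : cube_index m T k | closure (open_cube i) x} :=
  match k with
  | 0 => let: exist q qx := cid (h_cover x) in
    (* In generation 0 the open cube reads [|y - 0| < 1], which is only provably equal to [|y| < 1];
       hence the transport. *)
    exist _ (q : cube_index m T 0)
      (eq_ind _ (fun A : set X => closure A x) qx _
        (congr1 (fun P => h q @` P)
          (funext (fun y => congr1 (fun z : 'rV[R]_m => (`|z| < 1 : Prop)) (esym (subr0 y))))))
  | k'.+1 => let: exist i ix := cube_address x k' in
    let: exist s sx := cid (closure_open_cube_children ix) in
    exist _ ((i, s) : cube_index m T k'.+1) sx
  end.

(** As fibres of the address the cubes partition [X], and they are nested because an address
    determines that of the parent. *)
Definition cube_of k (i : cube_index m T k) : set X :=
  [set x | sval (cube_address x k) = i].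

Lemma cube_address_parent x k :
  (sval (cube_address x k.+1)).1 = sval (cube_address x k).
Proof. by rewrite /=; case: (cube_address x k) => i ix; case: cid. Qed.

(** The choice made by [cube_address] is forced here: a point of an open cube is in the closure of
    no other open cube of its generation. *)
Lemma open_cube_sub k (i : cube_index m T k) : open_cube i `<=` cube_of i.
Proof.
by move=> x ix; rewrite /cube_of /=; case: cube_address => j jx /=; apply: open_cube_closure jx ix.
Qed.

Lemma cube_of_closure k (i : cube_index m T k) :
  cube_of i `<=` closure (open_cube i).
Proof. by move=> x; rewrite /cube_of /= => <-; case: cube_address. Qed.

Lemma cube_of_nested k l (a : cube_index m T l) (b : cube_index m T k) :
  (k <= l)%N -> cube_of a `<=` cube_of b \/ cube_of a `&` cube_of b = set0.
Proof.
move=> kl.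
have desc x y : sval (cube_address x l) = sval (cube_address y l) ->
    sval (cube_address x k) = sval (cube_address y k).
  move: kl {a b}; elim: l => [|l IH]; first by rewrite leqn0 => /eqP ->.
  rewrite leq_eqVlt => /predU1P[->//|]; rewrite ltnS => /IH H E.
  by apply: H; rewrite -(cube_address_parent x) -(cube_address_parent y) E.
have [[x [xa xb]]|H] := pselect (cube_of a `&` cube_of b !=set0).
  by left=> y ya; rewrite /cube_of /= -xb; apply: desc; rewrite ya -xa.
by right; apply/eqP/negPn/negP => /set0P.
Qed.

(** A nonempty relatively clopen part of [B] meets the dense subset [A], hence contains it, hence is
    all of [B]. *)
Lemma connected_between (A B : set X) :
  A `<=` B -> B `<=` closure A -> connected A -> connected B.
Proof.
move=> AB BA cA U U0 [C1 oC1 C1E] [C2 cC2 C2E]; apply/seteqP; split.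
  by rewrite C1E => x [].
have AUE : A `&` U = A.
  apply: cA; [|by exists C1 => //; rewrite C1E setIA (setIidl AB)|
    by exists C2 => //; rewrite C2E setIA (setIidl AB)].
  case: U0 => x; rewrite C1E => -[/BA clx C1x].
  have [y [Ay C1y]] := clx _ (open_nbhs_nbhs (conj oC1 C1x)).
  by exists y; split=> //; split=> //; exact: AB.
move=> x Bx; rewrite C2E; split=> //.
rewrite (iffLR (closure_id _) cC2); have := BA _ Bx; apply: closureS.
by rewrite -AUE C2E => y [_ []].
Qed.

Theorem cube_decomposable_of_cells : cube_decomposable X.
Proof.
exists (cube_index m T), (@cube_of); split; last first.
  move=> k i; apply: (connected_between (@open_cube_sub k i) (@cube_of_closure k i)).
  apply: (@connected_lipschitz_ball _ _ _ _ _ _ L) => x y xi yi.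
  by apply: h_lip; [exact: cube_in_unit xi|exact: cube_in_unit yi].
split.
- move=> k; apply/seteqP; split=> // x _.
  by exists (sval (cube_address x k)).
- move=> k a b ab; apply/seteqP; split=> // x [xa xb].
  by apply: ab; rewrite -xa -xb.
- by move=> k l a b; exact: cube_of_nested.
(* The summand [L^-1] absorbs the distance from a point of a cube to the open cube in whose closure
   it lies; the inner balls ask for [C >= L]. *)
exists (2 * L + L^-1), 2^-1; have Li : 0 < L^-1 by rewrite invr_gt0.
split; [by rewrite addr_gt0// mulr_gt0|by apply/andP; split; lra|]; move=> k i.
have hk : 0 < half k := half_gt0 k.
have c1 : `|cube_center R i| < 1.
  by apply: (@cube_in_unit _ _ _ _ i); rewrite subrr normr0.
exists (h (cube_root i) (cube_center R i)).
  by apply: open_cube_sub; exists (cube_center R i) => //=; rewrite subrr normr0.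
split=> x; rewrite ballEmdist /= -/(half k) => xi.
  apply: open_cube_sub.
  have [||w wi <-] := @h_inner (cube_root i) (cube_center R i) (half k) hk _ x.
  - exact: cube_center_bound.
  - apply: lt_le_trans xi _; rewrite mulrC ler_wpM2l//; first exact: ltW.
    by rewrite lef_pV2 ?posrE ?addr_gt0 ?mulr_gt0// mulr_natl mulr2n -addrA lerDl addr_ge0// ltW.
  - by exists w.
have [_ [w /= wi <-] xw] := (closure_mdistP _ _).1 (cube_of_closure xi) _ (mulr_gt0 Li hk).
apply: le_lt_trans (metric_triangle _ (h (cube_root i) w) _) _.
rewrite mulrDl ltr_leD//; last by rewrite metric_sym ltW.
apply: le_lt_trans (h_lip _ c1 (cube_in_unit wi)) _.
rewrite distrC -mulrA mulrCA ltr_pM2l//.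
by apply: lt_trans wi _; rewrite -/(half k); lra.
Qed.

End CubesInMetricSpace.

(** * Star-shaped domains *)

Section RadialMaps.
Variables (R : realType) (m : nat).
Implicit Types (v w : 'rV[R]_m) (N : 'rV[R]_m -> R).

(** Applied with the gauge and the norm in both orders: once for the map that flattens a star-shaped
    domain to the cube and once for its inverse. *)
Lemma radial_lipschitz N1 N2 (a b c : R) :
  0 < a -> 0 < b -> 0 < c ->
  (forall v, 0 <= N1 v <= a * `|v|) ->
  (forall v w, `|N1 v - N1 w| <= a * `|v - w|) ->
  (forall v, c * `|v| <= N2 v) ->
  (forall v w, `|N2 v - N2 w| <= b * `|v - w|) ->
  forall v w, `|(N1 v / N2 v) *: v - (N1 w / N2 w) *: w| <=
    (a / c + a / c + a * b / c ^+ 2) * `|v - w|.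
Proof.
move=> a0 b0 c0 N1b N1l N2b N2l v w.
(* The last of the three terms below carries the factor [|w| / |v|], which has to be at most 1. *)
wlog wv : v w / `|w| <= `|v|.
  move=> H; have [/H //|/ltW/H] := leP `|w| `|v|.
  by rewrite distrC (distrC w).
have [v0|v0] := eqVneq v 0.
  have w0 : w = 0 by move: wv; rewrite v0 normr0 normr_le0 => /eqP.
  by rewrite v0 w0 !scaler0 !subrr normr0 mulr0.
have nv : 0 < `|v| by rewrite normr_gt0.
have N2v : 0 < N2 v by rewrite (lt_le_trans _ (N2b v))// mulr_gt0.
have -> : (N1 v / N2 v) *: v - (N1 w / N2 w) *: w =
   (N1 v / N2 v) *: (v - w) + ((N1 v - N1 w) / N2 v) *: w +
   (N1 w * ((N2 v)^-1 - (N2 w)^-1)) *: w.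
  by apply/rowP => j; rewrite !mxE; ring.
apply: le_trans (ler_normD _ _) _; rewrite [leRHS]mulrDl lerD//.
  apply: le_trans (ler_normD _ _) _; rewrite [leRHS]mulrDl lerD//.
    rewrite normrZ ler_wpM2r// normrM normfV.
    have /andP[n0 n1] := N1b v; rewrite (ger0_norm n0) (gtr0_norm N2v).
    rewrite ler_pdivrMr// (le_trans n1)// -mulrA ler_pM2l//.
    by rewrite ler_pdivlMl.
  rewrite normrZ normrM normfV (gtr0_norm N2v).
  rewrite -[leLHS]mulrA [_^-1 * `|w|]mulrC.
  apply: (@le_trans _ _ ((a * `|v - w|) * (`|w| / N2 v))).
    by rewrite ler_wpM2r// divr_ge0// ltW.
  rewrite [leRHS]mulrAC ler_wpM2l//; first by rewrite mulr_ge0// ltW.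
  rewrite ler_pdivrMr// ler_pdivlMl//.
  by rewrite (le_trans _ (N2b v))// ler_pM2l.
have [w0|w0] := eqVneq w 0.
  rewrite w0 scaler0 normr0 mulr_ge0// divr_ge0 ?mulr_ge0 ?exprn_ge0//; exact: ltW.
have nw : 0 < `|w| by rewrite normr_gt0.
have N2w : 0 < N2 w by rewrite (lt_le_trans _ (N2b w))// mulr_gt0.
have -> : (N2 v)^-1 - (N2 w)^-1 = (N2 w - N2 v) / (N2 v * N2 w).
  by field; rewrite !lt0r_neq0.
rewrite normrZ !normrM normfV; have /andP[n0 n1] := N1b w.
rewrite (ger0_norm n0) [ `|N2 v * _|]ger0_norm; last by rewrite mulr_ge0// ltW.
apply: (@le_trans _ _ ((a * `|w|) * ((b * `|v - w|) / (c * `|v| * (c * `|w|))) * `|w|)).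
  have h1 : `|N2 w - N2 v| <= b * `|v - w| by rewrite distrC.
  have cv : 0 < c * `|v| by rewrite mulr_gt0.
  have cw : 0 < c * `|w| by rewrite mulr_gt0.
  have h2 : (N2 v * N2 w)^-1 <= (c * `|v| * (c * `|w|))^-1.
    rewrite lef_pV2 ?posrE ?mulr_gt0//.
    by apply: ler_pM => //; exact: ltW.
  have h3 : 0 <= (N2 v * N2 w)^-1 by rewrite invr_ge0 mulr_ge0//; exact: ltW.
  rewrite ler_wpM2r//; apply: ler_pM => //; first by rewrite mulr_ge0.
  exact: ler_pM.
have -> : (a * `|w|) * ((b * `|v - w|) / (c * `|v| * (c * `|w|))) * `|w| =
  (a * b / c ^+ 2) * `|v - w| * (`|w| / `|v|).
  by field; rewrite !lt0r_neq0.
apply: ler_piMr; last by rewrite ler_pdivrMr// mul1r.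
apply: mulr_ge0 => //; apply: divr_ge0; [apply: mulr_ge0|apply: exprn_ge0]; exact: ltW.
Qed.

Definition gauge (A : set 'rV[R]_m) v : R :=
  inf [set t | 0 < t /\ A (t^-1 *: v)].

Section Gauge.
Variables (A : set 'rV[R]_m) (s K : R).
Hypotheses (s0 : 0 < s) (K0 : 0 < K) (A_open : open A).
Hypothesis A_bounded : forall v, A v -> `|v| <= K.
Hypothesis A0 : A 0.
Hypothesis A_star : forall v w t, A v -> `|w| < s -> 0 <= t <= 1 ->
  A ((1 - t) *: v + t *: w).

Let S v := [set t | 0 < t /\ A (t^-1 *: v)].

Let S_up v t t' : S v t -> t <= t' -> S v t'.
Proof.
move=> [t0 At] tt'; have t'0 : 0 < t' by exact: lt_le_trans tt'.
split=> //; have -> : t'^-1 *: v = (1 - (1 - t / t')) *: (t^-1 *: v) + (1 - t / t') *: 0.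
  rewrite scaler0 addr0 scalerA; congr (_ *: _); field.
  by rewrite !lt0r_neq0.
apply: A_star => //; first by rewrite normr0.
by rewrite subr_ge0 ler_pdivrMr// mul1r tt' lerBlDr lerDl divr_ge0// ltW.
Qed.

Let S_big v t : `|v| / s < t -> S v t.
Proof.
move=> vt; have t0 : 0 < t by rewrite (le_lt_trans _ vt)// divr_ge0// ltW.
(* The case [t := 1] of [A_star] says that the ball of radius [s] around 0 lies in [A]. *)
split=> //; rewrite -[X in A X]add0r -[X in A (X + _)](scaler0 _ (1 - 1)) -[X in A (_ + X)]scale1r.
apply: A_star; rewrite ?ler01 ?lexx// normrZ gtr0_norm ?invr_gt0//.
by rewrite ltr_pdivrMl// mulrC -ltr_pdivrMl// mulrC.
Qed.

Let S_low v : lbound (S v) (`|v| / K).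
Proof.
move=> t [t0 /A_bounded]; rewrite normrZ gtr0_norm ?invr_gt0//.
by rewrite ler_pdivrMl// ler_pdivrMr.
Qed.

Let S_inf v : has_inf (S v).
Proof.
split; last by exists (`|v| / K); exact: S_low.
by exists (`|v| / s + 1); apply: S_big; rewrite ltrDl.
Qed.

Lemma gauge_ge v : K^-1 * `|v| <= gauge A v.
Proof. by rewrite mulrC; apply: lb_le_inf; [case: (S_inf v)|exact: S_low]. Qed.

Lemma gauge_ge0 v : 0 <= gauge A v.
Proof. by apply: le_trans (gauge_ge v); rewrite mulr_ge0// invr_ge0 ltW. Qed.

Let gauge_le_S v t : S v t -> gauge A v <= t.
Proof. by move=> St; apply: ge_inf => //; case: (S_inf v). Qed.

Lemma gauge_le v : gauge A v <= s^-1 * `|v|.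
Proof.
rewrite mulrC; apply/ler_addgt0Pr => e e0; apply: gauge_le_S.
by apply: S_big; rewrite ltrDl.
Qed.

(** If [t^-1 *: v'] is in [A] and [d > |v' - w'| / s], then [(t + d)^-1 *: w'] is a convex
    combination of it and of [d^-1 *: (w' - v')], which lies in the ball of radius [s].
    Star-shapedness with respect to that ball concludes. *)
Lemma gauge_lipschitz v w : `|gauge A v - gauge A w| <= s^-1 * `|v - w|.
Proof.
suff H v' w' : gauge A w' <= gauge A v' + s^-1 * `|v' - w'|.
  by have := H v w; have := H w v; rewrite (distrC w) ler_norml; lra.
rewrite -lerBlDr; apply: lb_le_inf; first by case: (S_inf v').
move=> t [t0 At]; rewrite lerBlDr; apply/ler_addgt0Pr => e e0.
set d := s^-1 * `|v' - w'| + e; rewrite -addrA -/d.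
have d0 : 0 < d by rewrite ltr_wpDl// mulr_ge0// invr_ge0 ltW.
apply: gauge_le_S; split; first exact: addr_gt0.
have td : 0 < t + d by exact: addr_gt0.
have -> : (t + d)^-1 *: w' = (1 - d / (t + d)) *: (t^-1 *: v') +
    (d / (t + d)) *: (d^-1 *: (w' - v')).
  by apply/rowP => j; rewrite !mxE; field; rewrite !lt0r_neq0.
apply: A_star => //.
  rewrite normrZ gtr0_norm ?invr_gt0// ltr_pdivrMl// distrC.
  by rewrite /d mulrDl mulrAC mulVf ?lt0r_neq0// mul1r ltrDl mulr_gt0.
apply/andP; split; first by apply: divr_ge0; exact: ltW.
by rewrite ler_pdivrMr// mul1r lerDr ltW.
Qed.

Lemma gaugeZ c v : 0 < c -> gauge A (c *: v) = c * gauge A v.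
Proof.
suff H c' v' : 0 < c' -> c' * gauge A v' <= gauge A (c' *: v').
  move=> c0; apply/eqP; rewrite eq_le H// andbT.
  have ci : 0 < c^-1 by rewrite invr_gt0.
  have := H c^-1 (c *: v) ci.
  by rewrite scalerA mulVf ?lt0r_neq0// scale1r ler_pdivrMl.
move=> c0; apply: lb_le_inf; first by case: (S_inf (c' *: v')).
move=> t [t0 At]; rewrite -ler_pdivlMl//; apply: gauge_le_S; split.
  by rewrite mulr_gt0// invr_gt0.
by rewrite invfM invrK mulrC -scalerA.
Qed.

Lemma gauge_lt1 v : A v <-> gauge A v < 1.
Proof.
split=> [Av|].
  have /nbhs_ballP[e /= e0 eA] : nbhs v A by exact: open_nbhs_nbhs.
  pose d := e / (2 * (`|v| + 1)).
  have v1 : 0 < `|v| + 1 by rewrite ltr_wpDl.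
  have d0 : 0 < d by rewrite divr_gt0// mulr_gt0.
  have : S v (1 + d)^-1.
    split; first by rewrite invr_gt0; lra.
    apply: eA; rewrite -ball_normE /= invrK scalerDl scale1r opprD addrA subrr.
    rewrite add0r normrN normrZ gtr0_norm//.
    rewrite /d mulrAC ltr_pdivrMr ?mulr_gt0// ltr_pM2l//; have := normr_ge0 v; lra.
  move/gauge_le_S => H; apply: le_lt_trans H _.
  by rewrite invf_lt1; lra.
move=> /(inf_lt (S_inf v).1)[t St t1].
by have [] := S_up St (ltW t1); rewrite invr1 scale1r.
Qed.

End Gauge.

Lemma star_domain_bilipschitz (A : set 'rV[R]_m) (b : 'rV[R]_m) (s K : R) :
  0 < s -> 0 < K -> open A -> (forall v, A v -> `|v| <= K) -> A b ->
  (forall v w t, A v -> `|w - b| < s -> 0 <= t <= 1 ->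
    A ((1 - t) *: v + t *: w)) ->
  exists (f g : 'rV[R]_m -> 'rV[R]_m) (L : R),
    [/\ 0 < L, cancel f g /\ cancel g f,
        forall v w, `|f v - f w| <= L * `|v - w|,
        forall v w, `|g v - g w| <= L * `|v - w| &
        forall v, A v <-> `|f v| < 1].
Proof.
move=> s0 K0 oA bA Ab starA.
pose B := [set v | A (v + b)]; pose K' := K + `|b|.
have K'0 : 0 < K' by rewrite ltr_wpDr.
have oB : open B.
  have /continuousP : continuous (fun v => v + b).
    apply: (@continuous_of_lipschitz _ _ _ _ 1) => v w.
    by rewrite opprD addrACA subrr addr0 mul1r.
  exact.
have bB v : B v -> `|v| <= K'.
  move=> /bA H; rewrite -(addrK b v); apply: le_trans (ler_normD _ _) _.
  by rewrite normrN lerD2r.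
have B0 : B 0 by rewrite /B /= add0r.
have starB v w t : B v -> `|w| < s -> 0 <= t <= 1 -> B ((1 - t) *: v + t *: w).
  move=> Bv ws t01; rewrite /B /=.
  have -> : (1 - t) *: v + t *: w + b = (1 - t) *: (v + b) + t *: (w + b).
    by apply/rowP => j; rewrite !mxE; ring.
  by apply: starA => //; rewrite addrK.
have gge := gauge_ge s0 K'0 bB B0 starB.
have gle := gauge_le s0 K'0 bB B0 starB.
have glip := gauge_lipschitz s0 K'0 bB B0 starB.
have gZ := gaugeZ s0 K'0 bB B0 starB.
have g1 := gauge_lt1 s0 K'0 oB bB B0 starB.
have gge0 := gauge_ge0 s0 K'0 bB B0 starB.
set mu := gauge B in gge gle glip gZ g1 gge0.
have K'i : 0 < K'^-1 by rewrite invr_gt0.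
have si : 0 < s^-1 by rewrite invr_gt0.
have mu0 v : v != 0 -> 0 < mu v.
  by move=> v0; rewrite (lt_le_trans _ (gge v))// mulr_gt0// normr_gt0.
(* [f] is radial with [|f v| = mu v], so it carries the domain [mu < 1] onto the unit cube. At 0 the
   quotients are junk but the vector is 0, as it should be. *)
pose f v := (mu v / `|v|) *: v; pose g v := (`|v| / mu v) *: v.
have nf v : `|f v| = mu v.
  have [->|v0] := eqVneq v 0.
    rewrite /f scaler0 normr0; apply/eqP; rewrite eq_le gge0 /=.
    by have := gle 0; rewrite normr0 mulr0.
  rewrite /f normrZ ger0_norm ?divr_ge0// divfK// normr_eq0//.
have fK : cancel f g.
  move=> v; have [->|v0] := eqVneq v 0; first by rewrite /f /g !scaler0.
  rewrite /g nf /f gZ ?divr_gt0 ?mu0 ?normr_gt0// scalerA -[RHS]scale1r.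
  congr (_ *: _); field.
  by rewrite normr_eq0 v0 lt0r_neq0 ?mu0.
have gK : cancel g f.
  move=> v; have [->|v0] := eqVneq v 0; first by rewrite /f /g !scaler0.
  have nv : 0 < `|v| by rewrite normr_gt0.
  rewrite /f /g gZ ?divr_gt0 ?mu0// normrZ gtr0_norm ?divr_gt0 ?mu0//.
  rewrite scalerA -[RHS]scale1r; congr (_ *: _); field.
  by rewrite normr_eq0 v0 lt0r_neq0 ?mu0.
have nl (v w : 'rV[R]_m) : `| `|v| - `|w| | <= 1 * `|v - w|.
  by rewrite mul1r; exact: ler_dist_dist.
pose L1 := s^-1 / 1 + s^-1 / 1 + s^-1 * 1 / 1 ^+ 2.
pose L2 := 1 / K'^-1 + 1 / K'^-1 + 1 * s^-1 / K'^-1 ^+ 2.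
have f_lip v w : `|f v - f w| <= L1 * `|v - w|.
  apply: (radial_lipschitz (b := 1)) => // {}v; first by rewrite gge0 gle.
  by rewrite mul1r.
have g_lip v w : `|g v - g w| <= L2 * `|v - w|.
  by apply: (radial_lipschitz (a := 1)) => // {}v; rewrite mul1r lexx normr_ge0.
have L10 : 0 < L1 by rewrite /L1 expr1n !divr1 mulr1; lra.
have L20 : 0 < L2 by rewrite /L2 !addr_gt0 ?divr_gt0 ?mulr_gt0 ?exprn_gt0.
exists (fun v => f (v - b)), (fun v => g v + b), (L1 + L2); split.
- exact: addr_gt0.
- split=> v /=; first by rewrite fK subrK.
  by rewrite addrK gK.
- move=> v w; apply: le_trans (f_lip _ _) _.
  by rewrite opprB addrA subrK ler_wpM2r// lerDl ltW.
- move=> v w; rewrite opprD addrACA subrr addr0; apply: le_trans (g_lip _ _) _.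
  by rewrite ler_wpM2r// lerDr ltW.
- move=> v; rewrite nf; rewrite -g1 /B /= subrK//.
Qed.

End RadialMaps.

(** * Strict differentiability *)

Section MatrixBounds.
Variables (R : realType) (m k : nat).

Lemma rowE_delta (v : 'rV[R]_m) : v = \sum_i v 0 i *: delta_mx 0 i.
Proof. exact: row_sum_delta. Qed.

Lemma mulmx_bound (A : 'M[R]_(m, k)) :
  exists2 K, 0 < K & forall v : 'rV[R]_m, `|v *m A| <= K * `|v|.
Proof.
pose K := \sum_i `|delta_mx 0 i *m A : 'rV[R]_k|.
have K0 : 0 <= K by apply: sumr_ge0.
exists (K + 1); first by rewrite ltr_wpDl.
move=> v; rewrite {1}(rowE_delta v) mulmx_suml.
apply: le_trans (ler_norm_sum _ _ _) _.
apply: (@le_trans _ _ (K * `|v|)); last by rewrite ler_wpM2r// lerDl.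
rewrite mulr_suml; apply: ler_sum => i _.
by rewrite -scalemxAl normrZ mulrC ler_wpM2l// rv_coord_le.
Qed.

Lemma linear_close (f g : {linear 'rV[R]_m -> 'rV[R]_k}) d :
  (forall j, `|f (delta_mx 0 j) - g (delta_mx 0 j)| <= d) ->
  forall v, `|f v - g v| <= m%:R * d * `|v|.
Proof.
move=> fg v.
have dE (u : {linear 'rV[R]_m -> 'rV[R]_k}) : u v = \sum_i v 0 i *: u (delta_mx 0 i).
  by rewrite {1}(rowE_delta v) linear_sum; apply: eq_bigr => i _; rewrite linearZ.
rewrite (dE f) (dE g) -sumrB.
under eq_bigr do rewrite -scalerBr.
apply: le_trans (ler_norm_sum _ _ _) _.
apply: (@le_trans _ _ (\sum_(i < m) d * `|v|)).
  apply: ler_sum => i _; rewrite normrZ mulrC.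
  by apply: ler_pM => //; exact: rv_coord_le.
by rewrite sumr_const card_ord mulr_natl -mulrnAl.
Qed.

End MatrixBounds.

Section StrictDifferentiability.
Variables (R : realType) (T : topologicalType).

(** Strict differentiability at [o] in the coordinates [phi], with derivative [A]. Both points range
    over [T], so at a boundary point of a manifold no extension of [f] enters. *)
Definition strict_diff m k (phi : T -> 'rV[R]_m) (f : T -> 'rV[R]_k) (o : T)
    (A : 'M[R]_(m, k)) : Prop :=
  forall e, 0 < e -> exists2 U, nbhs o U & forall x y, U x -> U y ->
    `|f x - f y - (phi x - phi y) *m A| <= e * `|phi x - phi y|.

Lemma strict_diff_lipschitz m k (phi : T -> 'rV[R]_m) (f : T -> 'rV[R]_k) o A :
  strict_diff phi f o A -> exists2 K, 0 < K & exists2 U, nbhs o U &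
    forall x y, U x -> U y -> `|f x - f y| <= K * `|phi x - phi y|.
Proof.
move=> /(_ 1 ltr01)[U oU H]; have [K K0 KA] := mulmx_bound A.
exists (1 + K); first exact: addr_gt0.
exists U => // x y Ux Uy; rewrite -[X in `|X| <= _](subrK ((phi x - phi y) *m A)).
by rewrite (le_trans (ler_normD _ _))// mulrDl lerD// H.
Qed.

Lemma strict_diff_comp m k l (phi : T -> 'rV[R]_m) (f : T -> 'rV[R]_k)
    (g : T -> 'rV[R]_l) o A B :
  strict_diff phi f o A -> strict_diff f g o B -> strict_diff phi g o (A *m B).
Proof.
move=> fA gB e e0; have [K K0 [U oU fK]] := strict_diff_lipschitz fA.
have [L L0 BL] := mulmx_bound B.
have [V oV fV] : exists2 U, nbhs o U & forall x y, U x -> U y ->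
    `|f x - f y - (phi x - phi y) *m A| <= (e / (2 * L)) * `|phi x - phi y|.
  by apply: fA; rewrite divr_gt0// mulr_gt0.
have [W oW gW] : exists2 U, nbhs o U & forall x y, U x -> U y ->
    `|g x - g y - (f x - f y) *m B| <= (e / (2 * K)) * `|f x - f y|.
  by apply: gB; rewrite divr_gt0// mulr_gt0.
exists (U `&` (V `&` W)); first by do ! apply: filterI.
move=> x y [Ux [Vx Wx]] [Uy [Vy Wy]].
have -> : g x - g y - (phi x - phi y) *m (A *m B) =
    g x - g y - (f x - f y) *m B + (f x - f y - (phi x - phi y) *m A) *m B.
  by rewrite (mulmxBl (f x - f y)) mulmxA addrA subrK.
apply: le_trans (ler_normD _ _) _.
have -> : e * `|phi x - phi y| = (e / (2 * K)) * (K * `|phi x - phi y|)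
    + L * ((e / (2 * L)) * `|phi x - phi y|).
  by field; rewrite !lt0r_neq0.
apply: lerD.
  apply: le_trans (gW _ _ Wx Wy) _; apply: ler_wpM2l; last exact: fK.
  by rewrite divr_ge0// ltW// mulr_gt0.
apply: le_trans (BL _) _; apply: ler_wpM2l; first exact: ltW.
exact: fV.
Qed.

Lemma strict_diff_id m (phi : T -> 'rV[R]_m) o : strict_diff phi phi o 1%:M.
Proof.
move=> e e0; exists setT; first exact: filterT.
by move=> x y _ _; rewrite mulmx1 subrr normr0 mulr_ge0// ltW.
Qed.

Lemma strict_diff_near m k (phi : T -> 'rV[R]_m) (f g : T -> 'rV[R]_k) o A :
  (\forall x \near o, f x = g x) -> strict_diff phi f o A -> strict_diff phi g o A.
Proof.
move=> fg fA e e0; have [U oU H] := fA e e0.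
exists (U `&` [set x | f x = g x]); first exact: filterI.
by move=> x y [Ux <-] [Uy <-]; exact: H.
Qed.

End StrictDifferentiability.

Section StrictDiffOfC1.
Variables (R : realType) (m k : nat) (F : 'rV[R]_m -> 'rV[R]_k).

Lemma diff_lin1_mx x v : 'd F x v = v *m lin1_mx ('d F x).
Proof. by rewrite mul_rV_lin1. Qed.

Lemma segment_derive z v t i : differentiable F (z + t *: v) ->
  is_derive t 1 (fun s : R => F (z + s *: v) 0 i) ('d F (z + t *: v) v 0 i).
Proof.
move=> dF; have dv := diff_derivable (v := v) dF.
have E : (fun h : R => h^-1 *: (F (z + (h *: 1 + t) *: v) 0 i - F (z + t *: v) 0 i)) @ 0^'
    --> 'd F (z + t *: v) v 0 i.
  rewrite -deriveE//.
  have : (fun h : R => h^-1 *: (F (h *: v + (z + t *: v)) - F (z + t *: v))) @ 0^'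
     --> 'D_v F (z + t *: v) by exact: dv.
  move=> H; have := cvg_comp _ _ H (@coord_continuous R 1 k 0 i ('D_v F (z + t *: v))).
  apply: cvg_trans; apply: near_eq_cvg; near=> h.
  have -> : z + (h *: 1 + t) *: v = h *: v + (z + t *: v).
    by rewrite [h *: 1]mulr1 scalerDl addrCA.
  by rewrite /= !mxE.
have d : derivable (fun s : R => F (z + s *: v) 0 i) t 1.
  by apply/cvg_ex; exists ('d F (z + t *: v) v 0 i); exact: E.
apply: DeriveDef => //; exact: cvg_lim.
Unshelve. all: by end_near. Qed.

(** Continuity of ['d F z v] for each fixed [v] becomes uniform in [v] once tested on the finitely
    many basis vectors. *)
Lemma C1_near_diff x e : C1_near F x -> 0 < e ->
  exists2 r, 0 < r & forall z, `|z - x| < r -> differentiable F z /\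
    forall v, `|'d F z v - 'd F x v| <= e * `|v|.
Proof.
move=> C1 e0; have cx := nbhs_singleton C1.
pose d := e / (m%:R + 1); have d0 : 0 < d by rewrite divr_gt0// ltr_wpDl.
have near_e : nbhs x [set z | forall j,
    `|'d F x (delta_mx 0 j) - 'd F z (delta_mx 0 j)| < d].
  apply: nbhs_forall => j; 
  by have /cvgrPdist_lt/(_ d d0) := cx.2 (delta_mx 0 j).
have /nbhs_ballP[r /= r0 H] : nbhs x [set z | differentiable F z /\
    forall j, `|'d F x (delta_mx 0 j) - 'd F z (delta_mx 0 j)| < d].
  by apply: filterS2 C1 near_e => z [].
exists r => // z zx; have [|dz dj] := H z; first by rewrite -ball_normE /= distrC.
split=> // v; rewrite distrC.
apply: le_trans (@linear_close _ _ _ ('d F x) ('d F z) d _ v) _.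
  by move=> j; exact: ltW.
rewrite ler_wpM2r// /d mulrCA ler_piMr// ?(ltW e0)//.
by rewrite ler_pdivrMr ?ltr_wpDl// mul1r lerDl.
Qed.

(** The mean value theorem on the segment from [z] to [y], one coordinate at a time; the
    intermediate points differ between coordinates, which the sup norm tolerates. *)
Lemma C1_near_strict_diff x : C1_near F x -> strict_diff id F x (lin1_mx ('d F x)).
Proof.
move=> C1 e e0; have [r r0 H] := C1_near_diff C1 e0.
exists [set z | `|z - x| < r].
  apply/nbhs_ballP; exists r => // z; rewrite -ball_normE /=.
  by rewrite distrC.
move=> y z /= yr zr; rewrite -diff_lin1_mx rv_norm_le; last first.
  by rewrite mulr_ge0// ltW.
apply/forallP => i; rewrite 3!mxE.
pose v : 'rV[R]_m := y - z; pose g (s : R) : R := F (z + s *: v) 0 i.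
have seg (s : R) : 0 <= s <= 1 -> `|z + s *: v - x| < r.
  move=> /andP[s0 s1].
  have -> : z + s *: v - x = (1 - s) *: (z - x) + s *: (y - x).
    by apply/rowP => j; rewrite !mxE; ring.
  apply: le_lt_trans (ler_normD _ _) _.
  rewrite !normrZ !ger0_norm ?subr_ge0//.
  have [->|sn0] := eqVneq s 0; first by rewrite subr0 mul1r mul0r addr0.
  have : s * `|y - x| < s * r by rewrite ltr_pM2l// lt_neqAle eq_sym sn0.
  have : (1 - s) * `|z - x| <= (1 - s) * r by rewrite ler_wpM2l ?subr_ge0// ltW.
  lra.
have dg (s : R) : 0 <= s <= 1 -> is_derive s 1 g ('d F (z + s *: v) v 0 i).
  by move=> s01; apply: segment_derive; have [] := H _ (seg _ s01).
have [||s s01 E] := @MVT _ g (fun s => 'd F (z + s *: v) v 0 i) 0 1 ltr01.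
- by move=> s; rewrite in_itv /= => /andP[s0 s1]; apply: dg; rewrite !ltW.
- apply: derivable_within_continuous => s; rewrite in_itv /= => s01.
  by have [] := dg s s01.
have -> : F y 0 i = g 1 by rewrite /g scale1r /v addrC subrK.
have -> : F z 0 i = g 0 by rewrite /g scale0r addr0.
rewrite mxE E subr0 mulr1.
move: s01; rewrite in_itv /= => /andP[s0 s1].
have [|_ /(_ v) Hv] := H (z + s *: v); first by apply: seg; rewrite !ltW.
by apply: le_trans Hv; have := rv_coord_le ('d F (z + s *: v) v - 'd F x v) i; rewrite !mxE.
Qed.

End StrictDiffOfC1.

(** * Half-spaces and charts *)

Section HalfSpaces.
Variables (R : realType) (m : nat).
Implicit Types (H : set 'rV[R]_m) (x b v : 'rV[R]_m).

Definition chart_model_set H : Prop := H = [set: 'rV[R]_m] \/ closed_half_space H.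

Lemma mulmx_col_continuous (u : 'cV[R]_m) :
  continuous (fun x : 'rV[R]_m => (x *m u) 0 0).
Proof.
have [K K0 HK] := mulmx_bound u.
apply: (@continuous_of_lipschitz _ _ _ _ K) => x y.
have -> : (x *m u) 0 0 - (y *m u) 0 0 = ((x - y) *m u) 0 0.
  by rewrite mulmxBl !mxE.
by apply: le_trans (HK _); exact: rv_coord_le.
Qed.

Lemma model_closed H : chart_model_set H -> closed H.
Proof.
move=> [->|[u [c [_ ->]]]]; first exact: closedT.
have /continuous_closedP := @mulmx_col_continuous u.
by move/(_ [set r | c <= r]); apply; exact: closed_ge.
Qed.

Lemma model_convex H x y t : chart_model_set H -> H x -> H y -> 0 <= t <= 1 ->
  H ((1 - t) *: x + t *: y).
Proof.
move=> [-> *|[u [c [_ ->]]] /= xc yc /andP[t0 t1]]; first exact: I.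
rewrite mulmxDl -!scalemxAl mxE [X in X + _]mxE [X in _ + X]mxE.
have -> : c = (1 - t) * c + t * c by ring.
by apply: lerD; apply: ler_wpM2l; rewrite ?subr_ge0.
Qed.

(** The homothety of center [x] and ratio [t] carries a ball around [b] to a ball around the given
    point, and preserves [H] by convexity. *)
Lemma model_interior_segment H x b t : chart_model_set H -> H x -> H° b ->
  0 < t <= 1 -> H° ((1 - t) *: x + t *: b).
Proof.
move=> mH Hx /nbhs_ballP[e /= e0 eH] /andP[t0 t1].
apply/nbhs_ballP; exists (t * e) => /=; first exact: mulr_gt0.
move=> y; rewrite -ball_normE /= => yb.
pose z := b + t^-1 *: (y - ((1 - t) *: x + t *: b)).
have -> : y = (1 - t) *: x + t *: z.
  rewrite /z scalerDr scalerA divff ?lt0r_neq0// scale1r addrA.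
  by rewrite [X in X + _]addrC addrC -addrA addrC; apply/rowP => j; rewrite !mxE; ring.
apply: model_convex => //; last by rewrite (ltW t0).
apply: eH; rewrite -ball_normE /= /z opprD addrA subrr add0r normrN normrZ.
by rewrite gtr0_norm ?invr_gt0// ltr_pdivrMl// distrC.
Qed.

Lemma model_interior_dense H x e : chart_model_set H -> H x -> 0 < e ->
  exists2 b, H° b & `|b - x| < e.
Proof.
move=> [-> _|[u [c [u0 ->]]] /= xc] e0.
  by exists x; [rewrite interiorT|rewrite subrr normr0].
(* The inward normal: [n *m u] is the sum of the squares of the entries of [u]. *)
pose n : 'rV[R]_m := u^T.
have nu : 0 < (n *m u) 0 0.
  rewrite mxE lt_neqAle eq_sym; apply/andP; split; last first.
    by apply: sumr_ge0 => i _; rewrite mxE -expr2 sqr_ge0.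
  apply: contraNneq u0 => /eqP; rewrite psumr_eq0; last first.
    by move=> i _; rewrite mxE -expr2 sqr_ge0.
  move=> /allP u_eq0; apply/eqP/colP => i; rewrite mxE.
  by have := u_eq0 i (mem_index_enum _); rewrite mxE mulf_eq0 orbb => /eqP.
pose t := e / (2 * (`|n| + 1)).
have n1 : 0 < `|n| + 1 by rewrite ltr_wpDl.
have t0 : 0 < t by rewrite divr_gt0// mulr_gt0.
exists (x + t *: n).
  have /continuousP/(_ [set r | c < r]) := @mulmx_col_continuous u.
  have og : open [set r : R | c < r] by exact: open_gt.
  move=> /(_ og) oc; apply: (@filterS _ (nbhs (x + t *: n))); last first.
    apply: open_nbhs_nbhs; split; first exact: oc.
    rewrite /= mulmxDl -scalemxAl mxE [X in _ + X]mxE.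
    by have := mulr_gt0 t0 nu; lra.
  by move=> y /= /ltW.
rewrite addrC addKr normrZ gtr0_norm// /t mulrAC ltr_pdivrMr ?mulr_gt0//.
by rewrite ltr_pM2l//; have := normr_ge0 n; lra.
Qed.

End HalfSpaces.

Section Charts.
Variables (R : realType) (m : nat) (M : topologicalType).
Implicit Types (c : chart R m M) (o x : M).

Definition chart_ball c o (r : R) : set M :=
  [set x | chart_dom c x /\ `|chart_map c x - chart_map c o| < r].

Lemma chart_invK c x : chart_dom c x -> chart_inv c (chart_map c x) = x.
Proof. by move=> cx; apply: chart_mapK; exact: mem_set. Qed.

Lemma chart_map_inj c x y : chart_dom c x -> chart_dom c y ->
  chart_map c x = chart_map c y -> x = y.
Proof. by move=> cx cy E; rewrite -(chart_invK cx) E chart_invK. Qed.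

Lemma chart_map_model c x : chart_dom c x -> chart_model c (chart_map c x).
Proof.
move=> cx; have [U _ E] := chart_image_open c.
have : (chart_map c @` chart_dom c) (chart_map c x) by exists x.
by rewrite E => -[].
Qed.

Lemma chart_dom_nbhs c o : chart_dom c o -> nbhs o (chart_dom c).
Proof. by move=> co; apply: open_nbhs_nbhs; split=> //; exact: chart_dom_open. Qed.

Lemma chart_map_cvg c o : chart_dom c o -> chart_map c x @[x --> o] --> chart_map c o.
Proof.
move=> co; have /subspace_continuousP/(_ o co) := @chart_map_continuous _ _ _ c.
rewrite (_ : within _ _ = nbhs o)//.
apply/seteqP; split=> A; rewrite /within /= => H; last by apply: filterS H.
by apply: filterS2 (chart_dom_nbhs co) H => x cx; apply.
Qed.

Lemma chart_ball_nbhs c o r : chart_dom c o -> 0 < r -> nbhs o (chart_ball c o r).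
Proof.
move=> co r0; apply: filterI; first exact: chart_dom_nbhs.
have := (chart_map_cvg co) [set y | `|y - chart_map c o| < r]; apply.
apply/nbhs_ballP; exists r => // y; rewrite -ball_normE /=.
by rewrite distrC.
Qed.

(** [chart_inv] means something only on the image of the chart. This gives a radius within which
    every point of the model belongs to that image. *)
Lemma chart_local c o (W : set M) : chart_dom c o -> nbhs o W ->
  exists2 r, 0 < r & forall y, chart_model c y -> `|y - chart_map c o| < r ->
    [/\ chart_dom c (chart_inv c y), chart_map c (chart_inv c y) = y &
        W (chart_inv c y)].
Proof.
move=> co oW; have [U oU E] := chart_image_open c.
have io : (chart_map c @` chart_dom c) (chart_map c o) by exists o.
have Uo : nbhs (chart_map c o) U.
  by apply: open_nbhs_nbhs; split=> //; move: io; rewrite E => -[].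
have := @chart_inv_continuous _ _ _ c.
move=> /subspace_continuousP/(_ _ io) cv.
have /cv Wo : nbhs (chart_inv c (chart_map c o)) W by rewrite chart_invK.
have /nbhs_ballP[r /= r0 H] : nbhs (chart_map c o)
  (U `&` [set y | (chart_map c @` chart_dom c) y -> W (chart_inv c y)]).
  exact: filterI.
exists r => // y my yo.
have [Uy Wy] : (U `&` [set y | (chart_map c @` chart_dom c) y ->
   W (chart_inv c y)]) y by apply: H; rewrite -ball_normE /= distrC.
have iy : (chart_map c @` chart_dom c) y by rewrite E.
split; last exact: Wy.
  by case: iy => x cx <-; rewrite chart_invK.
by case: iy => x cx <-; rewrite chart_invK.
Qed.

Lemma chart_inv_cvg c y (W : set M) :
  chart_dom c (chart_inv c y) -> chart_map c (chart_inv c y) = y ->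
  nbhs (chart_inv c y) W ->
  exists2 r, 0 < r & forall z, chart_model c z -> `|z - y| < r -> W (chart_inv c z).
Proof.
move=> cy Ey yW; have [r r0 H] := chart_local cy yW.
by exists r => // z mz zy; have [|_ _ //] := H z mz; rewrite Ey.
Qed.

(** For small [s] the set is the image of a compact part of the model under [chart_inv c], hence
    closed in the whole Hausdorff space and not only in the chart domain. Extending bump functions
    by 0 and stopping paths at their first exit both rest on this. *)
Lemma chart_closed_ball c o : hausdorff_space M -> chart_dom c o ->
  exists2 r, 0 < r & forall s, s <= r ->
    closed [set x | chart_dom c x /\ `|chart_map c x - chart_map c o| <= s].
Proof.
move=> hM co; have [r r0 H] := chart_local co (filterT : nbhs o setT).
exists (r / 2); first by rewrite divr_gt0.
move=> s sr.
pose K := chart_model c `&` [set y | `|y - chart_map c o| <= s].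
have lt_r y : `|y - chart_map c o| <= s -> `|y - chart_map c o| < r by lra.
have cK : compact K.
  apply: bounded_closed_compact.
    exists (`|chart_map c o| + s); split; first exact: num_real.
    move=> x xb y [_ /= yo]; apply/ltW; apply: le_lt_trans xb.
    rewrite -(subrK (chart_map c o) y) (le_trans (ler_normD _ _))//.
    by rewrite addrC lerD2l.
  apply: closedI; first exact: model_closed (@chart_modelP _ _ _ c).
  have cn : continuous (fun y : 'rV[R]_m => `|y - chart_map c o| : R).
    apply: (@continuous_of_lipschitz _ _ _ _ 1) => x y.
    rewrite mul1r; apply: le_trans (ler_dist_dist _ _) _.
    by rewrite opprB addrA subrK.
  move/continuous_closedP: cn => /(_ [set t | t <= s]); apply; exact: closed_le.
have -> : [set x | chart_dom c x /\ `|chart_map c x - chart_map c o| <= s] =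
    chart_inv c @` K.
  apply/seteqP; split=> x /=.
    move=> [cx xo]; exists (chart_map c x); last exact: chart_invK.
    by split=> //; exact: chart_map_model.
  move=> [y [my /= yo] <-]; have [|dy Ey _] := H y my; first exact: lt_r.
  by rewrite Ey.
apply: compact_closed hM _; apply: continuous_compact cK.
apply: continuous_subspaceW (@chart_inv_continuous _ _ _ c).
move=> y [my /= yo]; have [|dy Ey _] := H y my; first exact: lt_r.
by exists (chart_inv c y).
Qed.

(** At a boundary point only inward directions can be tested, but for every [v] one of [v] and [- v]
    is inward, and these determine a linear map. *)
Lemma strict_diff_unique c k o (f : M -> 'rV[R]_k) A B : chart_dom c o ->
  strict_diff (chart_map c) f o A -> strict_diff (chart_map c) f o B -> A = B.
Proof.
move=> co fA fB.
suff E (v : 'rV[R]_m) : v *m (A - B) = 0.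
  apply/eqP; rewrite -subr_eq0; apply/eqP/row_matrixP => i.
  by rewrite rowE E row0.
wlog inward : v / exists2 r, 0 < r & forall t, 0 < t < r ->
    chart_model c (chart_map c o + t *: v).
  move=> W; case: (@chart_modelP _ _ _ c) => [E|[u [d [_ E]]]].
    by apply: W; exists 1 => // t _; rewrite E.
  have mo := chart_map_model co; rewrite E /= in mo.
  have [vu|vu] := leP 0 ((v *m u) 0 0).
    apply: W; exists 1 => // t /andP[t0 _]; rewrite E /= mulmxDl -scalemxAl mxE.
    by rewrite [X in _ + X]mxE ler_wpDr// mulr_ge0// ltW.
  apply/eqP; rewrite -oppr_eq0 -mulNmx; apply/eqP; apply: W.
  exists 1 => // t /andP[t0 _]; rewrite E /= mulmxDl -scalemxAl mxE.
  rewrite [X in _ + X]mxE ler_wpDr// mulr_ge0 ?(ltW t0)// mulNmx mxE.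
  by rewrite oppr_ge0 ltW.
have [r r0 rv] := inward.
apply/eqP; rewrite -normr_le0; apply/ler_addgt0Pr => e e0; rewrite add0r.
pose d := e / (2 * (`|v| + 1)); have v1 : 0 < `|v| + 1 by rewrite ltr_wpDl.
have d0 : 0 < d by rewrite divr_gt0// mulr_gt0.
have [U oU HU] := fA d d0; have [W oW HW] := fB d d0.
have [s s0 Hs] := chart_local co (filterI oU oW).
pose t := Num.min (r / 2) (s / (2 * (`|v| + 1))).
have t0 : 0 < t by rewrite lt_min !divr_gt0// mulr_gt0.
have tr : t < r.
  have : t <= r / 2 by rewrite /t ge_min lexx.
  by lra.
have ts : t * `|v| < s.
  have : t <= s / (2 * (`|v| + 1)) by rewrite /t ge_min lexx orbT.
  rewrite ler_pdivlMr ?mulr_gt0//; have := normr_ge0 v; have := mulr_ge0 (ltW t0) (normr_ge0 v).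
  by lra.
have mt : chart_model c (chart_map c o + t *: v) by apply: rv; rewrite t0 tr.
have [|dx Ex [Ux Wx]] := Hs _ mt.
  by rewrite addrC addKr normrZ gtr0_norm.
have Uo := nbhs_singleton oU; have Wo := nbhs_singleton oW.
have := HU _ _ Ux Uo; have := HW _ _ Wx Wo; rewrite Ex.
rewrite [chart_map c o + _ - _]addrC addKr normrZ gtr0_norm// => h1 h2.
set D := f _ - f o in h1 h2.
have : `|(t *: v) *m (A - B)| <= d * (t * `|v|) + d * (t * `|v|).
  have -> : (t *: v) *m (A - B) = (D - (t *: v) *m B) - (D - (t *: v) *m A).
    by rewrite mulmxBr opprB [RHS]addrC addrA subrK.
  by rewrite (le_trans (ler_normB _ _))// lerD.
rewrite -scalemxAl normrZ gtr0_norm// => h.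
have {h} : `|v *m (A - B)| <= d * `|v| + d * `|v|.
  by rewrite -(ler_pM2l t0) mulrDr !(mulrCA t).
move/le_trans; apply; rewrite /d.
have -> : e / (2 * (`|v| + 1)) * `|v| + e / (2 * (`|v| + 1)) * `|v| =
   e * (`|v| / (`|v| + 1)) by field; rewrite lt0r_neq0.
by rewrite ler_piMr// ?ler_pdivrMr ?mul1r ?lerDl ?ltW.
Qed.

End Charts.

Section Transitions.
Variables (R : realType) (m : nat) (M : C1_manifold R m).
Implicit Types (c : chart R m M) (p : M).

Lemma transition_strict_diff c1 c2 p F : chart_dom c1 p -> chart_dom c2 p ->
  C1_extension (transition_dom c1 c2) (transition c1 c2) (chart_map c1 p) F ->
  strict_diff (chart_map c1) (chart_map c2) p (lin1_mx ('d F (chart_map c1 p))).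
Proof.
move=> c1p c2p [C1F EF].
have H : strict_diff (chart_map c1) (F \o chart_map c1) p
    (lin1_mx ('d F (chart_map c1 p))).
  move=> e e0; have [U oU HU] := C1_near_strict_diff C1F e0.
  exists (chart_map c1 @^-1` U); first exact: (chart_map_cvg c1p).
  by move=> x y; exact: HU.
apply: (@strict_diff_near R M m m _ (F \o chart_map c1) _ p _ _ H).
have {}EF : nbhs p [set x | transition_dom c1 c2 (chart_map c1 x) ->
    F (chart_map c1 x) = transition c1 c2 (chart_map c1 x)] := chart_map_cvg c1p EF.
apply: filterS2 (filterI (chart_dom_nbhs c1p) (chart_dom_nbhs c2p)) EF.
move=> x [c1x c2x] /= ->.
  by rewrite /transition /= chart_invK.
by exists x.
Qed.

Lemma atlas_strict_diff c1 c2 p : chart_at p c1 -> chart_at p c2 ->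
  exists A, strict_diff (chart_map c1) (chart_map c2) p A.
Proof.
move=> [a1 c1p] [a2 c2p].
have [|F HF] := atlas_C1 a1 a2 (x := chart_map c1 p); first by exists p.
by eexists; exact: transition_strict_diff HF.
Qed.

End Transitions.

(** * Embedding of a compact manifold *)

Lemma compact_seq_cover (T : topologicalType) (I : choiceType) (f : I -> set T) :
  compact [set: T] -> (forall x : T, exists i, nbhs x (f i)) ->
  exists s : seq I, forall x, exists2 i, i \in s & f i x.
Proof.
move=> /compact_near_coveringP cT cov.
(* The filter of the sequences that contain a given finite one: a property near it holds for all
   large enough sequences, and compactness makes this uniform in the point. *)
pose F : set_system (seq I) :=
  [set P | exists s0 : seq I, forall s : seq I, {subset s0 <= s} -> P s].
have FF : Filter F.
  split=> [|P Q [s0 HP] [s1 HQ]|P Q PQ [s0 HP]].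
  - by exists [::].
  - exists (s0 ++ s1) => s ss; split.
      by apply: HP => i is0; apply: ss; rewrite mem_cat is0.
    by apply: HQ => i is1; apply: ss; rewrite mem_cat is1 orbT.
  - by exists s0 => s /HP/PQ.
have [x _|s0 H] := cT _ F (fun s x => exists2 i, i \in s & f i x) FF.
  have [i fi] := cov x.
  exists (f i, [set s : seq I | i \in s]).
    by split=> //; exists [:: i] => s; apply; rewrite mem_head.
  by move=> [y s] /= [fy si]; exists i.
by exists s0 => x; apply: H.
Qed.

Lemma rv_subE (R : realType) k (a b : 'rV[R]_k) j : (a - b) 0 j = a 0 j - b 0 j.
Proof. by rewrite !mxE. Qed.

Lemma rv_sub3E (R : realType) k (a b c : 'rV[R]_k) j :
  (a - b - c) 0 j = a 0 j - b 0 j - c 0 j.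
Proof. by rewrite !mxE. Qed.

(** * Calculus of strictly differentiable scalar functions *)

Section RealStrictDiff.
Variables (R : realType) (T : topologicalType) (m : nat).
Variables (phi : T -> 'rV[R]_m) (o : T).
Hypothesis phi_cvg : phi x @[x --> o] --> phi o.

Definition real_strict_diff (f : T -> R) : Prop :=
  exists a : 'cV[R]_m, forall e, 0 < e -> exists2 U, nbhs o U &
    forall x y, U x -> U y ->
      `|f x - f y - ((phi x - phi y) *m a) 0 0| <= e * `|phi x - phi y|.

Lemma real_strict_diff_lipschitz f : real_strict_diff f ->
  exists2 K, 0 < K & exists2 U, nbhs o U &
    forall x y, U x -> U y -> `|f x - f y| <= K * `|phi x - phi y|.
Proof.
move=> [a /(_ 1 ltr01)[U oU H]]; have [K K0 Ka] := mulmx_bound a.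
exists (1 + K); first exact: addr_gt0.
exists U => // x y Ux Uy.
rewrite -[X in `|X| <= _](subrK (((phi x - phi y) *m a) 0 0)).
rewrite (le_trans (ler_normD _ _))// mulrDl lerD// ?H//.
by apply: le_trans (Ka _); exact: rv_coord_le.
Qed.

Lemma real_strict_diff_near_lt f e : real_strict_diff f -> 0 < e ->
  nbhs o [set x | `|f x - f o| < e].
Proof.
move=> /real_strict_diff_lipschitz[K K0 [U oU H]] e0.
have eK : 0 < e / K by rewrite divr_gt0.
have oV : nbhs o (phi @^-1` [set y | `|y - phi o| < e / K]).
  apply: phi_cvg.
  by apply/nbhs_ballP; exists (e / K) => // y; rewrite -ball_normE /= distrC.
have Uo := nbhs_singleton oU.
apply: filterS2 oU oV => x Ux /= xo.
apply: le_lt_trans (H _ _ Ux Uo) _.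
by rewrite mulrC -ltr_pdivlMr.
Qed.

Lemma real_strict_diff_ext f g : nbhs o [set x | f x = g x] ->
  real_strict_diff f -> real_strict_diff g.
Proof.
move=> fg [a H]; exists a => e e0; have [U oU HU] := H e e0.
exists (U `&` [set x | f x = g x]); first exact: filterI.
by move=> x y [Ux <-] [Uy <-]; exact: HU.
Qed.

Lemma real_strict_diff_cst (r : R) : real_strict_diff (fun=> r).
Proof.
exists 0 => e e0; exists setT; first exact: filterT.
by move=> x y _ _; rewrite mulmx0 mxE !subrr normr0 mulr_ge0// ltW.
Qed.

Lemma real_strict_diff_coord k (f : T -> 'rV[R]_k) A j :
  strict_diff phi f o A -> real_strict_diff (fun x => f x 0 j).
Proof.
move=> fA; exists (col j A) => e /fA[U oU H]; exists U => // x y Ux Uy.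
have := rv_coord_le (f x - f y - (phi x - phi y) *m A) j.
have -> : ((phi x - phi y) *m col j A) 0 0 = ((phi x - phi y) *m A) 0 j.
  by rewrite colE mulmxA -colE mxE.
rewrite rv_sub3E; by move/le_trans; apply; exact: H.
Qed.

Lemma real_strict_diffD f g : real_strict_diff f -> real_strict_diff g ->
  real_strict_diff (fun x => f x + g x).
Proof.
move=> [a fa] [b gb]; exists (a + b) => e e0.
have e2 : 0 < e / 2 by rewrite divr_gt0.
have [U oU HU] := fa _ e2; have [V oV HV] := gb _ e2.
exists (U `&` V); first exact: filterI.
move=> x y [Ux Vx] [Uy Vy]; rewrite mulmxDr mxE.
have -> : f x + g x - (f y + g y) - (((phi x - phi y) *m a) 0 0 +
    ((phi x - phi y) *m b) 0 0) = (f x - f y - ((phi x - phi y) *m a) 0 0) +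
    (g x - g y - ((phi x - phi y) *m b) 0 0) by ring.
apply: le_trans (ler_normD _ _) _; rewrite [e]splitr mulrDl.
by rewrite lerD ?HU ?HV.
Qed.

Lemma real_strict_diffM f g : real_strict_diff f -> real_strict_diff g ->
  real_strict_diff (fun x => f x * g x).
Proof.
move=> sf sg; have [a fa] := sf; have [b gb] := sg.
exists (f o *: b + g o *: a) => e e0.
have [K K0 Ka] := mulmx_bound a; have [L L0 Lb] := mulmx_bound b.
(* The coefficients of the four error terms of the decomposition below add up to [C]. *)
pose C := `|f o| + `|g o| + 2 + K + L.
have C0 : 0 < C by rewrite /C; have := normr_ge0 (f o); have := normr_ge0 (g o); lra.
pose d := e / (2 * C).
have d0 : 0 < d by rewrite divr_gt0// mulr_gt0.
have [U oU HU] := fa _ d0; have [V oV HV] := gb _ d0.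
have min0 : 0 < Num.min 1 d by rewrite lt_min ltr01.
exists (U `&` V `&` ([set x | `|f x - f o| < Num.min 1 d] `&`
   [set x | `|g x - g o| < Num.min 1 d])).
  by do ! apply: filterI => //; exact: real_strict_diff_near_lt.
move=> x y [[Ux Vx] [/= fx gx]] [[Uy Vy] [/= fy gy]].
move: fx fy gx gy; rewrite !lt_min => /andP[fx1 fx] _ _ /andP[gy1 gy].
set v := phi x - phi y; set A := (v *m a) 0 0; set B := (v *m b) 0 0.
have -> : (v *m (f o *: b + g o *: a)) 0 0 = f o * B + g o * A.
  by rewrite mulmxDr -!scalemxAr mxE [X in X + _]mxE [X in _ + X]mxE.
have -> : f x * g x - f y * g y - (f o * B + g o * A) =
   f x * (g x - g y - B) + (f x - f o) * B +
   (g y * (f x - f y - A) + (g y - g o) * A) by ring.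
have nA : `|A| <= K * `|v| by apply: le_trans (Ka _); exact: rv_coord_le.
have nB : `|B| <= L * `|v| by apply: le_trans (Lb _); exact: rv_coord_le.
have nf : `|f x| <= `|f o| + 1.
  by have := ler_normD (f x - f o) (f o); rewrite subrK; lra.
have ng : `|g y| <= `|g o| + 1.
  by have := ler_normD (g y - g o) (g o); rewrite subrK; lra.
apply: le_trans (ler_normD _ _) _.
apply: (@le_trans _ _ (((`|f o| + 1) * (d * `|v|) + d * (L * `|v|)) +
  ((`|g o| + 1) * (d * `|v|) + d * (K * `|v|)))).
  apply: lerD; apply: le_trans (ler_normD _ _) _; rewrite !normrM;
    apply: lerD; apply: ler_pM => //; try exact: ltW; [exact: HV|exact: HU].
have -> : ((`|f o| + 1) * (d * `|v|) + d * (L * `|v|)) +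
  ((`|g o| + 1) * (d * `|v|) + d * (K * `|v|)) = (d * C) * `|v|.
  by rewrite /C; ring.
rewrite ler_wpM2r// /d.
have -> : e / (2 * C) * C = e / 2 by field; rewrite lt0r_neq0.
by lra.
Qed.

Lemma real_strict_diff_sum (I : finType) (f : I -> T -> R) :
  (forall i, real_strict_diff (f i)) -> real_strict_diff (fun x => \sum_i f i x).
Proof.
move=> H.
suff S s : real_strict_diff (fun x => \sum_(i <- s) f i x) by exact: S.
elim: s => [|i s IH].
  under eq_fun do rewrite big_nil; exact: real_strict_diff_cst.
under eq_fun do rewrite big_cons; exact: real_strict_diffD.
Qed.

(** The positive part itself has a corner at 0; its square is of class C^1, which is all the
    smoothness that the bump functions need. *)
Definition pos_sqr (r : R) : R := Num.max 0 r * Num.max 0 r.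

Lemma pos_sqr_gt0 r : (0 < pos_sqr r) = (0 < r).
Proof.
rewrite /pos_sqr; case: (ltP 0 r) => r0; last by rewrite mulr0 ltxx.
exact: mulr_gt0.
Qed.

(** Where [f o > 0] the function is locally [f * f]. Otherwise its derivative is 0: a difference of
    squares is the sum of the positive parts, which is small near [o], times their difference, which
    is Lipschitz. *)
Lemma real_strict_diff_pos_sqr f : real_strict_diff f ->
  real_strict_diff (fun x => pos_sqr (f x)).
Proof.
move=> sf; have [fo|fo] := ltP 0 (f o).
  apply: (real_strict_diff_ext _ (real_strict_diffM sf sf)).
  apply: filterS (real_strict_diff_near_lt sf fo) => x /=.
  by rewrite ltr_norml /pos_sqr => xo; rewrite max_r//; lra.
have [K K0 [U oU HU]] := real_strict_diff_lipschitz sf.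
exists 0 => e e0; pose d := e / (2 * K).
have d0 : 0 < d by rewrite divr_gt0// mulr_gt0.
exists (U `&` [set x | `|f x - f o| < d]).
  by apply: filterI => //; exact: real_strict_diff_near_lt.
move=> x y [Ux /= fx] [Uy /= fy]; rewrite mulmx0 mxE subr0.
have small z : `|f z - f o| < d -> 0 <= Num.max 0 (f z) <= d.
  by rewrite ltr_norml le_max lexx ge_max (ltW d0) /=; lra.
have /andP[x0 xd] := small _ fx; have /andP[y0 yd] := small _ fy.
have -> : pos_sqr (f x) - pos_sqr (f y) =
  (Num.max 0 (f x) + Num.max 0 (f y)) * (Num.max 0 (f x) - Num.max 0 (f y)).
  by rewrite /pos_sqr; ring.
have lip : `|Num.max 0 (f x) - Num.max 0 (f y)| <= `|f x - f y|.
  move: (f x) (f y) => r s; rewrite ler_norml.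
  have := ler_norm (r - s); have := ler_norm (s - r); rewrite (distrC s).
  have := normr_ge0 (r - s).
  by case: (leP 0 r); case: (leP 0 s); lra.
rewrite normrM (ger0_norm (addr_ge0 x0 y0)).
apply: (@le_trans _ _ ((d + d) * (K * `|phi x - phi y|))).
  by apply: ler_pM => //; [exact: addr_ge0|exact: lerD|exact: le_trans lip (HU _ _ Ux Uy)].
have -> : (d + d) * (K * `|phi x - phi y|) = e * `|phi x - phi y|.
  by rewrite /d; field; rewrite lt0r_neq0.
exact: lexx.
Qed.

Lemma strict_diff_of_coords k (f : T -> 'rV[R]_k) :
  (forall j, real_strict_diff (fun x => f x 0 j)) -> exists A, strict_diff phi f o A.
Proof.
move=> H; have [a Ha] := choice H.
exists (\matrix_(i, j) a j i 0) => e e0.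
have [U HU] : {U : 'I_k -> set T | forall j, nbhs o (U j) /\
    forall x y, U j x -> U j y ->
      `|f x 0 j - f y 0 j - ((phi x - phi y) *m a j) 0 0| <= e * `|phi x - phi y|}.
  have H' j : exists V : set T, nbhs o V /\ forall x y, V x -> V y ->
      `|f x 0 j - f y 0 j - ((phi x - phi y) *m a j) 0 0| <= e * `|phi x - phi y|.
    by have [V oV HV] := Ha j e e0; exists V.
  by have [U HU] := choice H'; exists U.
exists [set x | forall j, U j x]; first by apply: nbhs_forall => j; case: (HU j).
move=> x y Ux Uy; rewrite rv_norm_le; last by rewrite mulr_ge0// ltW.
apply/forallP => j; have [_ /(_ _ _ (Ux j) (Uy j))] := HU j.
set v := phi x - phi y.
have -> : (v *m a j) 0 0 = (v *m (\matrix_(i, j) a j i 0)) 0 j.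
  by rewrite !mxE; apply: eq_bigr => i _; rewrite !mxE.
by rewrite rv_sub3E.
Qed.

End RealStrictDiff.

Section Embedding.
Variables (R : realType) (m : nat) (M : C1_manifold R m).
Implicit Types (c : chart R m M) (p o x : M).

(** [r ^+ 2] minus the squared Euclidean distance to [p] in the chart, spelled with sums and
    products only to match the rules for [real_strict_diff]. *)
Definition bump_arg c p (r : R) x : R :=
  r * r + (-1) * \sum_j (chart_map c x 0 j + - chart_map c p 0 j) *
                        (chart_map c x 0 j + - chart_map c p 0 j).

Definition bump c p (r : R) x : R :=
  if `[< chart_dom c x >] then pos_sqr (bump_arg c p r x) else 0.

Lemma bumpE c p r x : chart_dom c x -> bump c p r x = pos_sqr (bump_arg c p r x).
Proof. by move=> cx; rewrite /bump asboolT. Qed.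

Lemma bump_gt0 c p r x : 0 < bump c p r x -> chart_dom c x.
Proof. by rewrite /bump; case: asboolP => //; rewrite ltxx. Qed.

Lemma bump_arg_center c p r : bump_arg c p r p = r * r.
Proof.
rewrite /bump_arg big1 ?mulr0 ?addr0// => j _.
by rewrite subrr mulr0.
Qed.

Lemma bump_arg_far c p r x : 0 <= r ->
  r < `|chart_map c x - chart_map c p| -> bump_arg c p r x < 0.
Proof.
move=> r0 xr; set v := chart_map c x - chart_map c p in xr *.
have [v0|[j vj]] := rv_normP v; first by move: xr; rewrite v0 normr0 ltNge r0.
have sq i : 0 <= (chart_map c x 0 i + - chart_map c p 0 i) *
                 (chart_map c x 0 i + - chart_map c p 0 i).
  by rewrite -expr2 sqr_ge0.
have : r * r < `|v 0 j| * `|v 0 j| by rewrite -vj ltr_pM.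
rewrite -normrM ger0_norm -?expr2 ?sqr_ge0// expr2.
have -> : v 0 j = chart_map c x 0 j + - chart_map c p 0 j by rewrite /v !mxE.
rewrite /bump_arg (bigD1 j)//= => H.
have := sumr_ge0 (P := fun i => i != j) (F := fun i =>
  (chart_map c x 0 i + - chart_map c p 0 i) *
  (chart_map c x 0 i + - chart_map c p 0 i)) (index_enum _) (fun i _ => sq i).
lra.
Qed.

Lemma bump_arg_strict_diff c c' p r o : chart_at o c -> chart_at o c' ->
  real_strict_diff (chart_map c') o (bump_arg c p r).
Proof.
move=> co c'o; have [A HA] := atlas_strict_diff c'o co.
have cv := chart_map_cvg c'o.2.
apply: real_strict_diffD; first exact: real_strict_diff_cst.
apply: real_strict_diffM => //; first exact: real_strict_diff_cst.
apply: real_strict_diff_sum => j.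
by apply: real_strict_diffM => //; apply: real_strict_diffD;
  [exact: real_strict_diff_coord HA|exact: real_strict_diff_cst|
   exact: real_strict_diff_coord HA|exact: real_strict_diff_cst].
Qed.

(** If [o] is outside the domain of [c], it is outside the closed chart ball, whose complement is
    open, and the bump vanishes there. So [f] matters only in the chart domain, where the
    coordinates of [c] make sense. *)
Lemma bump_strict_diff c c' p r (f : M -> R) o : atlas c -> chart_at o c' ->
  0 <= r ->
  closed [set x | chart_dom c x /\ `|chart_map c x - chart_map c p| <= r] ->
  (chart_dom c o -> real_strict_diff (chart_map c') o f) ->
  real_strict_diff (chart_map c') o (fun x => bump c p r x * f x).
Proof.
move=> ac c'o r0 clK fo; have cv := chart_map_cvg c'o.2.
have [co|nco] := pselect (chart_dom c o).
  apply: (real_strict_diff_ext (f := fun x => pos_sqr (bump_arg c p r x) * f x)).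
    by apply: filterS (chart_dom_nbhs co) => x cx; rewrite /= bumpE.
  apply: real_strict_diffM => //; last exact: fo.
  by apply: real_strict_diff_pos_sqr => //; apply: bump_arg_strict_diff.
apply: (real_strict_diff_ext (f := fun=> 0)); last exact: real_strict_diff_cst.
apply: (@filterS _ (nbhs o)); last first.
  apply: open_nbhs_nbhs; split; first exact: closed_openC clK.
  by move=> [].
move=> x /= nK; have [cx|ncx] := pselect (chart_dom c x); last first.
  by rewrite /bump asboolF// mul0r.
have xr : r < `|chart_map c x - chart_map c p|.
  by rewrite ltNge; apply/negP => xr; apply: nK.
have := bump_arg_far r0 xr; rewrite bumpE// /pos_sqr => h.
by rewrite max_l ?mul0r//; exact: ltW.
Qed.

(** The coordinates of [Phi] are finitely many bumps (index [None]) and their products with the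
    coordinates of their charts (index [Some j]). Where a bump is positive the chart coordinates are
    quotients of these, which gives injectivity and the lower Lipschitz bound. *)
Lemma manifold_embedding : compact [set: M] ->
  exists (n : nat) (Phi : M -> 'rV[R]_n),
    [/\ continuous Phi, injective Phi &
      forall o c, chart_at o c ->
        (exists A, strict_diff (chart_map c) Phi o A) /\
        exists2 L, 0 < L & exists2 U, nbhs o U & forall x y, U x -> U y ->
          `|chart_map c x - chart_map c y| <= L * `|Phi x - Phi y|].
Proof.
move=> cM.
have ex p : exists cr : chart R m M * R, [/\ chart_at p cr.1, 0 < cr.2 &
    closed [set x | chart_dom cr.1 x /\
      `|chart_map cr.1 x - chart_map cr.1 p| <= cr.2]].
  have [c ac cp] := atlas_cover p.
  have [r r0 H] := chart_closed_ball (@manifold_hausdorff _ _ M) cp.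
  by exists (c, r); split=> //; apply: H.
have [cr Hcr] := choice ex.
pose b p := bump (cr p).1 p (cr p).2.
have [s cov] : exists s : seq M, forall x, exists2 p, p \in s & 0 < b p x.
  apply: (compact_seq_cover (f := fun p => [set x | 0 < b p x])) => // p.
  exists p; have [cp r0 _] := Hcr p.
  have cv := chart_map_cvg cp.2.
  have sd := bump_arg_strict_diff p (cr p).2 cp cp.
  have rr : 0 < (cr p).2 * (cr p).2 by exact: mulr_gt0.
  have := real_strict_diff_near_lt cv sd rr.
  apply: filterS2 (chart_dom_nbhs cp.2) => x cx /=.
  rewrite /b bumpE// pos_sqr_gt0 bump_arg_center ltr_norml; lra.
pose I : finType := ('I_(size s) * option 'I_m)%type.
pose pt (i : 'I_(size s)) := tnth (in_tuple s) i.
have cov' x : exists i, 0 < b (pt i) x.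
  have [p ps bx] := cov x; have ip : (index p s < size s)%N by rewrite index_mem.
  by exists (Ordinal ip); rewrite /pt (tnth_nth p) /= nth_index.
pose comp (i : I) x : R := b (pt i.1) x *
  (if i.2 is Some j then chart_map (cr (pt i.1)).1 x 0 j else 1).
pose Phi x : 'rV[R]_#|I| := \row_k comp (enum_val k) x.
have PhiE x i : Phi x 0 (enum_rank i) = comp i x by rewrite mxE enum_rankK.
have sdcomp o c i : chart_at o c -> real_strict_diff (chart_map c) o (comp i).
  move=> co; have [[ac _] r0 cl] := Hcr (pt i.1).
  apply: bump_strict_diff => //; first exact: ltW.
  move=> cio; case: (i.2) => [j|]; last exact: real_strict_diff_cst.
  have [A HA] := atlas_strict_diff co (conj ac cio).
  exact: real_strict_diff_coord HA.
have sdPhi o c : chart_at o c -> exists A, strict_diff (chart_map c) Phi o A.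
  move=> co; apply: strict_diff_of_coords => k.
  apply: (real_strict_diff_ext (f := comp (enum_val k))); last exact: sdcomp.
  by apply: nearW => x; rewrite /Phi /= mxE.
have compB i x y : `|comp i x - comp i y| <= `|Phi x - Phi y|.
  rewrite -!PhiE; have := rv_coord_le (Phi x - Phi y) (enum_rank i).
  by rewrite rv_subE.
exists #|I|, Phi; split.
- move=> o; have [c ac co] := atlas_cover o.
  have [A /strict_diff_lipschitz[K K0 [U oU HU]]] := sdPhi o c (conj ac co).
  have Uo := nbhs_singleton oU.
  apply/cvgrPdist_lt => e e0.
  have : nbhs o (chart_ball c o (e / K)) by apply: chart_ball_nbhs => //; rewrite divr_gt0.
  apply: filterS2 oU => x Ux [_ xo].
  apply: le_lt_trans (HU _ _ Uo Ux) _.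
  by rewrite mulrC -ltr_pdivlMr// distrC.
- move=> x y xy; have [i bx] := cov' x.
  have [_ r0 _] := Hcr (pt i).
  have cE j : comp (i, j) x = comp (i, j) y by rewrite -!PhiE xy.
  have bxy : b (pt i) x = b (pt i) y by have := cE None; rewrite /comp !mulr1.
  have cx := bump_gt0 bx; have cy : chart_dom (cr (pt i)).1 y.
    by apply: (@bump_gt0 _ (pt i) (cr (pt i)).2); rewrite -/(b _ y) -bxy.
  apply: (chart_map_inj cx cy); apply/rowP => j.
  have := cE (Some j); rewrite /comp /= bxy; apply: mulfI.
  by rewrite -bxy lt0r_neq0.
move=> o c co; split; first exact: sdPhi.
have [i bo] := cov' o; set c' := (cr (pt i)).1.
have c'o : chart_at o c' by split; [have [[]] := Hcr (pt i)|exact: bump_gt0 bo].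
have [A /strict_diff_lipschitz[K K0 [U oU HU]]] := atlas_strict_diff c'o co.
pose be := b (pt i) o; pose B := `|chart_map c' o| + 1.
have B0 : 0 < B by rewrite ltr_wpDl.
have sb : real_strict_diff (chart_map c') o (comp (i, None)) by exact: sdcomp.
have be2 : 0 < be / 2 by rewrite divr_gt0.
have nb := real_strict_diff_near_lt (chart_map_cvg c'o.2) sb be2.
have nB := chart_ball_nbhs c'o.2 ltr01.
(* [K] accounts for the change of chart from [c'] to [c]. The quotient comes from dividing by a bump
   that is at least [be / 2], with chart coordinates bounded by [B]. *)
exists (K * ((1 + B) / (be / 2))).
  by rewrite mulr_gt0// divr_gt0// addr_gt0.
exists (U `&` ([set x | `|comp (i, None) x - comp (i, None) o| < be / 2] `&`
   chart_ball c' o 1)); first exact: filterI oU (filterI nb nB).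
move=> x y [Ux [/= bx _]] [Uy [_ [_ yo]]].
apply: le_trans (HU _ _ Ux Uy) _; rewrite -mulrA ler_pM2l//.
have {}yo : `|chart_map c' y| <= B.
  have := ler_normD (chart_map c' y - chart_map c' o) (chart_map c' o).
  by rewrite subrK /B; lra.
have {}bx : be / 2 <= b (pt i) x.
  by move: bx; rewrite /comp /= !mulr1 -/be ltr_norml; lra.
rewrite rv_norm_le; last by rewrite mulr_ge0// ltW// divr_gt0// addr_gt0.
apply/forallP => j; rewrite mulrAC ler_pdivlMr// mulrC rv_subE.
set D := `|Phi x - Phi y|.
apply: (@le_trans _ _ (`|b (pt i) x * (chart_map c' x 0 j - chart_map c' y 0 j)|)).
  by rewrite normrM; apply: ler_wpM2r => //; exact: le_trans bx (ler_norm _).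
(* The quotient rule without division: the difference of chart coordinates, times the bump, in terms
   of differences of coordinates of [Phi]. *)
have -> : b (pt i) x * (chart_map c' x 0 j - chart_map c' y 0 j) =
  (comp (i, Some j) x - comp (i, Some j) y) -
  (comp (i, None) x - comp (i, None) y) * chart_map c' y 0 j.
  by rewrite /comp /= -/c'; ring.
apply: le_trans (ler_normB _ _) _; rewrite [leRHS]mulrDl mul1r; apply: lerD => //.
rewrite normrM mulrC; apply: ler_pM => //.
by apply: le_trans yo; exact: rv_coord_le.
Qed.

End Embedding.

(** * Voronoi cells *)

Section SquaredNorm.
Variables (R : realType) (n : nat).
Implicit Types u v w : 'rV[R]_n.

Definition dotp u v : R := \sum_i u 0 i * v 0 i.
Definition sqn u : R := dotp u u.

Lemma dotpDr u v w : dotp u (v + w) = dotp u v + dotp u w.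
Proof. by rewrite -big_split; apply: eq_bigr => i _; rewrite mxE mulrDr. Qed.

Lemma dotpZr u (t : R) v : dotp u (t *: v) = t * dotp u v.
Proof. by rewrite /dotp mulr_sumr; apply: eq_bigr => i _; rewrite mxE; ring. Qed.

(** The norms on the right are sup norms; [n.+1] in place of [n] keeps the constant positive when
    [n = 0]. *)
Lemma dotp_bound u v : `|dotp u v| <= n.+1%:R * (`|u| * `|v|).
Proof.
apply: le_trans (ler_norm_sum _ _ _) _.
apply: (@le_trans _ _ (\sum_(i < n) `|u| * `|v|)).
  by apply: ler_sum => i _; rewrite normrM ler_pM// rv_coord_le.
rewrite sumr_const card_ord -[in leLHS]mulr_natl ler_wpM2r ?mulr_ge0//.
by rewrite ler_nat.
Qed.

Lemma sqn_ge u : `|u| ^+ 2 <= sqn u.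
Proof.
have sq i : 0 <= u 0 i * u 0 i by rewrite -expr2 sqr_ge0.
have [->|[j ->]] := rv_normP u.
  by rewrite normr0 expr0n /= /sqn /dotp sumr_ge0// => i _; rewrite mxE mul0r.
rewrite real_normK ?num_real// expr2 /sqn /dotp (bigD1 j)//= lerDl.
by apply: sumr_ge0 => i _.
Qed.

Lemma sqn_le u : sqn u <= n.+1%:R * `|u| ^+ 2.
Proof. by rewrite expr2; apply: le_trans (ler_norm _) (dotp_bound _ _). Qed.

(** The quadratic terms cancel, so the condition of being closer to [a] than to [b] is affine; this
    is why cells are Euclidean although the norm at hand is the sup norm. *)
Lemma sqn_margin a b x y :
  (sqn (y - b) - sqn (y - a)) - (sqn (x - b) - sqn (x - a)) =
  2 * dotp (a - b) (y - x).
Proof.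
rewrite /sqn /dotp -!sumrB mulr_sumr; apply: eq_bigr => i _.
by rewrite !mxE; ring.
Qed.

Lemma sqn_margin_center a b x :
  2 * dotp (a - b) (a - x) = sqn (a - b) - (sqn (x - b) - sqn (x - a)).
Proof.
rewrite /sqn /dotp mulr_sumr -!sumrB; apply: eq_bigr => i _.
by rewrite !mxE; ring.
Qed.

Lemma sqn_continuous (a : 'rV[R]_n) : continuous (fun x : 'rV[R]_n => sqn (x - a)).
Proof.
have C i : continuous (fun y : 'rV[R]_n => (y - a) 0 i).
  apply: (@continuous_of_lipschitz _ _ _ _ 1) => y z.
  by rewrite !rv_subE opprB addrA subrK mul1r -rv_subE; exact: rv_coord_le.
rewrite /sqn /dotp.
suff S s : continuous (fun x : 'rV[R]_n => \sum_(i <- s) (x - a) 0 i * (x - a) 0 i).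
  exact: S.
elim: s => [|i s IH] x.
  have -> : (fun x : 'rV[R]_n => \sum_(i <- [::]) (x - a) 0 i * (x - a) 0 i) = cst 0.
    by apply/funext => y; rewrite big_nil.
  exact: cst_continuous.
have -> : (fun x : 'rV[R]_n => \sum_(i <- i :: s) (x - a) 0 i * (x - a) 0 i) =
    (fun x => (x - a) 0 i * (x - a) 0 i + \sum_(i <- s) (x - a) 0 i * (x - a) 0 i).
  by apply/funext => y; rewrite big_cons.
apply: (@continuousD _ R^o _ (fun x : 'rV[R]_n => (x - a) 0 i * (x - a) 0 i)); last exact: IH.
by apply: (@continuousM _ _ (fun x : 'rV[R]_n => (x - a) 0 i)); exact: C.
Qed.

End SquaredNorm.

Lemma seq_argmin (R : realType) (T : choiceType) (f : T -> R) (s : seq T) p :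
  p \in s -> exists2 q, q \in s & forall q', q' \in s -> f q <= f q'.
Proof.
elim: s p => // a s IH p _; have [->|[b bs]] : s = [::] \/ exists b, b \in s.
  by case: (s) => [|b s']; [left|right; exists b; rewrite mem_head].
  by exists a; rewrite ?mem_head// => q'; rewrite inE => /eqP ->.
have [q qs Hq] := IH b bs; have [aq|qa] := leP (f a) (f q).
  exists a; rewrite ?mem_head// => q'; rewrite inE => /predU1P[->//|/Hq].
  exact: le_trans.
exists q; first by rewrite inE qs orbT.
by move=> q'; rewrite inE => /predU1P[->|/Hq//]; exact: ltW.
Qed.

Lemma nbhs_seq (T : topologicalType) (I : eqType) (x : T) (s : seq I)
    (P : I -> set T) :
  (forall i, i \in s -> nbhs x (P i)) -> nbhs x [set y | forall i, i \in s -> P i y].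
Proof.
elim: s => [|a s IH] H; first exact: filterS filterT.
have Ha : nbhs x (P a) by apply: H; rewrite mem_head.
have Hs : nbhs x [set y | forall i, i \in s -> P i y].
  by apply: IH => i si; apply: H; rewrite inE si orbT.
apply: filterS2 Ha Hs => y Pa Ps i.
by rewrite inE => /predU1P[->|]; [exact: Pa|exact: Ps].
Qed.

(** A continuous injection of a compact space into a Hausdorff one is a homeomorphism onto its
    image. Away from [o] the values of [f] stay at a positive distance from [f o], uniformly by
    compactness. *)
Lemma compact_injective_nbhs (R : realType) (T : topologicalType)
    (V : normedModType R) (f : T -> V) o W :
  compact [set: T] -> continuous f -> injective f -> nbhs o W ->
  exists2 r, 0 < r & forall x, `|f x - f o| < r -> W x.
Proof.
move=> /compact_near_coveringP cT cf inj oW.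
have H (x : T) : [set: T] x -> \forall x' \near x & r \near (0 : R)^'+,
    `|f x' - f o| < r -> W x'.
  move=> _; have [->|xo] := eqVneq x o.
    exists (W, setT); first by split=> //; exact: filterT.
    by move=> [x' r] [].
  pose d := `|f x - f o| / 2.
  have d0 : 0 < d.
    rewrite divr_gt0// normr_gt0 subr_eq0.
    by apply: contraNneq xo => /inj ->.
  exists ([set x' | `|f x - f x'| < d], [set r | r < d]).
    split; last exact: nbhs_right_lt.
    by have /cvgrPdist_lt/(_ d d0) := cf x.
  move=> [x' r] /= [xx' rd] x'o; exfalso.
  have := ler_normD (f x - f x') (f x' - f o); rewrite addrA subrK.
  have -> : `|f x - f o| = d + d by rewrite /d; lra.
  by move: xx' x'o rd => /=; lra.
have Hr := cT _ _ _ (at_right_proper_filter (0 : R)) H.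
have [r [r0 /= Hr']] := filter_ex (filterI (nbhs_right_gt (0 : R)) Hr).
by exists r => // x; exact: Hr'.
Qed.

(** Greedy selection: a point of [t] is kept when it is at distance at least [r] from those already
    kept. *)
Lemma separated_net (R : realType) (T : choiceType) (V : normedModType R)
    (f : T -> V) (r : R) (t : seq T) : 0 < r ->
  exists s : seq T,
    (forall p q, p \in s -> q \in s -> p != q -> r <= `|f p - f q|) /\
    forall p, p \in t -> exists2 q, q \in s & `|f p - f q| < r.
Proof.
move=> r0; elim: t => [|a t [s [sep cov]]]; first by exists [::].
have [[q qs aq]|na] := pselect (exists2 q, q \in s & `|f a - f q| < r).
  exists s; split=> // p; rewrite inE => /predU1P[->|/cov//].
  by exists q.
have far q : q \in s -> r <= `|f a - f q|.
  by move=> qs; rewrite leNgt; apply/negP => aq; apply: na; exists q.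
exists (a :: s); split.
  move=> p q; rewrite !inE => /predU1P[->|ps] /predU1P[->|qs].
  - by rewrite eqxx.
  - by move=> _; exact: far.
  - by move=> _; rewrite distrC; exact: far.
  - exact: sep.
move=> p; rewrite inE => /predU1P[->|/cov[q qs pq]].
  by exists a; rewrite ?mem_head// subrr normr0.
by exists q => //; rewrite inE qs orbT.
Qed.

(** * A Voronoi cell inside one chart *)

Section ChartCells.
Variables (R : realType) (m n : nat) (M : C1_manifold R m).
Variables (d : M -> M -> R) (Phi : M -> 'rV[R]_n).

(* The second clause is a Lipschitz bound for the chart which says moreover that
   small [d]-balls are contained in its domain. *)
Definition chart_bilipschitz (c : chart R m M) (o : M) (r L : R) : Prop :=
  (forall x y, chart_ball c o r x -> chart_ball c o r y ->
     d x y <= L * `|chart_map c x - chart_map c y|) /\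
  (forall x z e, chart_ball c o r x -> 0 < e <= r -> d x z < e / L ->
     chart_dom c z /\ `|chart_map c z - chart_map c x| < e).

Variables (c : chart R m M) (o : M) (eta L lam : R) (A : 'M[R]_(m, n)).
Hypotheses (eta0 : 0 < eta) (L0 : 0 < L) (lam0 : 0 < lam).
Hypothesis Phi_cont : continuous Phi.
Hypothesis model_ball : forall y, chart_model c y -> `|y - chart_map c o| < eta ->
  chart_dom c (chart_inv c y) /\ chart_map c (chart_inv c y) = y.
Hypothesis bilip : chart_bilipschitz c o eta L.
Hypothesis Phi_expand : forall x y, chart_ball c o eta x -> chart_ball c o eta y ->
  `|chart_map c x - chart_map c y| <= lam * `|Phi x - Phi y|.
Let nu : R := n.+1%:R.
(** Two points of the chart at distance at most [lam * (3 * nu * r)] then have an affine error at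
    most [3 * r / (32 * nu)], which leaves room in [cell_star]. *)
Let eps : R := (32 * nu ^+ 2 * lam)^-1.
Hypothesis Phi_affine : forall x y, chart_ball c o eta x -> chart_ball c o eta y ->
  `|Phi x - Phi y - (chart_map c x - chart_map c y) *m A| <=
     eps * `|chart_map c x - chart_map c y|.

Variables (N : seq M) (r : R) (q : M).
Hypothesis r0 : 0 < r.
Hypothesis separated : forall q', q' \in N -> q' != q -> r <= `|Phi q - Phi q'|.

Let E (x p : M) := sqn (Phi x - Phi p).

Definition voronoi_cell : set M := [set x | forall q', q' \in N -> q' != q ->
  E x q < E x q'].
Definition closed_voronoi_cell : set M := [set x | forall q', q' \in N ->
  E x q <= E x q'].

Hypothesis cell_small : forall x, closed_voronoi_cell x ->
  `|Phi x - Phi q| <= 2 * nu * r /\ chart_ball c o eta x.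

Let nu1 : 1 <= nu.
Proof. by rewrite ler1n. Qed.

Let nu0 : 0 < nu.
Proof. exact: lt_le_trans nu1. Qed.

Let eps0 : 0 < eps.
Proof. by rewrite invr_gt0 !mulr_gt0// exprn_gt0. Qed.

Lemma center_in_closed_cell : closed_voronoi_cell q.
Proof.
move=> q' _; apply: (@le_trans _ _ 0); last exact: le_trans (sqn_ge _).
by apply: le_trans (sqn_le _) _; rewrite subrr normr0 expr0n /= mulr0.
Qed.

Lemma voronoi_cell_sub : voronoi_cell `<=` closed_voronoi_cell.
Proof.
move=> x Vx q' q'N; have [->//|q'q] := eqVneq q' q.
by apply: ltW; exact: Vx.
Qed.

Lemma voronoi_cell_nbhs x : voronoi_cell x -> nbhs x voronoi_cell.
Proof.
move=> Vx.
have H : nbhs x [set y | forall q', q' \in N -> (q' != q -> E y q < E y q')].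
  apply: nbhs_seq => q' q'N; have [->|q'q] := eqVneq q' q.
    exact: filterS filterT.
  have cE p : E y p @[y --> x] --> E x p.
    exact: (continuous_comp (@Phi_cont x) (@sqn_continuous _ _ (Phi p) _)).
  pose de := (E x q' - E x q) / 2.
  have de0 : 0 < de by rewrite divr_gt0// subr_gt0; exact: Vx.
  have /cvgrPdist_lt/(_ de de0) h1 := cE q.
  have /cvgrPdist_lt/(_ de de0) h2 := cE q'.
  apply: filterS2 h1 h2 => y; rewrite !ltr_norml /de => h1 h2 _; lra.
exact: H.
Qed.

Let seg (x b : 'rV[R]_m) t := (1 - t) *: x + t *: b.

Lemma chart_ball_segment x b t : chart_ball c o eta x -> (chart_model c)° b ->
  `|b - chart_map c o| < eta -> 0 < t <= 1 ->
  [/\ (chart_model c)° (seg (chart_map c x) b t),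
      `|seg (chart_map c x) b t - chart_map c o| < eta,
      chart_ball c o eta (chart_inv c (seg (chart_map c x) b t)) &
      chart_map c (chart_inv c (seg (chart_map c x) b t)) =
        seg (chart_map c x) b t].
Proof.
move=> [cx xo] ib bo t01; have mP := @chart_modelP _ _ _ c.
have iy := model_interior_segment mP (chart_map_model cx) ib t01.
have /andP[t0 t1] := t01.
have yo : `|seg (chart_map c x) b t - chart_map c o| < eta.
  have -> : seg (chart_map c x) b t - chart_map c o =
    (1 - t) *: (chart_map c x - chart_map c o) + t *: (b - chart_map c o).
    by apply/rowP => j; rewrite !mxE; ring.
  apply: le_lt_trans (ler_normD _ _) _.
  rewrite !normrZ (gtr0_norm t0) ger0_norm ?subr_ge0//.
  have : t * `|b - chart_map c o| < t * eta by rewrite ltr_pM2l.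
  have : (1 - t) * `|chart_map c x - chart_map c o| <= (1 - t) * eta.
    by rewrite ler_wpM2l ?subr_ge0// ltW.
  lra.
have [dy Ey] := model_ball (interior_subset iy) yo.
by split=> //; split=> //; rewrite Ey.
Qed.

(* Along the segment towards [b] the margin [E _ q' - E _ q] is affine up to an
   error which is small with respect to its value at [q]. *)
Lemma cell_star x b t : closed_voronoi_cell x -> (chart_model c)° b ->
  `|b - chart_map c o| < eta ->
  `|Phi (chart_inv c b) - Phi q| <= r / (8 * nu) -> 0 < t <= 1 ->
  voronoi_cell (chart_inv c (seg (chart_map c x) b t)).
Proof.
move=> cx ib bo bq t01 q' q'N q'q; have /andP[t0 t1] := t01.
have [xq xball] := cell_small cx.
have [_ _ yball Ey] := chart_ball_segment xball ib bo t01.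
have [db Eb] := model_ball (interior_subset ib) bo.
have bball : chart_ball c o eta (chart_inv c b) by split=> //; rewrite Eb.
set y := chart_inv c _ in yball Ey *; set z := chart_inv c b in bq db Eb bball.
set xi := chart_map c x in Ey *.
pose e1 := Phi y - Phi x - (chart_map c y - xi) *m A.
pose e3 := Phi z - Phi x - (chart_map c z - xi) *m A.
have Eyx : chart_map c y - xi = t *: (b - xi).
  by rewrite Ey /seg; apply/rowP => j; rewrite !mxE; ring.
have n1 : `|e1| <= t * (eps * `|b - xi|).
  have := Phi_affine yball xball; rewrite -/xi -/e1 Eyx normrZ gtr0_norm//.
  by rewrite mulrCA.
have n3 : `|e3| <= eps * `|b - xi|.
  by have := Phi_affine bball xball; rewrite -/xi -/e3 Eb.
have kn : 0 < r / (8 * nu) by rewrite divr_gt0// mulr_gt0.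
have nb : `|b - xi| <= lam * (3 * nu * r).
  have := Phi_expand bball xball; rewrite Eb -/xi => /le_trans; apply.
  rewrite ler_pM2l//; have := ler_normD (Phi z - Phi q) (Phi q - Phi x).
  rewrite addrA subrK (distrC (Phi q)) => h.
  have h8 : r / (8 * nu) <= nu * r.
    rewrite ler_pdivrMr ?mulr_gt0//.
    have -> : nu * r * (8 * nu) = r * (8 * (nu * nu)) by ring.
    rewrite ler_peMr ?(ltW r0)//.
    have : 1 * 1 <= nu * nu by apply: ler_pM.
    lra.
  move: (r / (8 * nu)) bq h8 => k bq h8; lra.
(* [w] is the deviation of [Phi y] from the point [(1 - t) Phi x + t Phi q] of the straight segment:
   [Phi z] is close to [Phi q] but distinct from it, and [Phi] is only nearly affine. The two
   sources give [r / (8 * nu)] and [6 * r / (32 * nu)], up to the factor [t]. *)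
pose w := t *: (Phi z - Phi q) + (e1 - t *: e3).
have Ew : Phi y - Phi x = t *: (Phi q - Phi x) + w.
  have Hy : Phi y - Phi x = t *: ((b - xi) *m A) + e1.
    by rewrite /e1 Eyx -scalemxAl [RHS]addrC subrK.
  have Hz : Phi z - Phi x = (b - xi) *m A + e3.
    by rewrite /e3 Eb [RHS]addrC subrK.
  rewrite Hy /w; have -> : (b - xi) *m A = Phi z - Phi x - e3 by rewrite Hz addrK.
  by apply/rowP => j; rewrite !mxE; ring.
have nw : nu * `|w| <= t * (r * (5 / 16)).
  have : `|w| <= t * (r / (8 * nu)) + (t * (eps * `|b - xi|) + t * (eps * `|b - xi|)).
    rewrite /w (le_trans (ler_normD _ _))// lerD//.
      by rewrite normrZ gtr0_norm// ler_pM2l.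
    by rewrite (le_trans (ler_normB _ _))// lerD// normrZ gtr0_norm// ler_pM2l.
  have : eps * `|b - xi| <= r * (3 / (32 * nu)).
    apply: (@le_trans _ _ (eps * (lam * (3 * nu * r)))); first by rewrite ler_pM2l.
    rewrite /eps; suff -> : (32 * nu ^+ 2 * lam)^-1 * (lam * (3 * nu * r)) =
      r * (3 / (32 * nu)) by [].
    by field; rewrite !lt0r_neq0.
  set f := eps * _ => hf hw.
  have hw' : `|w| <= t * (r * (5 / (16 * nu))).
    apply: le_trans hw _.
    have -> : t * (r * (5 / (16 * nu))) = t * (r / (8 * nu)) +
        (t * (r * (3 / (32 * nu))) + t * (r * (3 / (32 * nu)))).
      by field; rewrite lt0r_neq0.
    by rewrite lerD2l; apply: lerD; rewrite ler_pM2l.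
  have -> : t * (r * (5 / 16)) = nu * (t * (r * (5 / (16 * nu)))).
    by field; rewrite lt0r_neq0.
  by rewrite ler_pM2l.
have margin := sqn_margin (Phi q) (Phi q') (Phi x) (Phi y).
move: margin; rewrite Ew dotpDr dotpZr mulrDr mulrCA sqn_margin_center.
set D := Phi q - Phi q'.
have rD : r <= `|D| by exact: separated.
have D0 : 0 < `|D| by exact: lt_le_trans rD.
have hD : `|D| * r <= sqn D.
  by apply: le_trans (sqn_ge _); rewrite expr2 ler_pM2l.
have hw : `|2 * dotp D w| <= 2 * (`|D| * (t * (r * (5 / 16)))).
  rewrite normrM (ger0_norm (ltW (ltr0n R 2)))// ler_pM2l//.
  apply: le_trans (dotp_bound _ _) _; rewrite -/nu mulrCA ler_pM2l//.
have mx0 : 0 <= E x q' - E x q by rewrite subr_ge0; exact: cx.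
rewrite /E; move: mx0; rewrite /E; set mx := sqn _ - sqn _ => mx0 my.
rewrite -subr_gt0; set my' := sqn _ - sqn _ in my *.
have := hw; rewrite ler_norml => /andP[hw1 _].
have h1 : 0 <= (1 - t) * mx by rewrite mulr_ge0// subr_ge0.
have h2 : t * (`|D| * r) <= t * sqn D by rewrite ler_pM2l.
have h3 : 0 < t * (`|D| * r) by rewrite !mulr_gt0.
(* The first term is nonnegative since [x] is in the closed cell, and the error is at most [5 / 8]
   of [t * (|D| * r) <= t * sqn D]. *)
have -> : my' = (1 - t) * mx + t * sqn D + 2 * dotp D w.
  move: my => /(congr1 (fun u => u + mx)) /=; rewrite subrK => ->.
  have rg (a1 a2 a3 : R) : t * (a1 - a2) + 2 * a3 + a2 = (1 - t) * a2 + t * a1 + 2 * a3.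
    by ring.
  exact: rg.
have h4 : 2 * (`|D| * (t * (r * (5 / 16)))) = (5 / 8) * (t * (`|D| * r)) by field.
rewrite h4 in hw1; move: (t * (`|D| * r)) (t * sqn D) ((1 - t) * mx) h1 h2 h3 hw1.
by move=> a1 a2 a3; lra.
Qed.

(** The cell read in the chart. Taking the interior of the model makes it open in the vector space
    even when the cell touches the boundary of [M]; the missing points are limits of the others. *)
Let Omega : set 'rV[R]_m := [set y | [/\ (chart_model c)° y,
  `|y - chart_map c o| < eta & voronoi_cell (chart_inv c y)]].

Let Omega_ball y : Omega y -> chart_ball c o eta (chart_inv c y) /\
  chart_map c (chart_inv c y) = y.
Proof.
move=> [iy yo _]; have [dy Ey] := model_ball (interior_subset iy) yo.
by split=> //; split=> //; rewrite Ey.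
Qed.

Let Omega_open : open Omega.
Proof.
rewrite openE => y Oy; have [iy yo Vy] := Oy; have [[dy _] Ey] := Omega_ball Oy.
have [s s0 Hs] := chart_inv_cvg dy Ey (voronoi_cell_nbhs Vy).
have ny e : 0 < e -> nbhs y [set z : 'rV[R]_m | `|z - y| < e].
  by move=> e0; apply/nbhs_ballP; exists e => // z; rewrite -ball_normE /= distrC.
have e0 : 0 < eta - `|y - chart_map c o| by rewrite subr_gt0.
have ii : nbhs y (chart_model c)° by apply: open_nbhs_nbhs; split=> //; exact: open_interior.
apply: filterS2 ii (filterI (ny _ s0) (ny _ e0)) => z iz [/= zs ze].
split=> //; last by apply: Hs => //; exact: interior_subset.
by have := ler_normD (z - y) (y - chart_map c o); rewrite addrA subrK; lra.
Qed.

(** [q] may lie on the boundary, so the center is a nearby interior point [b]. It belongs to the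
    cell by [cell_star] with [x := q] and [t := 1]. *)
Let star_center : exists b s, [/\ 0 < s, Omega b & forall w, `|w - b| < s ->
  [/\ (chart_model c)° w, `|w - chart_map c o| < eta &
      `|Phi (chart_inv c w) - Phi q| <= r / (8 * nu)]].
Proof.
have [_ [dq qo]] := cell_small center_in_closed_cell.
have k0 : 0 < r / (8 * nu) by rewrite divr_gt0// mulr_gt0.
have nq : nbhs q [set x | `|Phi q - Phi x| < r / (8 * nu)].
  by have /cvgrPdist_lt/(_ _ k0) := @Phi_cont q.
have [s s0 Hs] := chart_local dq nq.
pose s' := Num.min s (eta - `|chart_map c q - chart_map c o|) / 2.
have s'0 : 0 < s' by rewrite divr_gt0// lt_min s0 subr_gt0.
have [s's s'e] : s' + s' <= s /\ s' + s' <= eta - `|chart_map c q - chart_map c o|.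
  have : s' + s' <= Num.min s (eta - `|chart_map c q - chart_map c o|) by rewrite /s'; lra.
  by rewrite le_min => /andP[].
have [b ib bq] := model_interior_dense (@chart_modelP _ _ _ c) (chart_map_model dq) s'0.
have /nbhs_ballP[e /= e0 eb] : nbhs b (chart_model c)°.
  by apply: open_nbhs_nbhs; split=> //; exact: open_interior.
have H w : `|w - b| < Num.min e s' -> [/\ (chart_model c)° w,
    `|w - chart_map c o| < eta & `|Phi (chart_inv c w) - Phi q| <= r / (8 * nu)].
  rewrite lt_min => /andP[we ws].
  have iw : (chart_model c)° w by apply: eb; rewrite -ball_normE /= distrC.
  have wq : `|w - chart_map c q| < s' + s'.
    by have := ler_normD (w - b) (b - chart_map c q); rewrite addrA subrK; lra.
  split=> //.
    have := ler_normD (w - chart_map c q) (chart_map c q - chart_map c o).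
    by rewrite addrA subrK; lra.
  have [|_ _ /=] := Hs w (interior_subset iw); first by lra.
  by rewrite distrC => /ltW.
exists b, (Num.min e s'); split=> //; first by rewrite lt_min e0.
have [|_ bo bPhi] := H b; first by rewrite subrr normr0 lt_min e0.
split=> //; have := @cell_star q b 1 center_in_closed_cell ib bo bPhi.
by rewrite /seg subrr scale0r add0r scale1r; apply; rewrite ltr01 lexx.
Qed.

Lemma chart_cell : exists (h : 'rV[R]_m -> M) (K : R), [/\ 0 < K,
  forall x y, `|x| < 1 -> `|y| < 1 -> d (h x) (h y) <= K * `|x - y|,
  forall x s, 0 < s -> `|x| + s <= 1 -> forall z, d (h x) z < s / K ->
    exists2 y, `|y - x| < s & h y = z,
  forall x y, `|x| < 1 -> `|y| < 1 -> h x = h y -> x = y &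
  (forall x, `|x| < 1 -> voronoi_cell (h x)) /\
  forall x, closed_voronoi_cell x -> forall e, 0 < e ->
    exists2 y, `|y| < 1 & d x (h y) < e].
Proof.
have [b [s [s0 Ob Hb]]] := star_center.
have OK y : Omega y -> `|y| <= `|chart_map c o| + eta.
  move=> [_ yo _]; have := ler_normD (y - chart_map c o) (chart_map c o).
  by rewrite subrK; lra.
have K0 : 0 < `|chart_map c o| + eta by rewrite ltr_wpDl.
have starO v w t : Omega v -> `|w - b| < s -> 0 <= t <= 1 ->
    Omega ((1 - t) *: v + t *: w).
  move=> Ov ws /andP[t0 t1]; have [iw wo wPhi] := Hb w ws.
  have [->|tn0] := eqVneq t 0; first by rewrite subr0 scale1r scale0r addr0.
  have t01 : 0 < t <= 1 by rewrite lt_neqAle eq_sym tn0 t0 t1.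
  have [vball Ev] := Omega_ball Ov; have [_ _ Vv] := Ov.
  have [i1 i2 _ _] := chart_ball_segment vball iw wo t01.
  have := cell_star (voronoi_cell_sub Vv) iw wo wPhi t01.
  by move: i1 i2; rewrite Ev.
have [f [g [Lf [Lf0 [fK gK] f_lip g_lip fO]]]] :=
  star_domain_bilipschitz s0 K0 Omega_open OK Ob starO.
have gO x : `|x| < 1 -> Omega (g x) by move=> x1; apply/fO; rewrite gK.
(* [de <= eta] allows the second clause of [bilip] at radius [t * de], and [de <= Lf^-1] keeps the
   displacement of [f] below [t]. *)
pose de := Num.min eta Lf^-1.
have de0 : 0 < de by rewrite lt_min eta0 invr_gt0.
have K1 : 0 < L * Lf by rewrite mulr_gt0.
have K2 : 0 < L / de by rewrite divr_gt0.
exists (chart_inv c \o g), (L * Lf + L / de); split.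
- exact: addr_gt0.
- move=> x y x1 y1 /=.
  have [bx Ex] := Omega_ball (gO x x1); have [by_ Ey] := Omega_ball (gO y y1).
  apply: le_trans (bilip.1 _ _ bx by_) _; rewrite Ex Ey.
  apply: (@le_trans _ _ (L * (Lf * `|x - y|))); first by rewrite ler_pM2l.
  by rewrite mulrA ler_wpM2r// lerDl ltW.
- move=> x t t0 xt z xz.
  have x1 : `|x| < 1 by rewrite (lt_le_trans _ xt)// ltrDl.
  have [bx Ex] := Omega_ball (gO x x1).
  have t1 : t <= 1 by rewrite (le_trans _ xt)// lerDr.
  have [||dz zx] := bilip.2 _ z (t * de) bx.
  + rewrite mulr_gt0//= (le_trans (ler_piMl (ltW de0) t1))//.
    by rewrite /de ge_min lexx.
  + apply: lt_le_trans xz _.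
    have -> : t * de / L = t / (L / de) by field; rewrite !lt0r_neq0.
    by rewrite ler_pM2l// lef_pV2 ?posrE ?addr_gt0// lerDr ltW.
  have fz : `|f (chart_map c z) - x| < t.
    rewrite -[X in _ - X]gK; apply: le_lt_trans (f_lip _ _) _.
    rewrite Ex in zx.
    apply: (@lt_le_trans _ _ (Lf * (t * de))); first by rewrite ltr_pM2l.
    rewrite mulrCA ler_piMr ?(ltW t0)// -ler_pdivlMl// mulr1.
    by rewrite /de ge_min lexx orbT.
  exists (f (chart_map c z)) => //=.
  by rewrite fK chart_invK.
- move=> x y x1 y1 /= /(congr1 (chart_map c)).
  have [_ ->] := Omega_ball (gO x x1); have [_ ->] := Omega_ball (gO y y1).
  by move/(congr1 f); rewrite !gK.
split; first by move=> x /gO[].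
move=> x cx e e0.
have [|ib bo bPhi] := Hb b; first by rewrite subrr normr0.
have [_ xball] := cell_small cx.
pose B := L * (`|chart_map c x - b| + 1).
have B0 : 0 < B by rewrite mulr_gt0// ltr_wpDl.
(* A point of the closed cell is approached along its segment towards [b], all of whose points other
   than the origin [x] lie in [Omega]. *)
pose t := Num.min 1 (e / (2 * B)).
have t0 : 0 < t by rewrite lt_min ltr01 divr_gt0// mulr_gt0.
have t01 : 0 < t <= 1 by rewrite t0 /t ge_min lexx.
have te : t * B < e.
  have : t <= e / (2 * B) by rewrite /t ge_min lexx orbT.
  by rewrite ler_pdivlMr ?mulr_gt0//; move: (mulr_gt0 t0 B0); lra.
have [i1 i2 yball Ey] := chart_ball_segment xball ib bo t01.
have Vy := cell_star cx ib bo bPhi t01.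
set y := seg _ _ _ in i1 i2 yball Ey Vy.
have Oy : Omega y by [].
exists (f y); first by apply/fO.
rewrite /= fK; apply: le_lt_trans (bilip.1 _ _ xball yball) _.
apply: le_lt_trans te; rewrite Ey /y /seg.
have -> : chart_map c x - ((1 - t) *: chart_map c x + t *: b) =
  t *: (chart_map c x - b) by apply/rowP => j; rewrite !mxE; ring.
rewrite normrZ gtr0_norm// /B mulrCA ler_pM2l// ler_pM2l//.
by rewrite lerDl.
Qed.

End ChartCells.

(** * Assembling the cells of a finite net *)

Section VoronoiDecomposition.
Variables (R : realType) (m : nat) (M : C1_manifold R m).
Variables (d : M -> M -> R) (dP : is_metric d).
Hypothesis M_compact : compact [set: M].
Hypothesis d_charts : forall o, exists c r L, [/\ chart_at o c, 0 < r, 0 < L &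
  chart_bilipschitz d c o r L].

Lemma chart_bilipschitz_sub c o r r' L : r' <= r ->
  chart_bilipschitz d c o r L -> chart_bilipschitz d c o r' L.
Proof.
move=> r'r [H1 H2]; have sub x : chart_ball c o r' x -> chart_ball c o r x.
  by move=> [cx xo]; split=> //; exact: lt_le_trans r'r.
split=> [x y /sub bx /sub by_|x z e /sub bx /andP[e0 er]]; first exact: H1.
by apply: H2 => //; rewrite e0 (le_trans er).
Qed.

(** The last clause leads back from [Phi] to the chart: it is what confines a small cell to a single
    chart ball. *)
Let good_chart n (Phi : M -> 'rV[R]_n) o (c : chart R m M) (eta L lam : R)
    (A : 'M[R]_(m, n)) (r : R) : Prop :=
  [/\ [/\ 0 < eta, 0 < L, 0 < lam & chart_dom c o],
    forall y, chart_model c y -> `|y - chart_map c o| < eta ->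
      chart_dom c (chart_inv c y) /\ chart_map c (chart_inv c y) = y,
    chart_bilipschitz d c o eta L,
    (forall x y, chart_ball c o eta x -> chart_ball c o eta y ->
      `|chart_map c x - chart_map c y| <= lam * `|Phi x - Phi y|) /\
    (forall x y, chart_ball c o eta x -> chart_ball c o eta y ->
      `|Phi x - Phi y - (chart_map c x - chart_map c y) *m A| <=
      (32 * n.+1%:R ^+ 2 * lam)^-1 * `|chart_map c x - chart_map c y|) &
    0 < r /\ forall x, `|Phi x - Phi o| < r -> chart_ball c o eta x].

Let good_chart_exists n (Phi : M -> 'rV[R]_n) : continuous Phi -> injective Phi ->
  (forall o c, chart_at o c -> (exists A, strict_diff (chart_map c) Phi o A) /\
     exists2 L, 0 < L & exists2 U, nbhs o U & forall x y, U x -> U y ->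
       `|chart_map c x - chart_map c y| <= L * `|Phi x - Phi y|) ->
  forall o, exists c eta L lam A r, good_chart Phi o c eta L lam A r.
Proof.
move=> cPhi iPhi HPhi o; have [c [r [L [co r0 L0 bl]]]] := d_charts o.
have [[A HA] [lam lam0 [U oU HU]]] := HPhi o c co.
have e0 : 0 < (32 * n.+1%:R ^+ 2 * lam)^-1 :> R.
  by rewrite invr_gt0 !mulr_gt0// exprn_gt0.
have [W oW HW] := HA _ e0.
have [s s0 Hs] := chart_local co.2 (filterI oU oW).
pose eta := Num.min r s.
have eta0 : 0 < eta by rewrite lt_min r0.
have inUW x : chart_ball c o eta x -> U x /\ W x.
  move=> [cx xo]; have [|_ _] := Hs (chart_map c x) (chart_map_model cx).
    by rewrite (lt_le_trans xo)// /eta ge_min lexx orbT.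
  by rewrite chart_invK.
have nb : nbhs o (chart_ball c o eta) by apply: chart_ball_nbhs => //; case: co.
have [t t0 Ht] := compact_injective_nbhs M_compact cPhi iPhi nb.
exists c, eta, L, lam, A, t; split.
- by split=> //; case: co.
- move=> y my yo; have [|cy Ey _] := Hs y my; last by [].
  by rewrite (lt_le_trans yo)// /eta ge_min lexx orbT.
- by apply: chart_bilipschitz_sub bl; rewrite /eta ge_min lexx.
- by split=> x y /inUW[Ux Wx] /inUW[Uy Wy]; [exact: HU|exact: HW].
- by [].
Qed.

Theorem cube_decomposable_of_charts : cube_decomposable (metric_space dP).
Proof.
have [n [Phi [cPhi iPhi HPhi]]] := manifold_embedding M_compact.
have [c Hc] := choice (good_chart_exists cPhi iPhi HPhi).
have [eta Heta] := choice Hc; have [L HL] := choice Heta.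
have [lam Hlam] := choice HL; have [A HA] := choice Hlam.
have [rho Hrho] := choice HA.
clear Hc Heta HL Hlam HA.
have rho0 o : 0 < rho o by case: (Hrho o) => _ _ _ _ [].
have [s cov] : exists s : seq M, forall x, exists2 o, o \in s &
    `|Phi x - Phi o| < rho o / 2.
  apply: (compact_seq_cover (f := fun o => [set x | `|Phi x - Phi o| < rho o / 2])) => //.
  move=> o; exists o; have r2 : 0 < rho o / 2 by rewrite divr_gt0.
  have /cvgrPdist_lt/(_ _ r2) := cPhi o.
  by apply: filterS => x; rewrite distrC.
pose nu : R := n.+1%:R; have nu0 : 0 < nu by rewrite ltr0n.
(* Cells will have radius at most [2 * nu * r] around their center, which is itself within
   [rho o / 2] of some [Phi o]; together they stay within [rho o]. *)
have [r r0 Hr] : exists2 r, 0 < r & forall o, o \in s -> 2 * nu * r < rho o / 2.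
  elim: (s) => [|o s' [r r0 Hr]]; first by exists 1.
  exists (Num.min r (rho o / (8 * nu))).
    by rewrite lt_min r0 divr_gt0// mulr_gt0.
  move=> o'; rewrite inE => /predU1P[->|/Hr].
    apply: (@le_lt_trans _ _ (2 * nu * (rho o / (8 * nu)))).
      by rewrite ler_pM2l ?mulr_gt0// ge_min lexx orbT.
    have -> : 2 * nu * (rho o / (8 * nu)) = rho o / 4 by field; rewrite lt0r_neq0.
    by have := rho0 o; lra.
  by apply: le_lt_trans; rewrite ler_pM2l ?mulr_gt0// ge_min lexx.
have [t tcov] : exists t : seq M, forall x, exists2 p, p \in t &
    `|Phi x - Phi p| < r.
  apply: (compact_seq_cover (f := fun p => [set x | `|Phi x - Phi p| < r])) => //.
  move=> p; exists p; have /cvgrPdist_lt/(_ _ r0) := cPhi p.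
  by apply: filterS => x; rewrite distrC.
have [N [sep net]] := separated_net Phi t r0.
have dense x : exists2 q, q \in N & `|Phi x - Phi q| < 2 * r.
  have [p pt xp] := tcov x; have [q qN pq] := net p pt; exists q => //.
  have := ler_normD (Phi x - Phi p) (Phi p - Phi q).
  by rewrite addrA subrK; lra.
(* The net is [2 * r]-dense in the sup norm; passing to squared Euclidean norms and back costs the
   factor [nu], after which [nu <= nu ^+ 2]. *)
have small q x : closed_voronoi_cell Phi N q x -> `|Phi x - Phi q| <= 2 * nu * r.
  move=> Vx; have [p pN xp] := dense x.
  have nu1 : 1 <= nu by rewrite ler1n.
  rewrite -(@ler_pXn2r _ 2) ?nnegrE//; last by rewrite !mulr_ge0// ltW.
  apply: le_trans (sqn_ge _) _; apply: le_trans (Vx p pN) _.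
  apply: le_trans (sqn_le _) _; rewrite -/nu.
  apply: (@le_trans _ _ (nu * (2 * r) ^+ 2)).
    rewrite ler_pM2l// ler_pXn2r ?nnegrE//; first exact: ltW.
    by rewrite mulr_ge0// ltW.
  have -> : (2 * nu * r) ^+ 2 = nu * (nu * (2 * r) ^+ 2) by ring.
  by rewrite ler_pM2l// ler_peMl// exprn_ge0// mulr_ge0// ltW.
pose cell_prop q (hK : ('rV[R]_m -> M) * R) := [/\ 0 < hK.2,
    forall x y, `|x| < 1 -> `|y| < 1 -> d (hK.1 x) (hK.1 y) <= hK.2 * `|x - y|,
    forall x s, 0 < s -> `|x| + s <= 1 -> forall z, d (hK.1 x) z < s / hK.2 ->
      exists2 y, `|y - x| < s & hK.1 y = z,
    forall x y, `|x| < 1 -> `|y| < 1 -> hK.1 x = hK.1 y -> x = y &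
    (forall x, `|x| < 1 -> voronoi_cell Phi N q (hK.1 x)) /\
    forall x, closed_voronoi_cell Phi N q x -> forall e, 0 < e ->
      exists2 y, `|y| < 1 & d x (hK.1 y) < e].
have cell q : q \in N -> exists hK, cell_prop q hK.
  move=> qN; have [b bs qb] := cov q.
  have [[e0 L0 l0 _] mo bl [lamo Ao] [_ Ho]] := Hrho b.
  have [| |h [K HK]] := chart_cell e0 L0 l0 cPhi mo bl lamo Ao r0 (N := N) (q := q).
  - by move=> q' q'N q'q; apply: sep => //; rewrite eq_sym.
  - move=> x Vx; have xq := small q x Vx; split=> //.
    apply: Ho; have := Hr b bs; have := ler_normD (Phi x - Phi q) (Phi q - Phi b).
    by rewrite addrA subrK -/nu; lra.
  by exists (h, K).
have cell' q : exists hK : ('rV[R]_m -> M) * R, q \in N -> cell_prop q hK.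
  have [/cell[hK HK]|qN] := pselect (q \in N).
    by exists hK.
  by exists (fun=> q, 1) => /qN.
have [hK HhK'] := choice cell'.
pose T := {q : M | q \in N}.
have HhK (q : T) := HhK' (sval q) (svalP q).
(* There are finitely many cells, hence a common constant. *)
have [Ks Ks0 HKs] : exists2 K, 0 < K & forall q, q \in N -> (hK q).2 <= K.
  elim: (N) => [|q N' [K K0 IH]]; first by exists 1.
  exists (Num.max K (hK q).2); first by rewrite lt_max K0.
  move=> q'; rewrite inE => /predU1P[->|/IH h]; first by rewrite le_max lexx orbT.
  by rewrite le_max h.
apply: (@cube_decomposable_of_cells R m (metric_space dP) T (fun q => (hK (sval q)).1) Ks) => //.
- move=> q x y x1 y1; have [K0 H _ _ _] := HhK q.
  by apply: le_trans (H x y x1 y1) _; apply: ler_wpM2r => //; exact: (HKs (sval q) (svalP q)).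
- move=> q x e e0 xe z xz; have [K0 _ H _ _] := HhK q.
  apply: (H x e e0 xe z); apply: lt_le_trans xz _.
  by rewrite ler_pM2l// lef_pV2 ?posrE//; exact: (HKs (sval q) (svalP q)).
- move=> q q' x x' x1 x'1 E.
  have [_ _ _ inj [Vq _]] := HhK q; have [_ _ _ _ [Vq' _]] := HhK q'.
  have [qq'|qq'] := eqVneq (sval q) (sval q').
    have E' : q = q' by apply: val_inj.
    by subst q'; split=> //; exact: inj.
  (* A common point would be strictly closer to each of the two centers than to the other. *)
  have h1 := Vq x x1 (sval q') (svalP q'); have h2 := Vq' x' x'1 (sval q) (svalP q).
  have := h1; rewrite eq_sym => /(_ qq') {}h1; have {}h2 := h2 qq'.
  by move: h1; rewrite E => /lt_trans/(_ h2); rewrite ltxx.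
move=> z; have [p pN _] := dense z.
have [q qN Hq] := seq_argmin (fun q => sqn (Phi z - Phi q)) pN.
have [_ _ _ _ [_ H]] := HhK (exist _ q qN).
exists (exist _ q qN); apply/closure_mdistP => e e0.
have [y y1 zy] := H z Hq e e0.
by exists ((hK q).1 y) => //; exists y.
Qed.

End VoronoiDecomposition.

(** * Tangent vectors and lengths of curves *)

Section TangentVectors.
Variables (R : realType) (m : nat) (M : C1_manifold R m).
Implicit Types (c : chart R m M) (p : M).

(** Every coordinate vector comes from a tangent vector, so positivity of [g] passes to its
    coefficient matrix. The family is compatible by the chain rule and the uniqueness of strict
    derivatives. *)
Lemma tangent_vector_exists c p (w : 'rV[R]_m) : chart_at p c ->
  exists v : tangent_family M, tangent_space p v /\ v c = w.
Proof.
move=> pc.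
have ex c2 : exists A, chart_at p c2 ->
    strict_diff (chart_map c) (chart_map c2) p A.
  have [pc2|] := pselect (chart_at p c2); last by exists 0.
  by have [A HA] := atlas_strict_diff pc pc2; exists A.
have [A HA] := choice ex.
exists (fun c2 => if `[< chart_at p c2 >] then w *m A c2 else 0); split; last first.
  rewrite asboolT//; have H := HA c pc.
  by rewrite (strict_diff_unique pc.2 H (strict_diff_id _ _)) mulmx1.
split=> [c1 c2 pc1 pc2|c2 pc2]; last by rewrite asboolF.
have [|F HF] := atlas_C1 pc1.1 pc2.1 (x := chart_map c1 p).
  by exists p => //; split; [exact: pc1.2|exact: pc2.2].
exists F => //; rewrite !asboolT// diff_lin1_mx.
have H := transition_strict_diff pc1.2 pc2.2 HF.
have := strict_diff_comp (HA c1 pc1) H.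
by move=> /(strict_diff_unique pc.2 (HA c2 pc2)) ->; rewrite mulmxA.
Qed.

End TangentVectors.

Section QuadraticForms.
Variables (R : realType) (m : nat).
Implicit Types (A B : 'M[R]_m) (v w : 'rV[R]_m).

Definition quad A v : R := (v *m A *m v^T) 0 0.

Lemma quad_dotp A v : quad A v = dotp (v *m A) v.
Proof. by rewrite /quad mxE; apply: eq_bigr => i _; rewrite [v^T _ _]mxE. Qed.

Lemma quadZ A (t : R) v : quad A (t *: v) = t ^+ 2 * quad A v.
Proof.
by rewrite /quad [(_ *: _)^T]linearZ /= -scalemxAr -!scalemxAl scalerA mxE expr2.
Qed.

Lemma mulmx_norm_le A v : `|v *m A| <= m%:R * (`|A| * `|v|).
Proof.
rewrite rv_norm_le; last by rewrite !mulr_ge0.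
apply/forallP => j; rewrite mxE.
apply: le_trans (ler_norm_sum _ _ _) _.
apply: (@le_trans _ _ (\sum_(i < m) `|A| * `|v|)).
  apply: ler_sum => i _; rewrite normrM mulrC.
  apply: ler_pM => //; last exact: rv_coord_le.
  rewrite [leRHS]/Num.norm /= mx_normrE.
  by apply/bigmax_geP; right; exists (i, j).
by rewrite sumr_const card_ord mulr_natl.
Qed.

Definition quad_cst : R := m.+1%:R * m.+1%:R.

Lemma quad_bound A v : `|quad A v| <= quad_cst * `|A| * `|v| ^+ 2.
Proof.
rewrite quad_dotp; apply: le_trans (dotp_bound _ _) _.
rewrite /quad_cst -!mulrA ler_pM2l ?ltr0n// expr2.
have -> : m.+1%:R * (`|A| * (`|v| * `|v|)) = (m.+1%:R * (`|A| * `|v|)) * `|v| by ring.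
rewrite ler_wpM2r//; apply: le_trans (mulmx_norm_le _ _) _.
by rewrite ler_wpM2r ?mulr_ge0// ler_nat.
Qed.

Lemma quadB A B v : quad A v - quad B v = quad (A - B) v.
Proof. by rewrite /quad mulmxBr mulmxBl [RHS]mxE [X in _ = _ + X]mxE. Qed.

Lemma quad_continuous A : continuous (quad A).
Proof.
move=> v.
have -> : quad A = (fun w => sqn (w + w *m A - 0) / 2 - sqn (w - 0) / 2 - sqn (w *m A - 0) / 2).
  (* Polarization reduces continuity to that of [sqn]. *)
  apply/funext => w; rewrite quad_dotp !subr0 /sqn /dotp !mulr_suml -!sumrB.
  by apply: eq_bigr => i _; rewrite [(w + _) 0 i]mxE; field.
have [K K0 HK] := mulmx_bound A.
have cA : continuous (fun w : 'rV[R]_m => w *m A).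
  apply: (@continuous_of_lipschitz _ _ _ _ K) => x y.
  by rewrite -mulmxBl; exact: HK.
have cB : continuous (fun w : 'rV[R]_m => w + w *m A).
  apply: (@continuous_of_lipschitz _ _ _ _ (1 + K)) => x y.
  rewrite opprD addrACA -mulmxBl mulrDl mul1r (le_trans (ler_normD _ _))//.
  by rewrite lerD.
have s (f : 'rV[R]_m -> 'rV[R]_m) : continuous f ->
    {for v, continuous (fun w => sqn (f w - 0) / 2)}.
  move=> cf; apply: (@continuousM _ _ (fun w => sqn (f w - 0)) (cst 2^-1)).
    exact: (continuous_comp (cf v) (@sqn_continuous _ _ 0 _)).
  exact: cst_continuous.
apply: (@continuousB _ R^o _ (fun w => sqn (w + w *m A - 0) / 2 - sqn (w - 0) / 2)).
  apply: (@continuousB _ R^o _ (fun w => sqn (w + w *m A - 0) / 2)).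
    exact: s cB.
  by apply: (s id); apply: (@continuous_of_lipschitz _ _ _ _ 1) => x y; rewrite mul1r.
exact: s cA.
Qed.

(** A positive lower bound on the compact unit sphere, extended by homogeneity. *)
Lemma quad_coercive A : (forall v, v != 0 -> 0 < quad A v) ->
  exists2 e, 0 < e & forall v, e * `|v| ^+ 2 <= quad A v.
Proof.
move=> pos; pose S := [set v : 'rV[R]_m | `|v| = 1].
have cS : compact S.
  apply: bounded_closed_compact.
    by exists 1; split; [exact: num_real|move=> x x1 v /= ->; exact: ltW].
  have cn : continuous (fun v : 'rV[R]_m => `|v| : R).
    apply: (@continuous_of_lipschitz _ _ _ _ 1) => x y.
    by rewrite mul1r; exact: ler_dist_dist.
  by move/continuous_closedP: cn => /(_ [set 1]); apply; exact: closed_eq.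
have H (v : 'rV[R]_m) : S v -> \forall v' \near v & e \near (0 : R)^'+, e < quad A v'.
  move=> Sv; have v0 : v != 0 by rewrite -normr_eq0 Sv oner_eq0.
  have q0 : 0 < quad A v / 2 by rewrite divr_gt0// pos.
  exists ([set v' | `|quad A v - quad A v'| < quad A v / 2], [set e | e < quad A v / 2]).
    split; last exact: nbhs_right_lt.
    by have /cvgrPdist_lt/(_ _ q0) := @quad_continuous A v.
  move=> [v' e] /= [+ h]; rewrite ltr_norml.
  by move: (quad A v') (quad A v) h => x y h; lra.
have He := (compact_near_coveringP S).1 cS _ _ _ (at_right_proper_filter (0 : R)) H.
have [e [/= e0 He']] := filter_ex (filterI (nbhs_right_gt (0 : R)) He).
exists e => // v; have [->|v0] := eqVneq v 0.
  have := quad_bound A 0; rewrite normr0 expr0n /= !mulr0 normr_le0 => /eqP ->.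
  exact: lexx.
have nv : 0 < `|v| by rewrite normr_gt0.
have /He'/ltW : S (`|v|^-1 *: v).
  by rewrite /S /= normrZ gtr0_norm ?invr_gt0// mulVf// lt0r_neq0.
by rewrite quadZ exprVn mulrC ler_pdivlMr// exprn_gt0.
Qed.

End QuadraticForms.

Section RiemannianBounds.
Variables (R : realType) (m : nat) (M : C1_manifold R m).
Variables (g : riemannian_metric M).

(** The matrix at [o] is coercive with constant [e]. Nearby matrices differ from it by so little
    that [e / 2] survives as a lower constant; the square roots of the constants compare lengths. *)
Lemma riem_comparison (o : M) (c : chart R m M) : chart_at o c ->
  exists lam K : R, [/\ 0 < lam, 0 < K & exists2 U, nbhs o U &
    forall p v, U p -> tangent_space p v ->
      lam * `|v c| <= Num.sqrt (g p v v) <= K * `|v c|].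
Proof.
move=> oc; have [G cG HG] := riem_continuous g oc.1.
have HGq p v : chart_dom c p -> tangent_space p v -> g p v v = quad (G p) (v c).
  by move=> cp tv; rewrite HG.
have pos w : w != 0 -> 0 < quad (G o) w.
  move=> w0; have [v [tv vc]] := tangent_vector_exists w oc.
  rewrite -vc -HGq//; last exact: oc.2.
  apply: (inner_positive (riem_inner g o)) => //.
  by apply: contraNneq w0 => v0; rewrite -vc v0.
have [e e0 He] := quad_coercive pos.
pose C := quad_cst R m; have C0 : 0 < C by rewrite mulr_gt0 ?ltr0n.
pose d := e / (2 * C); have d0 : 0 < d by rewrite divr_gt0// mulr_gt0.
have nG : nbhs o [set p | `|G o - G p| < d].
  move/subspace_continuousP : cG => /(_ o oc.2) /cvgrPdist_lt/(_ d d0) H.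
  by apply: filterS2 (chart_dom_nbhs oc.2) H => p cp; apply.
pose K := C * (`|G o| + d) + 1.
have K1 : 0 <= C * (`|G o| + d) by rewrite mulr_ge0 ?ltW// ltr_wpDl.
have K0 : 0 < K by rewrite ltr_wpDl.
exists (Num.sqrt (e / 2)), (Num.sqrt K); split.
- by rewrite sqrtr_gt0 divr_gt0.
- by rewrite sqrtr_gt0.
exists (chart_dom c `&` [set p | `|G o - G p| < d]).
  exact: filterI (chart_dom_nbhs oc.2) nG.
move=> p v [cp /= Gp] tv; rewrite HGq//.
set w := v c.
have B1 : `|quad (G o) w - quad (G p) w| <= e / 2 * `|w| ^+ 2.
  rewrite quadB; apply: le_trans (quad_bound _ _) _.
  rewrite ler_wpM2r ?exprn_ge0//.
  apply: (@le_trans _ _ (C * d)); first by rewrite ler_pM2l// ltW.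
  by rewrite /d; have -> : C * (e / (2 * C)) = e / 2 by field; rewrite lt0r_neq0.
have B2 : quad (G p) w <= K * `|w| ^+ 2.
  apply: le_trans (ler_norm _) _; apply: le_trans (quad_bound _ _) _.
  rewrite ler_wpM2r ?exprn_ge0//; apply: (@le_trans _ _ (C * (`|G o| + d))).
    rewrite ler_pM2l//; have := ler_normB (G o) (G o - G p).
    by rewrite opprB addrCA subrr addr0; lra.
  by rewrite lerDl.
have B3 : e / 2 * `|w| ^+ 2 <= quad (G p) w.
  have := He w; move: B1; rewrite ler_norml => /andP[_].
  move: (quad (G p) w) (quad (G o) w) (`|w| ^+ 2) => x y z; lra.
have nE : `|w| = Num.sqrt (`|w| ^+ 2) by rewrite sqrtr_sqr normr_id.
have e2 : 0 <= e / 2 by rewrite divr_ge0// ltW.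
by rewrite nE -(sqrtrM _ e2) -(sqrtrM _ (ltW K0)) !ler_wsqrtr.
Qed.

End RiemannianBounds.

(** * Curves of class C^1 and their velocities *)

Section Curves.
Variables (R : realType) (m : nat) (M : C1_manifold R m).
Implicit Types (c : chart R m M) (p : M) (gamma : R -> M) (a b t : R).

Lemma C1_near_derive1 (F : R -> 'rV[R]_m) t : C1_near F t ->
  nbhs t [set s | derivable F s 1] /\ {for t, continuous (derive1 F)}.
Proof.
move=> C1; split.
  by apply: filterS C1 => s [dF _]; exact: diff_derivable.
have [_ /(_ 1) cd] := nbhs_singleton C1.
have E : nbhs t [set s | 'd F s 1 = derive1 F s].
  by apply: filterS C1 => s [dF _]; rewrite /= derive1E deriveE.
have : derive1 F s @[s --> t] --> 'd F t 1.
  by apply: cvg_trans cd; exact: near_eq_cvg.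
by rewrite (nbhs_singleton E : 'd F t 1 = derive1 F t).
Qed.

Definition C1_piece a b gamma : Prop :=
  {within `[a, b], continuous gamma} /\ C1_path_on a b gamma.

Lemma C1_piece_local a b gamma c t : C1_piece a b gamma -> atlas c ->
  t \in `[a, b] -> chart_dom c (gamma t) -> exists F : R -> 'rV[R]_m,
    C1_near F t /\ nbhs t [set s | s \in `[a, b] ->
      chart_dom c (gamma s) /\ F s = chart_map c (gamma s)].
Proof.
move=> [cg C1g] ac tab ct.
have [|F [C1F EF]] := C1g c ac t; first by split.
exists F; split=> //.
have nd : nbhs t [set s | s \in `[a, b] -> chart_dom c (gamma s)].
  move/subspace_continuousP : cg => /(_ t tab).
  by move=> /(_ _ (chart_dom_nbhs ct)).
by apply: filterS2 nd EF => s ds Es sab; split; [exact: ds|apply: Es; split=> //; exact: ds].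
Qed.

Lemma itvoo_nbhs a b t : t \in `]a, b[ -> nbhs t [set s | s \in `]a, b[].
Proof.
move=> tab; apply: open_nbhs_nbhs; split=> //.
Qed.

Lemma itvoo_sub_itvcc a b t : t \in `]a, b[ -> t \in `[a, b].
Proof. by rewrite !in_itv /= => /andP[/ltW -> /ltW ->]. Qed.

Lemma C1_piece_interior a b gamma c t : C1_piece a b gamma -> atlas c ->
  t \in `]a, b[ -> chart_dom c (gamma t) ->
  [/\ nbhs t [set s | chart_dom c (gamma s)],
      nbhs t [set s | derivable (chart_map c \o gamma) s 1] &
      {for t, continuous (derive1 (chart_map c \o gamma))}].
Proof.
move=> gP ac tab ct; have [F [C1F EF]] := C1_piece_local gP ac (itvoo_sub_itvcc tab) ct.
have {}EF : nbhs t [set s | chart_dom c (gamma s) /\ F s = chart_map c (gamma s)].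
  by apply: filterS2 (itvoo_nbhs tab) EF => s /itvoo_sub_itvcc sab; exact.
have [dF cF] := C1_near_derive1 C1F.
have EF2 : nbhs t [set s | nbhs s [set u | F u = (chart_map c \o gamma) u]].
  have := (nbhs_interior EF); apply: filterS => s.
  by apply: filterS => u [].
have Ed : nbhs t [set s | derive1 F s = derive1 (chart_map c \o gamma) s].
  by apply: filterS EF2 => s Es /=; rewrite !derive1E; exact: near_eq_derive.
split.
- by apply: filterS EF => s [].
- apply: filterS2 dF EF2 => s ds Es; exact: near_eq_derivable Es ds.
- have : derive1 (chart_map c \o gamma) s @[s --> t] --> derive1 F t.
    by apply: cvg_trans cF; exact: near_eq_cvg.
  by rewrite (nbhs_singleton Ed : derive1 F t = derive1 (chart_map c \o gamma) t).
Qed.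

(** [t] may be an end of the interval, where the two-sided derivative of the curve is possibly
    meaningless. The C^1 extension across [t] still bounds the derivatives at nearby interior
    points. *)
Lemma C1_piece_boundary a b gamma c t : C1_piece a b gamma -> atlas c ->
  t \in `[a, b] -> chart_dom c (gamma t) ->
  exists K, nbhs t [set s | s \in `]a, b[ ->
    chart_dom c (gamma s) /\ `|derive1 (chart_map c \o gamma) s| <= K].
Proof.
move=> gP ac tab ct; have [F [C1F EF]] := C1_piece_local gP ac tab ct.
have [dF cF] := C1_near_derive1 C1F.
exists (`|derive1 F t| + 1).
have B : nbhs t [set s | `|derive1 F s| <= `|derive1 F t| + 1].
  have /cvgrPdist_lt/(_ _ ltr01) := cF; apply: filterS => s; exact: ler_norm_dist.
have EF2 := nbhs_interior EF.
apply: filterS2 B EF2 => s Bs Es sab.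
have [ds _] := nbhs_singleton Es (itvoo_sub_itvcc sab); split; first exact: ds.
suff <- : derive1 F s = derive1 (chart_map c \o gamma) s by exact: Bs.
rewrite !derive1E; apply: near_eq_derive.
by apply: filterS2 (itvoo_nbhs sab) Es => u /itvoo_sub_itvcc uab /(_ uab)[].
Qed.

Lemma velocityE gamma t c : chart_at (gamma t) c ->
  velocity gamma t c = derive1 (chart_map c \o gamma) t.
Proof. by move=> ct; rewrite /velocity asboolT. Qed.

Lemma velocity_tangent a b gamma t : C1_piece a b gamma -> t \in `]a, b[ ->
  tangent_space (gamma t) (velocity gamma t).
Proof.
move=> gP tab; split=> [c1 c2 ct1 ct2|c nct]; last by rewrite /velocity asboolF.
have [|F HF] := atlas_C1 ct1.1 ct2.1 (x := chart_map c1 (gamma t)).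
  by exists (gamma t) => //; split; [exact: ct1.2|exact: ct2.2].
exists F => //; rewrite !velocityE//.
have [n1 d1 _] := C1_piece_interior gP ct1.1 tab ct1.2.
have [n2 _ _] := C1_piece_interior gP ct2.1 tab ct2.2.
have [C1F EF] := HF.
have df1 : differentiable (chart_map c1 \o gamma) t.
  by apply/derivable1_diffP; exact: nbhs_singleton d1.
have dF : differentiable F ((chart_map c1 \o gamma) t) by have [] := nbhs_singleton C1F.
have E : nbhs t [set s | (F \o (chart_map c1 \o gamma)) s = (chart_map c2 \o gamma) s].
  have := differentiable_continuous df1 EF.
  apply: filterS2 (filterI n1 n2) => s [d1s d2s] /= ->.
    by rewrite /transition /= chart_invK.
  by exists (gamma s).
rewrite derive1E -(near_eq_derive _ E) deriveE; last exact: differentiable_comp.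
by rewrite diff_comp// derive1E deriveE.
Qed.

End Curves.

(** * Integrals of bounded measurable functions over intervals *)

Section BoundedMeasurable.
Variable R : realType.
Implicit Types (f : R -> R) (a b c : R).
Local Notation mu := (@lebesgue_measure R).

(** The speed of a piecewise C^1 path need not be continuous; this weaker property survives
    concatenation and arbitrary values at the subdivision points, and still gives integrability. *)
Definition bounded_measurable f a b : Prop :=
  measurable_fun `[a, b] f /\ exists K, forall t, t \in `[a, b] -> `|f t| <= K.

Lemma bounded_measurable_integrable f a b : bounded_measurable f a b ->
  mu.-integrable `[a, b] (EFin \o f).
Proof.
move=> [mf [K HK]]; apply: measurable_bounded_integrable => //.
  by rewrite /= lebesgue_measure_itv /=; case: ifP => _; rewrite -?EFinD ltry.
exists K; split; first exact: num_real.
by move=> x Kx t /= tab; apply/ltW; apply: le_lt_trans Kx; exact: HK.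
Qed.

Lemma bounded_measurable_cat f a b c : a <= b -> b <= c ->
  bounded_measurable f a b -> bounded_measurable f b c -> bounded_measurable f a c.
Proof.
move=> ab bc [m1 [K1 H1]] [m2 [K2 H2]]; split.
  have -> : `[a, c]%classic = `[a, b]%classic `|` `[b, c]%classic.
    apply/seteqP; split=> x /=; rewrite !in_itv /=.
      by move=> /andP[ax xc]; have [xb|/ltW bx] := leP x b; [left|right]; apply/andP.
    move=> [/andP[ax xb]|/andP[bx xc]]; apply/andP; split=> //.
      exact: le_trans bc.
    exact: le_trans bx.
  by apply/measurable_funU.
exists (Num.max K1 K2) => t; rewrite in_itv /= => /andP[ta tc].
rewrite le_max; have [tb|/ltW bt] := leP t b.
  by rewrite H1// in_itv /= ta.
by rewrite H2 ?orbT// in_itv /= bt.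
Qed.

Lemma bounded_measurable_sub f a b c d : a <= c -> d <= b ->
  bounded_measurable f a b -> bounded_measurable f c d.
Proof.
move=> ac db [mf [K HK]].
have sub t : t \in `[c, d] -> t \in `[a, b].
  rewrite !in_itv /= => /andP[ct td].
  by rewrite (le_trans ac ct) (le_trans td db).
split; first by apply: measurable_funS mf => // t; exact: sub.
by exists K => t /sub; exact: HK.
Qed.

Lemma Rintegral_cat f a b c : a <= b -> b <= c ->
  bounded_measurable f a c ->
  \int[mu]_(t in `[a, c]) f t = \int[mu]_(t in `[a, b]) f t + \int[mu]_(t in `[b, c]) f t.
Proof.
move=> ab bc /bounded_measurable_integrable fi.
have := @Rintegral_itvB _ f (BLeft a) (BRight c) b fi; rewrite !bnd_simp => /(_ ab bc).
rewrite Rintegral_itv_obnd_cbnd; last first.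
  apply: integrableS fi => //; apply: subset_itvr.
  by rewrite bnd_simp.
by move=> <-; rewrite addrC subrK.
Qed.

(** The ends form a null set; this disposes of the meaningless velocities there. *)
Lemma Rintegral_itv_eq f f' a b : (forall t, t \in `]a, b[ -> f t = f' t) ->
  measurable_fun `]a, b[ f ->
  \int[mu]_(t in `[a, b]) f t = \int[mu]_(t in `[a, b]) f' t.
Proof.
move=> ff' mf.
have mf' : measurable_fun `]a, b[ f'.
  by apply: eq_measurable_fun mf => t; rewrite inE /= => /ff'.
have open_int h : measurable_fun `]a, b[ h ->
    \int[mu]_(t in `[a, b]) h t = \int[mu]_(t in `]a, b[) h t.
  move=> mh; rewrite /Rintegral -integral_itv_bndo_bndc; last first.
    apply/measurable_EFinP; exact: measurable_fun_itv_co mh.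
  by rewrite -integral_itv_obnd_cbnd//; apply/measurable_EFinP.
rewrite !open_int//; apply: eq_Rintegral => t; rewrite inE /=; exact: ff'.
Qed.

Lemma Rintegral_ge_sub f a b c d : a <= c -> c <= d -> d <= b ->
  bounded_measurable f a b -> (forall t, 0 <= f t) ->
  \int[mu]_(t in `[c, d]) f t <= \int[mu]_(t in `[a, b]) f t.
Proof.
move=> ac cd db bm f0.
rewrite (Rintegral_cat ac (le_trans cd db) bm).
rewrite (Rintegral_cat cd db (bounded_measurable_sub ac (lexx b) bm)).
have h1 : 0 <= \int[mu]_(t in `[a, c]) f t by exact: Rintegral_ge0.
have h2 : 0 <= \int[mu]_(t in `[d, b]) f t by exact: Rintegral_ge0.
by rewrite [leRHS]addrCA lerDl addr_ge0.
Qed.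

Lemma Rintegral_le_cst f a b K : a <= b -> bounded_measurable f a b ->
  (forall t, t \in `]a, b[ -> f t <= K) ->
  \int[mu]_(t in `[a, b]) f t <= K * (b - a).
Proof.
move=> ab bm fK; have [mf _] := bm.
pose h t := if t \in `]a, b[ then f t else K.
have mo : measurable_fun `]a, b[ f by apply: measurable_funS mf => //; exact: subset_itv_oo_cc.
have mh : measurable_fun `]a, b[ h.
  by apply: eq_measurable_fun mo => t; rewrite inE /= /h => ->.
rewrite (@Rintegral_itv_eq f h)//; last by move=> t tab; rewrite /h tab.
have bh : bounded_measurable h a b.
  split; first exact: measurable_fun_itv_cc mh.
  have [K' HK'] := bm.2; exists (Num.max K' `|K|) => t tab.
  by rewrite /h le_max; case: ifP => _; rewrite ?HK'// lexx orbT.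
have bK : bounded_measurable (fun=> K) a b by split=> //; exists `|K|.
apply: (@le_trans _ _ (\int[mu]_(t in `[a, b]) K)).
  apply: le_Rintegral => //; [exact: bounded_measurable_integrable|
    exact: bounded_measurable_integrable|].
  by move=> t _; rewrite /h; case: ifP => // /fK.
rewrite Rintegral_cst//= lebesgue_measure_itv /= lte_fin.
by case: ltP => //= ba; rewrite (le_anti (_ : a <= b <= a)) ?subrr ?mulr0// ab.
Qed.

(** Translations and reflections preserve Lebesgue measure, by uniqueness of the measure with the
    right values on half-open intervals. A reflection exchanges the open and closed ends, which
    leaves the length unchanged. *)
Lemma Rintegral_isometry f a b a' b' (k s : R) : k = 1 \/ k = -1 ->
  (forall t, (k * t + s \in `[a, b]) = (t \in `[a', b'])) ->
  measurable_fun `[a, b] f -> (forall t, 0 <= f t) ->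
  \int[mu]_(t in `[a', b']) f (k * t + s) = \int[mu]_(t in `[a, b]) f t.
Proof.
move=> k1 E mf f0; pose T t := k * t + s.
have mT : measurable_fun [set: R] T.
  apply: continuous_measurable_fun; apply: (@continuous_of_lipschitz _ R^o R^o _ 1) => x y.
  rewrite opprD addrACA subrr addr0 -mulrBr normrM mul1r.
  by case: k1 => ->; rewrite ?normrN normr1 mul1r.
have muT A : measurable A -> mu A = pushforward mu T A.
  pose T' : measurableTypeR R -> measurableTypeR R := T.
  have mT' : measurable_fun [set: measurableTypeR R] T' := mT.
  pose nu := measure_function_pushforward__canonical__measure_function_Measure mu mT'.
  move: A; apply: (@lebesgue_measure_unique R nu) => _ [[x y] _ <-] /=.
  rewrite lebesgue_measure_itv /= lte_fin /pushforward.
  case: k1 => k1.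
    have -> : T @^-1` `]x, y] = `](x - s), (y - s)]%classic.
      by apply/seteqP; split=> t; rewrite /= !in_itv /= /T k1 mul1r ltrBlDr lerBrDr.
    rewrite lebesgue_measure_itv /= lte_fin ltrD2r.
    by case: ifP => // _; rewrite -!EFinB; congr EFin; ring.
  have -> : T @^-1` `]x, y] = `[(s - y), (s - x)[%classic.
    apply/seteqP; split=> t; rewrite /= !in_itv /= /T k1 mulN1r;
      move=> /andP[h1 h2]; apply/andP; split; lra.
  rewrite lebesgue_measure_itv /= lte_fin ltrD2l ltrN2.
  by case: ifP => // _; rewrite -!EFinB; congr EFin; ring.
rewrite /Rintegral; congr fine.
have mfE : measurable_fun `[a, b] (EFin \o f) by exact/measurable_EFinP.
have f0E : {in `[a, b]%classic, forall y, (0 <= (EFin \o f) y)%E}.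
  by move=> y _; rewrite /= lee_fin.
have := @ge0_integral_pushforward _ _ (measurableTypeR R) (measurableTypeR R) R
  T mT mu `[a, b]%classic (EFin \o f) (measurable_itv _) mfE f0E.
have -> : T @^-1` `[a, b] = `[a', b']%classic :> set R.
  by apply/seteqP; split=> t; rewrite /= /T E.
move=> <-; apply: eq_measure_integral => A mA _; exact/esym/muT.
Qed.

End BoundedMeasurable.

(** * The speed of a curve of class C^1 *)

Section Speed.
Variables (R : realType) (m : nat) (M : C1_manifold R m).
Variable g : riemannian_metric M.
Implicit Types (c : chart R m M) (p : M) (gamma : R -> M) (a b t : R).

Definition speed gamma t : R :=
  Num.sqrt (g (gamma t) (velocity gamma t) (velocity gamma t)).

Lemma speed_ge0 gamma t : 0 <= speed gamma t.
Proof. exact: sqrtr_ge0. Qed.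

Lemma C1_piece_continuous a b gamma t : C1_piece a b gamma -> t \in `]a, b[ ->
  gamma s @[s --> t] --> gamma t.
Proof.
move=> [cg _] tab; have := cg.
move=> /subspace_continuousP/(_ t (itvoo_sub_itvcc tab)) H U /H HU.
apply: filterS2 (itvoo_nbhs tab) HU => s /itvoo_sub_itvcc sab; exact.
Qed.

Lemma speedE a b gamma t c (G : M -> 'M[R]_m) : C1_piece a b gamma ->
  t \in `]a, b[ -> atlas c -> chart_dom c (gamma t) ->
  (forall p v w, chart_dom c p -> tangent_space p v -> tangent_space p w ->
      g p v w = (v c *m G p *m (w c)^T) 0 0) ->
  speed gamma t = Num.sqrt (quad (G (gamma t)) (derive1 (chart_map c \o gamma) t)).
Proof.
move=> gP tab ac ct HG; have tv := velocity_tangent gP tab.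
by rewrite /speed HG// velocityE.
Qed.

Lemma speed_continuous a b gamma t : C1_piece a b gamma -> t \in `]a, b[ ->
  {for t, continuous (speed gamma)}.
Proof.
move=> gP tab; have [c ac ct] := atlas_cover (gamma t).
have [G cG HG] := riem_continuous g ac.
have [dn _ cv] := C1_piece_interior gP ac tab ct.
have cgam := C1_piece_continuous gP tab.
set v := derive1 (chart_map c \o gamma) in cv.
have E : nbhs t [set s | Num.sqrt (quad (G (gamma s)) (v s)) = speed gamma s].
  apply: filterS2 dn (itvoo_nbhs tab) => s ds sab /=.
  by rewrite (speedE gP sab ac ds HG).
have cq : quad (G (gamma s)) (v s) @[s --> t] --> quad (G (gamma t)) (v t).
  have cGt : G (gamma s) @[s --> t] --> G (gamma t).
    move/subspace_continuousP : cG => /(_ (gamma t) ct) H U /H HU.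
    by apply: filterS2 dn (cgam _ HU) => s ds; exact.
  apply/cvgrPdist_lt => e e0.
  have Q0 : 0 < quad_cst R m by rewrite mulr_gt0 ?ltr0n.
  have N0 : 0 < (`|v t| + 1) ^+ 2 by rewrite exprn_gt0// ltr_wpDl.
  pose C := quad_cst R m * (`|v t| + 1) ^+ 2.
  have C0 : 0 < C by rewrite mulr_gt0.
  have d0 : 0 < e / (2 * C) by rewrite divr_gt0// mulr_gt0.
  have e2 : 0 < e / 2 by rewrite divr_gt0.
  have /cvgrPdist_lt/(_ _ d0) h1 := cGt.
  have /cvgrPdist_lt/(_ _ ltr01) h2 := cv.
  have /cvgrPdist_lt/(_ _ e2) h3 := cvg_comp _ _ cv (@quad_continuous R m (G (gamma t)) (v t)).
  apply: filterS2 h1 (filterI h2 h3) => s g1 [/= g2 g3].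
  have nv : `|v s| <= `|v t| + 1 by exact: ler_norm_dist g2.
  have -> : quad (G (gamma t)) (v t) - quad (G (gamma s)) (v s) =
    (quad (G (gamma t)) (v t) - quad (G (gamma t)) (v s)) +
    (quad (G (gamma t)) (v s) - quad (G (gamma s)) (v s)) by rewrite addrA subrK.
  apply: le_lt_trans (ler_normD _ _) _.
  rewrite quadB [ltRHS]splitr; apply: ltr_leD g3 _.
  apply: le_trans (quad_bound _ _) _.
  have -> : e / 2 = quad_cst R m * (e / (2 * C)) * (`|v t| + 1) ^+ 2.
    rewrite /C; move: (quad_cst R m) ((`|v t| + 1) ^+ 2) Q0 N0 => x y x0 y0.
    by field; rewrite !lt0r_neq0.
  apply: ler_pM => //; first by rewrite mulr_ge0// ltW.
    by rewrite ler_pM2l//; exact: ltW.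
  by rewrite ler_pXn2r ?nnegrE// addr_ge0.
have cs : Num.sqrt (quad (G (gamma s)) (v s)) @[s --> t] -->
    Num.sqrt (quad (G (gamma t)) (v t)).
  exact: cvg_comp cq (@sqrt_continuous R _).
have : speed gamma s @[s --> t] --> Num.sqrt (quad (G (gamma t)) (v t)).
  by apply: cvg_trans cs; exact: near_eq_cvg.
by rewrite (nbhs_singleton E : Num.sqrt _ = speed gamma t).
Qed.

(** Near each time, ends included, the metric is comparable with the chart norm and the coordinate
    velocity is bounded; compactness of [[a, b]] makes the bound uniform. *)
Lemma speed_bounded a b gamma : C1_piece a b gamma ->
  exists K, forall t, t \in `]a, b[ -> speed gamma t <= K.
Proof.
move=> gP.
have cI : compact `[a, b] by exact: segment_compact.
have H (t : R) : `[a, b]%classic t -> \forall s \near t & K \near +oo,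
    s \in `]a, b[ -> speed gamma s <= K.
  move=> tab; have [c ac ct] := atlas_cover (gamma t).
  have [lam [K [_ K0 [U oU HU]]]] := riem_comparison g (conj ac ct).
  have [D HD] := C1_piece_boundary gP ac tab ct.
  have nU : nbhs t [set s | s \in `[a, b] -> U (gamma s)].
    move/subspace_continuousP : gP.1 => /(_ t tab); exact.
  exists ([set s | (s \in `]a, b[ ->
      chart_dom c (gamma s) /\ `|derive1 (chart_map c \o gamma) s| <= D) /\
      (s \in `[a, b] -> U (gamma s))], [set B | K * D <= B]).
    by split; [exact: (filterI HD nU)|exact: (nbhs_pinfty_ge (num_real _))].
  move=> [s B] /= [[h1 h2] KB] sab; apply: le_trans KB.
  have [ds vs] := h1 sab.
  have := HU _ _ (h2 (itvoo_sub_itvcc sab)) (velocity_tangent gP sab).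
  rewrite velocityE// => /andP[_ ub]; apply: le_trans ub _.
  by rewrite ler_pM2l.
have HK := (compact_near_coveringP `[a, b]%classic).1 cI _ _ _ proper_pinfty_nbhs H.
have [K HK'] := filter_ex HK.
by exists K => t tab; apply: (HK' t) => //; exact: itvoo_sub_itvcc.
Qed.

Lemma speed_measurable a b gamma : C1_piece a b gamma ->
  measurable_fun `]a, b[ (speed gamma).
Proof.
move=> gP; apply: open_continuous_measurable_fun; first exact: interval_open.
by move=> t; rewrite inE /= => tab; exact: speed_continuous gP tab.
Qed.

Lemma speed_bounded_measurable a b gamma : C1_piece a b gamma ->
  bounded_measurable (speed gamma) a b.
Proof.
move=> gP; split; first exact: measurable_fun_itv_cc (speed_measurable gP).
have [K HK] := speed_bounded gP.
exists (Num.max K (Num.max (speed gamma a) (speed gamma b))) => t.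
rewrite in_itv /= => /andP[ta tb].
rewrite ger0_norm ?speed_ge0// !le_max.
have [->|tna] := eqVneq t a; first by apply/or3P; constructor 2; exact: lexx.
have [->|tnb] := eqVneq t b; first by apply/or3P; constructor 3; exact: lexx.
by rewrite HK// in_itv /= !lt_neqAle ta tb tnb eq_sym tna.
Qed.

End Speed.

Lemma affine_is_diff (R : realType) (k s u : R) :
  is_diff u (fun v : R => k * v + s) (fun h : R => k * h).
Proof.
have D := is_diffD (is_diff_scaler k u) (is_diff_cst s u).
by apply: is_diff_eq D _; rewrite addr0.
Qed.

(** The differential of [T] is the same map everywhere. Both the reparametrizations of time and the
    segments in charts are of this kind. *)
Lemma C1_near_comp_affine (R : realType) (V W : normedModType R) (F : V -> W)
    (T dT : R -> V) (t : R) : (forall u, is_diff u T dT) ->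
  C1_near F (T t) -> C1_near (fun u => F (T u)) t.
Proof.
move=> T_diff C1.
have cT : continuous T.
  by move=> u; apply: differentiable_continuous; have [] := T_diff u.
have C1T : nbhs (T t) [set y | differentiable F y /\
    forall v : V, {for y, continuous (fun z => 'd F z v)}] := C1.
have C1' : nbhs t (T @^-1` [set y | differentiable F y /\
    forall v : V, {for y, continuous (fun z => 'd F z v)}]) by exact: cT C1T.
have C2 := nbhs_interior C1'.
have dTu u : differentiable T u by have [] := T_diff u.
have dE u v : differentiable F (T u) -> 'd (F \o T) u v = 'd F (T u) (dT v).
  move=> dF; have E := diff_comp (dTu u) dF.
  transitivity (('d F (T u) \o 'd T u) v); first exact: (congr1 (fun h => h v) E).
  have [_ E2] := T_diff u.
  exact: (congr1 (fun h : R -> V => 'd F (T u) (h v)) E2).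
apply: filterS C2 => u Cu; have [dF cF] := nbhs_singleton Cu.
split.
  by apply: (@differentiable_comp _ _ _ _ T F) => //; have [] := T_diff u.
move=> v.
have H : 'd F (T z) (dT v) @[z --> u] --> 'd F (T u) (dT v).
  exact: (cvg_comp _ _ (cT u) (cF (dT v))).
have En : nbhs u [set z | 'd F (T z) (dT v) = 'd (F \o T) z v].
  by apply: filterS Cu => z [dFz _]; exact: (esym (dE z v dFz)).
have H2 : 'd (F \o T) z v @[z --> u] --> 'd F (T u) (dT v).
  by apply: cvg_trans H; exact: near_eq_cvg.
exact: (eq_ind _ (fun w => 'd (F \o T) z v @[z --> u] --> w) H2 _ (nbhs_singleton En)).
Qed.

(** * Piecewise C^1 paths and their length *)

Section PiecewisePaths.
Variables (R : realType) (m : nat) (M : C1_manifold R m).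
Variable g : riemannian_metric M.
Implicit Types (gamma : R -> M) (a b c t : R).
Local Notation mu := (@lebesgue_measure R).

(** Concatenation as a constructor replaces bookkeeping on subdivisions by structural induction;
    [piecewise_of_path] and [path_of_piecewise] prove the equivalence. *)
Inductive piecewise gamma : R -> R -> Prop :=
| piecewise_one a b : a < b -> C1_piece a b gamma -> piecewise gamma a b
| piecewise_cat a b c : piecewise gamma a b -> piecewise gamma b c ->
    piecewise gamma a c.

Lemma piecewise_lt gamma a b : piecewise gamma a b -> a < b.
Proof. by elim=> // {}a {}b c _ ab _; exact: lt_trans. Qed.

Fixpoint chain (P : R -> R -> Prop) a (s : seq R) : Prop :=
  if s is x :: s' then [/\ a < x, P a x & chain P x s'] else True.

Lemma chainP (P : R -> R -> Prop) a s : chain P a s <->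
  path <%R a s /\ forall i, (i < size s)%N -> P (nth 0 (a :: s) i) (nth 0 (a :: s) i.+1).
Proof.
elim: s a => [|x s IH] a /=; first by split.
split=> [[ax Pax /IH[ps H]]|[/andP[ax ps] H]].
  by rewrite ax ps; split=> // -[|i] //=; exact: H.
by split=> //; [exact: (H 0%N)|apply/IH; split=> // i is_; exact: (H i.+1)].
Qed.

Lemma chain_le (P : R -> R -> Prop) a s : chain P a s -> a <= last a s.
Proof.
elim: s a => [//|x s IH] a /= [ax _ /IH]; apply: le_trans; exact: ltW.
Qed.

Lemma chain_cat (P : R -> R -> Prop) a s1 s2 :
  chain P a s1 -> chain P (last a s1) s2 -> chain P a (s1 ++ s2).
Proof. by elim: s1 a => [//|x s IH] a /= [ax Pax H] H2; split=> //; exact: IH. Qed.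

Lemma piecewise_of_path a b gamma : piecewise_C1_path a b gamma ->
  piecewise gamma a b.
Proof.
move=> [ab cg [s [ps ls H]]].
have : chain (fun x y => C1_path_on x y gamma) a s by apply/chainP.
move: ab cg; rewrite -ls; clear b ls ps H.
elim: s a => [|x s IH] a /= ab cg; first by rewrite ltxx in ab.
move=> [ax Cax Hs]; have xl := chain_le Hs.
have P1 : piecewise gamma a x.
  apply: piecewise_one => //; split=> //; apply: continuous_subspaceW cg.
  by apply: subset_itvl; rewrite bnd_simp.
have [E|xl'] := eqVneq x (last x s); first by rewrite -E.
apply: piecewise_cat P1 _; apply: IH => //; first by rewrite lt_neqAle xl'.
by apply: continuous_subspaceW cg; apply: subset_itvr; rewrite bnd_simp ltW.
Qed.

Lemma path_of_piecewise a b gamma : piecewise gamma a b ->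
  piecewise_C1_path a b gamma.
Proof.
move=> gP; split; first exact: piecewise_lt gP.
  elim: gP => [{}a {}b _ []//|{}a {}b c P1 c1 P2 c2].
  have -> : `[a, c]%classic = `[a, b]%classic `|` `[b, c]%classic.
    have ab := ltW (piecewise_lt P1); have bc := ltW (piecewise_lt P2).
    apply/seteqP; split=> x /=; rewrite !in_itv /=.
      by move=> /andP[ax xc]; have [xb|/ltW bx] := leP x b; [left|right]; apply/andP.
    move=> [/andP[ax xb]|/andP[bx xc]]; apply/andP; split=> //.
      exact: le_trans bc.
    exact: le_trans bx.
  by apply: withinU_continuous c1 c2; exact: interval_closed.
suff [s [cs ls]] : exists s, chain (fun x y => C1_path_on x y gamma) a s /\ last a s = b.
  by have [ps H] := (chainP _ _ _).1 cs; exists s.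
elim: gP => [{}a {}b ab [_ C]|{}a {}b c _ [s1 [c1 l1]] _ [s2 [c2 l2]]].
  by exists [:: b].
exists (s1 ++ s2); split; last by rewrite last_cat l1.
by apply: chain_cat => //; rewrite l1.
Qed.

Lemma piecewise_bounded_measurable gamma a b : piecewise gamma a b ->
  bounded_measurable (speed g gamma) a b.
Proof.
elim=> [{}a {}b ab|{}a {}b c P1 H1 P2 H2]; first exact: speed_bounded_measurable.
by apply: bounded_measurable_cat H1 H2; apply/ltW; apply: piecewise_lt; eassumption.
Qed.

Definition arc_length gamma a b : R := \int[mu]_(t in `[a, b]) speed g gamma t.

Lemma arc_length_cat gamma a b c : piecewise gamma a b -> piecewise gamma b c ->
  arc_length gamma a c = arc_length gamma a b + arc_length gamma b c.
Proof.
move=> P1 P2; apply: Rintegral_cat; [exact/ltW/(piecewise_lt P1)|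
  exact/ltW/(piecewise_lt P2)|].
exact: piecewise_bounded_measurable (piecewise_cat P1 P2).
Qed.

(** Paths are functions on all of [R], so two that agree on [[a, b]] may still have different
    derivatives at its ends; the length does not see this. It serves to glue paths. *)
Lemma piecewise_congr gamma gamma' a b : piecewise gamma a b ->
  (forall t, t \in `[a, b] -> gamma t = gamma' t) ->
  piecewise gamma' a b /\ arc_length gamma' a b = arc_length gamma a b.
Proof.
elim=> [{}a {}b ab gP E|{}a {}b c P1 H1 P2 H2 E].
  split.
    apply: piecewise_one => //; have [cg C1g] := gP; split.
      apply/subspace_continuousP => t tab U.
      move=> HU; have HU' : nbhs (gamma t) U by rewrite E.
      have h1 : nbhs t [set s | s \in `[a, b] -> U (gamma s)].
        by move/subspace_continuousP : cg => /(_ t tab U HU').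
      have h2 : nbhs t [set s | s \in `[a, b] -> U (gamma' s)].
        by apply: filterS h1 => s h sab; rewrite -E//; exact: h.
      exact: h2.
    move=> c ac t [tab ct]; rewrite /= in ct.
    have [|F [CF EF]] := C1g c ac t; first by split=> //=; rewrite E.
    exists F; split=> //; apply: filterS EF => s h [sab cs]; rewrite /= in cs.
    by rewrite h /= ?E//; split=> //=; rewrite E.
  apply/esym/Rintegral_itv_eq; last exact: speed_measurable.
  move=> t tab; rewrite /speed.
  have -> : velocity gamma t = velocity gamma' t.
    apply/funext => c; rewrite /velocity (E t (itvoo_sub_itvcc tab)).
    case: asboolP => // _; rewrite !derive1E; apply: near_eq_derive.
    by apply: filterS (itvoo_nbhs tab) => s /itvoo_sub_itvcc /E /= ->.
  by rewrite (E t (itvoo_sub_itvcc tab)).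
have ab := piecewise_lt P1; have bc := piecewise_lt P2.
have [|Q1 L1] := H1.
  by move=> t; rewrite in_itv /= => /andP[ta tb]; apply: E;
    rewrite in_itv /= ta (le_trans tb (ltW bc)).
have [|Q2 L2] := H2.
  by move=> t; rewrite in_itv /= => /andP[ta tb]; apply: E;
    rewrite in_itv /= tb (le_trans (ltW ab) ta).
split; first exact: piecewise_cat Q1 Q2.
by rewrite (arc_length_cat P1 P2) (arc_length_cat Q1 Q2) L1 L2.
Qed.

End PiecewisePaths.

(** * Reversal and concatenation of paths *)

Section Reparametrization.
Variables (R : realType) (m : nat) (M : C1_manifold R m).
Variable g : riemannian_metric M.
Implicit Types (gamma : R -> M) (a b c k s t : R).

(** The isometry [t -> k * t + s] carries [[a', b']] onto [[a, b]]: translations serve concatenation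
    and reflections serve reversal. *)
Definition affine_itv k s a b a' b' : Prop :=
  (k = 1 /\ a = a' + s /\ b = b' + s) \/ (k = -1 /\ a = s - b' /\ b = s - a').

Lemma affine_itv_cc k s a b a' b' t : affine_itv k s a b a' b' ->
  (k * t + s \in `[a, b]) = (t \in `[a', b']).
Proof.
rewrite !in_itv /= => -[[-> [-> ->]]|[-> [-> ->]]].
  by rewrite mul1r !lerD2r.
rewrite mulN1r [- t + s]addrC !lerD2l !lerN2; exact: andbC.
Qed.

Lemma affine_itv_oo k s a b a' b' t : affine_itv k s a b a' b' ->
  (k * t + s \in `]a, b[) = (t \in `]a', b'[).
Proof.
rewrite !in_itv /= => -[[-> [-> ->]]|[-> [-> ->]]].
  by rewrite mul1r !ltrD2r.
rewrite mulN1r [- t + s]addrC !ltrD2l !ltrN2; exact: andbC.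
Qed.

Lemma affine_itv_lt k s a b a' b' : affine_itv k s a b a' b' -> a < b -> a' < b'.
Proof. by move=> [[_ [-> ->]]|[_ [-> ->]]]; lra. Qed.

Lemma affine_continuous k s : continuous (fun t : R => k * t + s).
Proof.
move=> t; apply: differentiable_continuous.
by have [] := affine_is_diff k s t.
Qed.

Lemma C1_piece_affine k s a b a' b' gamma : affine_itv k s a b a' b' ->
  C1_piece a b gamma -> C1_piece a' b' (fun t => gamma (k * t + s)).
Proof.
move=> T_ab [cg C1g].
have pre t A : nbhs (k * t + s) A -> nbhs t [set u | A (k * u + s)].
  by move=> HA; exact: (@affine_continuous k s t A HA).
split.
  apply/subspace_continuousP => t tab U HU.
  have Tt : k * t + s \in `[a, b] by rewrite (affine_itv_cc _ T_ab).
  have h1 : nbhs (k * t + s) [set y | y \in `[a, b] -> U (gamma y)].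
    by move/subspace_continuousP : cg => /(_ _ Tt U HU).
  have h2 : nbhs t [set u | u \in `[a', b'] -> U (gamma (k * u + s))].
    by apply: filterS (pre _ _ h1) => u /= h; rewrite -(affine_itv_cc _ T_ab).
  exact: h2.
move=> c ac t [tab ct]; rewrite /= in ct.
have [|F [CF EF]] := C1g c ac (k * t + s).
  by split=> //=; rewrite (affine_itv_cc _ T_ab).
exists (fun u => F (k * u + s)); split; first exact: C1_near_comp_affine (affine_is_diff k s) CF.
apply: filterS (pre _ _ EF) => u /= h [uab cu]; apply: h; split=> //=.
by rewrite (affine_itv_cc _ T_ab).
Qed.

Lemma derive1_affine (f : R -> 'rV[R]_m) k s t : differentiable f (k * t + s) ->
  derive1 (fun u => f (k * u + s)) t = k *: derive1 f (k * t + s).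
Proof.
move=> df; pose T (u : R) := k * u + s.
have [dT E2] := affine_is_diff k s t.
have E := diff_comp dT df.
have dfT : differentiable (f \o T) t by exact: (differentiable_comp dT df).
rewrite (derive1E' dfT) (derive1E' df).
transitivity (('d f (T t) \o 'd T t) 1); first exact: (congr1 (fun h => h 1) E).
transitivity ('d f (T t) (k * 1)).
  exact: (congr1 (fun h : R -> R => 'd f (T t) (h 1)) E2).
by rewrite -[in RHS]linearZ.
Qed.

Lemma speed_affine k s a b a' b' gamma t : affine_itv k s a b a' b' ->
  C1_piece a b gamma -> t \in `]a', b'[ ->
  speed g (fun u => gamma (k * u + s)) t = speed g gamma (k * t + s).
Proof.
move=> T_ab gP tab; have gP' := C1_piece_affine T_ab gP.
have Tt : k * t + s \in `]a, b[ by rewrite (affine_itv_oo _ T_ab).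
have [c ac ct] := atlas_cover (gamma (k * t + s)).
have [G _ HG] := riem_continuous g ac.
rewrite (speedE gP Tt ac ct HG) (speedE gP' tab ac ct HG).
have [_ d _] := C1_piece_interior gP ac Tt ct.
have df : differentiable (chart_map c \o gamma) (k * t + s).
  by apply/derivable1_diffP; exact: nbhs_singleton d.
have -> : derive1 (chart_map c \o (fun u => gamma (k * u + s))) t =
    k *: derive1 (chart_map c \o gamma) (k * t + s) by exact: derive1_affine df.
have k2 : k ^+ 2 = 1 by case: T_ab => -[-> _]; rewrite ?sqrrN expr1n.
by rewrite quadZ k2 mul1r.
Qed.

Lemma piecewise_affine k s a b a' b' gamma : affine_itv k s a b a' b' ->
  piecewise gamma a b -> piecewise (fun t => gamma (k * t + s)) a' b' /\
    arc_length g (fun t => gamma (k * t + s)) a' b' = arc_length g gamma a b.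
Proof.
move=> + gP; elim: gP a' b' => [{}a {}b ab gP|{}a {}b c P1 IH1 P2 IH2] a' b' T_ab.
  have gP' := C1_piece_affine T_ab gP.
  split; first by apply: piecewise_one gP'; exact: (affine_itv_lt T_ab ab).
  have mo := speed_measurable g gP'.
  have mf := (speed_bounded_measurable g gP).1.
  have k1 : k = 1 \/ k = -1 by case: T_ab => -[-> _]; [left|right].
  have := Rintegral_isometry k1 (fun t => affine_itv_cc t T_ab) mf (speed_ge0 g gamma).
  move=> H; rewrite /arc_length -H; apply: Rintegral_itv_eq mo => t tab.
  exact: speed_affine T_ab gP tab.
case: T_ab => -[kE [aE cE]].
  have T1 : affine_itv k s a b a' (b - s) by left; split=> //; split; lra.
  have T2 : affine_itv k s b c (b - s) b' by left; split=> //; split; lra.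
  have [Q1 L1] := IH1 _ _ T1; have [Q2 L2] := IH2 _ _ T2.
  split; first exact: piecewise_cat Q1 Q2.
  by rewrite (arc_length_cat g Q1 Q2) L1 L2 (arc_length_cat g P1 P2).
have T1 : affine_itv k s a b (s - b) b' by right; split=> //; split; lra.
have T2 : affine_itv k s b c a' (s - b) by right; split=> //; split; lra.
have [Q1 L1] := IH1 _ _ T1; have [Q2 L2] := IH2 _ _ T2.
split; first exact: piecewise_cat Q2 Q1.
by rewrite (arc_length_cat g Q2 Q1) L1 L2 (arc_length_cat g P1 P2) addrC.
Qed.

Definition joined (x y : M) (L : R) : Prop := exists a b gamma,
  [/\ piecewise gamma a b, gamma a = x, gamma b = y & L = arc_length g gamma a b].

Lemma joined_sym x y L : joined x y L -> joined y x L.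
Proof.
move=> [a [b [gamma [gP ga gb ->]]]].
have T : affine_itv (-1) (a + b) a b a b by right; split=> //; split; lra.
have [gP' E] := piecewise_affine T gP.
exists a, b, (fun t => gamma (-1 * t + (a + b))); split.
- exact: gP'.
- by rewrite mulN1r addrA addNr add0r.
- by rewrite mulN1r [a + b]addrC addKr.
- exact: esym E.
Qed.

Lemma joined_trans x y z L L' : joined x y L -> joined y z L' ->
  joined x z (L + L').
Proof.
move=> [a [b [gamma [gP ga gb ->]]]] [a2 [b2 [gamma2 [gP2 ga2 gb2 ->]]]].
pose s := a2 - b; pose b3 := b2 - s.
have T : affine_itv 1 s a2 b2 b b3 by left; split=> //; rewrite /b3 /s; split; lra.
have [gP3 E3] := piecewise_affine T gP2.
pose h t := if t <= b then gamma t else gamma2 (1 * t + s).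
have ab := piecewise_lt gP; have bb3 := piecewise_lt gP3.
have [Q1 L1] : piecewise h a b /\ arc_length g h a b = arc_length g gamma a b.
  apply: piecewise_congr gP _ => t; rewrite in_itv /= => /andP[_ tb].
  by rewrite /h tb.
have [Q2 L2] : piecewise h b b3 /\ arc_length g h b b3 =
    arc_length g (fun t => gamma2 (1 * t + s)) b b3.
  apply: piecewise_congr gP3 _ => t; rewrite in_itv /= => /andP[bt _].
  rewrite /h; have [tb|tb] := leP t b; last reflexivity.
  have -> : t = b by apply: le_anti; rewrite tb bt.
  by rewrite gb mul1r /s addrC subrK ga2.
exists a, b3, h; split.
- exact: piecewise_cat Q1 Q2.
- by rewrite /h (ltW ab).
- by rewrite /h leNgt bb3 /= /b3 mul1r subrK.
- by rewrite (arc_length_cat g Q1 Q2) L1 L2 E3.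
Qed.

Lemma joined_ge0 x y L : joined x y L -> 0 <= L.
Proof.
move=> [a [b [gamma [_ _ _ ->]]]]; apply: Rintegral_ge0 => t _.
exact: speed_ge0.
Qed.

Lemma geodesic_distanceE x y : geodesic_distance g x y = inf [set L | joined x y L].
Proof.
rewrite /geodesic_distance; congr inf; apply/seteqP; split=> L /=.
  move=> [a [b [gamma [gP ga gb ->]]]]; exists a, b, gamma; split=> //.
  exact: piecewise_of_path.
move=> [a [b [gamma [gP ga gb ->]]]]; exists a, b, gamma; split=> //.
exact: path_of_piecewise.
Qed.

End Reparametrization.

(** * Increments bounded by integrals *)

Section SpeedBoundsIncrements.
Variable R : realType.
Implicit Types (f h : R -> R) (s t : R).
Local Notation mu := (@lebesgue_measure R).

Lemma increment_le_integral_inner f h s t lam : s < t -> 0 < lam ->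
  (forall u, u \in `[s, t] -> [/\ derivable f u 1, {for u, continuous (derive1 f)} &
     lam * `|derive1 f u| <= h u]) ->
  bounded_measurable h s t ->
  lam * `|f t - f s| <= \int[mu]_(u in `[s, t]) h u.
Proof.
move=> st lam0 H bh.
have cf : {within `[s, t], continuous (derive1 f)}.
  by apply: continuous_in_subspaceT => u; rewrite inE => /H[].
have cvf u : u \in `[s, t] -> {for u, continuous f}.
  by move=> /H[d _ _]; apply: differentiable_continuous; exact/derivable1_diffP.
have sI : s \in `[s, t] by rewrite in_itv /= lexx ltW.
have tI : t \in `[s, t] by rewrite in_itv /= lexx ltW.
have dLR : derivable_oo_LRcontinuous f s t.
  split.
  - by move=> u /itvoo_sub_itvcc /H[d _ _]; exact: d.
  - exact: cvg_at_right_filter (cvf _ sI).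
  - exact: cvg_at_left_filter (cvf _ tI).
have FTC := continuous_FTC2 st cf dLR (fun u _ => erefl).
have int_f' : mu.-integrable `[s, t] (EFin \o derive1 f).
  by apply: continuous_compact_integrable => //; exact: segment_compact.
have E : \int[mu]_(u in `[s, t]) derive1 f u = f t - f s.
  by rewrite /Rintegral FTC.
have int_h := bounded_measurable_integrable bh.
have int_n : mu.-integrable `[s, t] (EFin \o (fun u => `|derive1 f u|)).
  exact: integrable_norm int_f'.
rewrite -E -ler_pdivlMl//.
apply: le_trans (le_normr_Rintegral _ int_f') _ => //.
have -> : lam^-1 * \int[mu]_(u in `[s, t]) h u = \int[mu]_(u in `[s, t]) (lam^-1 * h u).
  by rewrite RintegralZl.
apply: le_Rintegral => //.
  by have := integrableZl _ lam^-1 int_h; apply.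
by move=> u us; rewrite ler_pdivlMl//; have [] := H u us.
Qed.

(** The derivative is controlled only inside the interval. The fundamental theorem is applied on
    [[s + q, t - q]], and continuity of [f] at the ends makes the loss at most [e]. *)
Lemma increment_le_integral f h s t lam : s < t -> 0 < lam ->
  {within `[s, t], continuous f} ->
  (forall u, u \in `]s, t[ -> [/\ derivable f u 1, {for u, continuous (derive1 f)} &
     lam * `|derive1 f u| <= h u]) ->
  bounded_measurable h s t -> (forall u, 0 <= h u) ->
  lam * `|f t - f s| <= \int[mu]_(u in `[s, t]) h u.
Proof.
move=> st lam0 cf H bh h0.
apply/ler_addgt0Pr => e e0; pose d := e / (2 * lam).
have d0 : 0 < d by rewrite divr_gt0// mulr_gt0.
have near_end u : u \in `[s, t] -> nbhs u [set v | v \in `[s, t] -> `|f u - f v| < d].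
  move=> us; move/subspace_continuousP : cf => /(_ u us).
  by move=> /cvgrPdist_lt/(_ d d0).
have sI : s \in `[s, t] by rewrite in_itv /= lexx ltW.
have tI : t \in `[s, t] by rewrite in_itv /= lexx ltW.
have /nbhs_ballP[r1 /= r10 H1] := near_end s sI.
have /nbhs_ballP[r2 /= r20 H2] := near_end t tI.
pose q := Num.min (Num.min (r1 / 2) (r2 / 2)) ((t - s) / 3).
have ts : 0 < t - s by rewrite subr_gt0.
have q0 : 0 < q by rewrite !lt_min !divr_gt0.
have [qr1 qr2 q3] : [/\ q <= r1 / 2, q <= r2 / 2 & q <= (t - s) / 3].
  by have := lexx q; rewrite {2}/q !le_min => /andP[/andP[]].
have h1 : `|f s - f (s + q)| < d.
  apply: H1; last by rewrite in_itv /=; lra.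
  by rewrite -ball_normE /= opprD addrA subrr add0r normrN gtr0_norm//; lra.
have h2 : `|f t - f (t - q)| < d.
  apply: H2; last by rewrite in_itv /=; lra.
  by rewrite -ball_normE /= opprB addrC subrK gtr0_norm//; lra.
have st' : s + q < t - q by lra.
have H3 : lam * `|f (t - q) - f (s + q)| <= \int[mu]_(u in `[(s + q), (t - q)]) h u.
  apply: increment_le_integral_inner => //.
    by move=> u; rewrite in_itv /= => /andP[su ut]; apply: H; rewrite in_itv /=; lra.
  by apply: bounded_measurable_sub bh; lra.
have H4 : \int[mu]_(u in `[(s + q), (t - q)]) h u <= \int[mu]_(u in `[s, t]) h u.
  by apply: Rintegral_ge_sub => //; lra.
have H5 : `|f t - f s| <= `|f (t - q) - f (s + q)| + (d + d).
  have -> : f t - f s = (f (t - q) - f (s + q)) + ((f t - f (t - q)) - (f s - f (s + q))).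
    by ring.
  apply: le_trans (ler_normD _ _) _; rewrite lerD2l.
  by apply: le_trans (ler_normB _ _) _; rewrite lerD// ltW.
apply: (@le_trans _ _ (lam * (`|f (t - q) - f (s + q)| + (d + d)))).
  by rewrite ler_pM2l.
rewrite mulrDr; apply: lerD; first exact: le_trans H3 H4.
have -> : lam * (d + d) = e by rewrite /d; field; rewrite lt0r_neq0.
exact: lexx.
Qed.

End SpeedBoundsIncrements.

(** * Geodesic distance in a chart *)

Section LowerBound.
Variables (R : realType) (m : nat) (M : C1_manifold R m).
Variable g : riemannian_metric M.
Implicit Types (gamma : R -> M) (a b s t lam d : R).
Variables (ch : chart R m M) (lam : R) (U : set M).
Hypotheses (ch_atlas : atlas ch) (lam0 : 0 < lam).
Hypothesis U_lower : forall p v, U p -> tangent_space p v ->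
  lam * `|v ch| <= Num.sqrt (g p v v).

(** One coordinate at a time, as the fundamental theorem is for scalar functions; the sup norm is
    attained at some coordinate, so no constant is lost. *)
Lemma C1_piece_lower gamma a b s t j : C1_piece a b gamma ->
  a <= s -> s < t -> t <= b ->
  (forall u, u \in `[s, t] -> chart_dom ch (gamma u) /\ U (gamma u)) ->
  lam * `|chart_map ch (gamma t) 0 j - chart_map ch (gamma s) 0 j| <=
    arc_length g gamma s t.
Proof.
move=> gP as_ st tb inU.
have sub u : u \in `]s, t[ -> u \in `]a, b[.
  by rewrite !in_itv /= => /andP[su ut]; apply/andP; split; lra.
have sub' u : u \in `[s, t] -> u \in `[a, b].
  by rewrite !in_itv /= => /andP[su ut]; apply/andP; split; lra.
pose f u := chart_map ch (gamma u) 0 j.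
apply: (@increment_le_integral _ f) => //.
- apply/subspace_continuousP => u us; apply/cvgrPdist_lt => e e0.
  have [du _] := inU u us.
  have hb := chart_ball_nbhs du e0.
  have h1 : nbhs u [set v | v \in `[a, b] -> chart_ball ch (gamma u) e (gamma v)].
    by move/subspace_continuousP : gP.1 => /(_ u (sub' u us) _ hb).
  have h2 : nbhs u [set v | v \in `[s, t] -> `|f u - f v| < e].
    apply: filterS h1 => v h vs; have [_] := h (sub' v vs).
    rewrite distrC; apply: le_lt_trans; rewrite /f -rv_subE; exact: rv_coord_le.
  exact: h2.
- move=> u us; have [du Uu] := inU u (itvoo_sub_itvcc us).
  have [_ dn cv] := C1_piece_interior gP ch_atlas (sub u us) du.
  have E : nbhs u [set v | derive1 (chart_map ch \o gamma) v 0 j = derive1 f v].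
    apply: filterS dn => v dv /=; rewrite !derive1E derive_mx// mxE.
    reflexivity.
  have d1 := nbhs_singleton dn.
  split.
  + by move/derivable_mxP : d1 => /(_ 0 j).
  + have : derive1 f v @[v --> u] --> derive1 (chart_map ch \o gamma) u 0 j.
      apply: cvg_trans (cvg_comp _ _ cv (@coord_continuous R 1 m 0 j _)).
      exact: near_eq_cvg.
    by rewrite (nbhs_singleton E : derive1 (chart_map ch \o gamma) u 0 j = derive1 f u).
  + rewrite -(nbhs_singleton E : derive1 (chart_map ch \o gamma) u 0 j = derive1 f u).
    have := U_lower Uu (velocity_tangent gP (sub u us)); rewrite velocityE//.
    by apply: le_trans; rewrite ler_pM2l//; exact: rv_coord_le.
- exact: bounded_measurable_sub as_ tb (speed_bounded_measurable g gP).
- by move=> u; exact: speed_ge0.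
Qed.

Lemma piecewise_lower gamma a b s t j : piecewise gamma a b ->
  a <= s -> s <= t -> t <= b ->
  (forall u, u \in `[s, t] -> chart_dom ch (gamma u) /\ U (gamma u)) ->
  lam * `|chart_map ch (gamma t) 0 j - chart_map ch (gamma s) 0 j| <=
    arc_length g gamma s t.
Proof.
move=> gP; elim: gP s t => [{}a {}b ab gP|{}a {}b c P1 IH1 P2 IH2] s t as_ st tb inU.
  have [E|sn] := eqVneq s t; last by apply: C1_piece_lower gP _ _ _ _ => //; rewrite lt_neqAle sn.
  subst t; rewrite subrr normr0 mulr0.
  by apply: Rintegral_ge0 => u _; exact: speed_ge0.
have [tb'|/ltW bt] := leP t b; first exact: IH1.
have [bs|/ltW sb] := leP b s; first exact: IH2.
have i1 u : u \in `[s, b] -> u \in `[s, t].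
  by rewrite !in_itv /= => /andP[-> ub]; exact: le_trans bt.
have i2 u : u \in `[b, t] -> u \in `[s, t].
  by rewrite !in_itv /= => /andP[ub ->]; rewrite (le_trans sb).
have L1 := IH1 s b as_ sb (lexx b) (fun u us => inU u (i1 u us)).
have L2 := IH2 b t (lexx b) bt tb (fun u us => inU u (i2 u us)).
have bm := bounded_measurable_sub as_ tb
  (piecewise_bounded_measurable g (piecewise_cat P1 P2)).
rewrite /arc_length (Rintegral_cat sb bt bm).
apply: le_trans (lerD L1 L2); rewrite -mulrDr ler_pM2l//.
set A := chart_map _ _ _ _; set B := chart_map _ _ _ _; set C := chart_map _ _ _ _.
by rewrite [leRHS]addrC; exact: ler_distD.
Qed.

(** Let [t1] be the first time outside the open chart ball. Up to [t1] the path is in the closed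
    ball, where speeds are bounded below, and at [t1] its chart distance from the start is exactly
    [d]. Closedness of that ball in [M] prevents the path from leaving the chart domain without
    crossing the sphere. *)
Lemma exit_length gamma a b d : piecewise gamma a b -> 0 < d ->
  chart_dom ch (gamma a) ->
  closed [set z | chart_dom ch z /\ `|chart_map ch z - chart_map ch (gamma a)| <= d] ->
  (forall z, chart_dom ch z -> `|chart_map ch z - chart_map ch (gamma a)| <= d -> U z) ->
  ~ chart_ball ch (gamma a) d (gamma b) ->
  lam * d <= arc_length g gamma a b.
Proof.
move=> gP d0 da clB BU nb; have ab := piecewise_lt gP.
set x := gamma a in da clB BU nb *.
pose S := [set t | t \in `[a, b] /\ ~ chart_ball ch x d (gamma t)].
have cg : {within `[a, b], continuous gamma} by have [] := path_of_piecewise gP.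
have Sb : S b by split=> //; rewrite in_itv /= lexx ltW.
have Slb : lbound S a by move=> t [+ _]; rewrite in_itv /= => /andP[].
have iS : has_inf S by split; [exists b|exists a].
pose t1 := inf S.
have at1 : a <= t1 by apply: lb_le_inf => //; exists b.
have t1b : t1 <= b by apply: ge_inf => //; exists a.
have t1I : t1 \in `[a, b] by rewrite in_itv /= at1.
have before u : a <= u -> u < t1 -> chart_ball ch x d (gamma u).
  move=> au ut; apply: contrapT => nu.
  have : t1 <= u.
    apply: ge_inf; first by exists a.
    by split=> //; rewrite in_itv /= au (ltW (lt_le_trans ut t1b)).
  by rewrite leNgt ut.
have ngt1 : ~ chart_ball ch x d (gamma t1).
  move=> [dt1 t1x].
  have e0 : 0 < d - `|chart_map ch (gamma t1) - chart_map ch x| by rewrite subr_gt0.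
  have h : nbhs t1 [set v | v \in `[a, b] -> chart_ball ch (gamma t1)
      (d - `|chart_map ch (gamma t1) - chart_map ch x|) (gamma v)].
    by move/subspace_continuousP : cg => /(_ t1 t1I _ (chart_ball_nbhs dt1 e0)).
  have /nbhs_ballP[r /= r0 Hr] := h.
  have [u Su ut] := inf_adherent r0 iS.
  have t1u : t1 <= u by apply: ge_inf => //; exists a.
  have [ui nu] := Su; apply: nu.
  have [|du ux] := Hr u _ ui.
    by rewrite -ball_normE /= ler0_norm ?subr_le0//; rewrite -/t1 in ut; lra.
  split=> //; have := ler_normD (chart_map ch (gamma u) - chart_map ch (gamma t1))
    (chart_map ch (gamma t1) - chart_map ch x).
  by rewrite addrA subrK; lra.
have at1' : a < t1.
  rewrite lt_neqAle at1 andbT; apply/eqP => E; apply: ngt1.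
  by rewrite -E; split=> //; rewrite subrr normr0.
have Bt1 : chart_dom ch (gamma t1) /\ `|chart_map ch (gamma t1) - chart_map ch x| <= d.
  apply: contrapT => nB.
  have oB : nbhs (gamma t1) (~` [set z | chart_dom ch z /\
      `|chart_map ch z - chart_map ch x| <= d]).
    by apply: open_nbhs_nbhs; split; first exact: closed_openC.
  have h : nbhs t1 [set v | v \in `[a, b] -> ~ (chart_dom ch (gamma v) /\
      `|chart_map ch (gamma v) - chart_map ch x| <= d)].
    by move/subspace_continuousP : cg => /(_ t1 t1I _ oB).
  have /nbhs_ballP[r /= r0 Hr] := h.
  pose q := Num.min (r / 2) (t1 - a).
  have q0 : 0 < q by rewrite lt_min divr_gt0//= subr_gt0.
  have [qr qa] : q <= r / 2 /\ q <= t1 - a.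
    by have := lexx q; rewrite {2}/q le_min => /andP[].
  have [dv vx] : chart_ball ch x d (gamma (t1 - q)) by apply: before; lra.
  apply: (Hr (t1 - q)); last by split=> //; exact: ltW.
    by rewrite -ball_normE /= opprB addrC subrK gtr0_norm//; lra.
  by rewrite in_itv /=; apply/andP; split; lra.
have dE : `|chart_map ch (gamma t1) - chart_map ch x| = d.
  apply: le_anti; rewrite Bt1.2 /= leNgt; apply/negP => lt_d.
  by apply: ngt1; split=> //; exact: Bt1.1.
have inB u : u \in `[a, t1] -> chart_dom ch (gamma u) /\ U (gamma u).
  rewrite in_itv /= => /andP[au ut]; have [->|un] := eqVneq u t1.
    by have [h1 h2] := Bt1; split=> //; exact: BU.
  have [|h1 h2] := before u au; first by rewrite lt_neqAle un.
  by split=> //; apply: BU => //; exact: ltW.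
(* A coordinate in which the path has moved by the full distance [d]. *)
have [z0|[j zj]] := rv_normP (chart_map ch (gamma t1) - chart_map ch x).
  by move: dE; rewrite z0 normr0 => E; move: d0; rewrite -E ltxx.
have := piecewise_lower j gP (lexx a) at1 t1b inB.
rewrite -rv_subE -zj dE => /le_trans; apply.
rewrite /arc_length; apply: Rintegral_ge_sub => //.
  exact: piecewise_bounded_measurable.
by move=> u; exact: speed_ge0.
Qed.

End LowerBound.

Lemma line_is_diff (R : realType) (V : normedModType R) (p w : V) (u : R) :
  is_diff u (fun t : R => p + t *: w) (fun t : R => t *: w).
Proof.
have D := is_diffD (is_diff_cst p u) (is_diff_scalel u w).
by apply: is_diff_eq D _; rewrite add0r.
Qed.

Section ChartSegments.
Variables (R : realType) (m : nat) (M : C1_manifold R m).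
Variable g : riemannian_metric M.
Implicit Types (c : chart R m M) (o x y : M) (r t : R).

Let line c x y t := chart_map c x + t *: (chart_map c y - chart_map c x).

Lemma chart_line_model c x y t : chart_dom c x -> chart_dom c y ->
  0 <= t <= 1 -> chart_model c (line c x y t).
Proof.
move=> cx cy t01; have -> : line c x y t = (1 - t) *: chart_map c x + t *: chart_map c y.
  by rewrite /line scalerBr scalerBl scale1r addrA addrAC.
exact: model_convex (@chart_modelP _ _ _ c) (chart_map_model cx) (chart_map_model cy) t01.
Qed.

Lemma chart_line_ball c o x y r t : chart_ball c o r x -> chart_ball c o r y ->
  0 <= t <= 1 -> `|line c x y t - chart_map c o| < r.
Proof.
move=> [_ xr] [_ yr] /andP[t0 t1].
have -> : line c x y t - chart_map c o =
    (1 - t) *: (chart_map c x - chart_map c o) + t *: (chart_map c y - chart_map c o).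
  rewrite /line !scalerBr !scalerBl !scale1r.
  set a := chart_map c x; set b := chart_map c y; set p := chart_map c o.
  rewrite opprB !addrA; apply/eqP; rewrite -subr_eq0; apply/eqP.
  apply/rowP => i; rewrite !mxE; ring.
apply: le_lt_trans (ler_normD _ _) _.
rewrite !normrZ (ger0_norm t0) ger0_norm ?subr_ge0//.
move: `|_| `|_| xr yr => v u ur vr.
have [uv|vu] := leP u v.
  by apply: le_lt_trans vr; nra.
by apply: le_lt_trans ur; nra.
Qed.

(** The straight segment stays in the convex model and near [o]; its coordinate velocity is
    constant, so its length is at most [K] times the chart distance. *)
Lemma chart_segment c o : chart_at o c -> exists r K, [/\ 0 < r, 0 < K &
  forall x y, chart_ball c o r x -> chart_ball c o r y ->
    exists2 L, joined g x y L & L <= K * `|chart_map c x - chart_map c y|].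
Proof.
move=> co; have [lam [K [_ K0 [U oU HU]]]] := riem_comparison g co.
have [ac dco] := co.
have [r r0 Hr] := chart_local dco oU.
exists r, K; split=> // x y bx by_; have [cx _] := bx; have [cy _] := by_.
pose gamma t := chart_inv c (line c x y t).
have lineP t : t \in `[0, 1] -> [/\ chart_dom c (gamma t),
    chart_map c (gamma t) = line c x y t & U (gamma t)].
  rewrite in_itv /= => t01; apply: Hr; first exact: chart_line_model.
  exact: chart_line_ball.
have ld t := line_is_diff (chart_map c x) (chart_map c y - chart_map c x) t.
have lcont : continuous (line c x y).
  by move=> u; apply: differentiable_continuous; have [] := ld u.
have gP : C1_piece 0 1 gamma.
  split.
    apply/subspace_continuousP => t t01 W HW.
    have [dt Et _] := lineP t t01.
    have [e e0 He] := chart_inv_cvg dt Et HW.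
    have h : nbhs t [set s | s \in `[0, 1] -> W (gamma s)].
      have /cvgrPdist_lt/(_ e e0) := lcont t.
      apply: filterS => s ds s01; rewrite in_itv /= in s01; apply: He.
        exact: chart_line_model.
      by rewrite distrC.
    exact: h.
  move=> c' ac' t [/= t01 ct]; have [dt Et _] := lineP t t01.
  have [|F [C1F EF]] := atlas_C1 ac ac' (x := line c x y t); first by exists (gamma t).
  exists (fun u => F (line c x y u)); split; first exact: C1_near_comp_affine ld C1F.
  have {}EF : nbhs t [set s | transition_dom c c' (line c x y s) ->
      F (line c x y s) = transition c c' (line c x y s)] by exact: lcont t _ EF.
  apply: filterS EF => s /= Es [/= s01 cs].
  have [ds Es' _] := lineP s s01.
  by rewrite Es//; exists (gamma s).
exists (arc_length g gamma 0 1).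
  exists 0, 1, gamma; split=> //.
  - exact: piecewise_one.
  - by rewrite /gamma /line scale0r addr0 chart_invK.
  - by rewrite /gamma /line scale1r addrC subrK chart_invK.
rewrite distrC; set w := chart_map c y - chart_map c x.
have -> : K * `|w| = K * `|w| * (1 - 0) by rewrite subr0 mulr1.
apply: Rintegral_le_cst; first exact: ler01.
  exact: speed_bounded_measurable.
move=> t t01; have [dt Et Ut] := lineP t (itvoo_sub_itvcc t01).
have /andP[_] := HU _ _ Ut (velocity_tangent gP t01).
suff -> : velocity gamma t c = w by [].
rewrite velocityE// derive1E.
have E : nbhs t [set s | line c x y s = (chart_map c \o gamma) s].
  apply: filterS (itvoo_nbhs t01) => s /itvoo_sub_itvcc s01.
  by have [_ Es _] := lineP s s01; rewrite /= Es.
rewrite -(near_eq_derive _ E) deriveE; last by have [] := ld t.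
have [_ ->] := ld t; exact: scale1r.
Qed.

End ChartSegments.

(** * The geodesic distance as a metric comparable with charts *)

Section GeodesicMetric.
Variables (R : realType) (m : nat) (M : C1_manifold R m).
Variable g : riemannian_metric M.
Hypothesis M_connected : connected [set: M].
Implicit Types (c : chart R m M) (o x y z : M).

Lemma joined_near o : exists2 V, nbhs o V &
  forall x y, V x -> V y -> exists L, joined g x y L.
Proof.
have [c ac oc] := atlas_cover o.
have [r [K [r0 _ HK]]] := chart_segment g (conj ac oc).
exists (chart_ball c o r); first exact: chart_ball_nbhs.
by move=> x y bx by_; have [L HL _] := HK x y bx by_; exists L.
Qed.

(** The set of points joined to [x] is nonempty, open and closed. Infima of lengths are thus never
    taken over the empty set, where [inf] would be 0. *)
Lemma joined_exists x y : exists L, joined g x y L.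
Proof.
pose B := [set z | exists L, joined g x z L].
suff : B = setT by move=> E; have : [set: M] y by []; rewrite -E.
apply: M_connected.
- exists x; have [V oV HV] := joined_near x.
  by apply: HV; exact: nbhs_singleton oV.
- exists B; last by rewrite setTI.
  rewrite openE => z [L HL]; have [V oV HV] := joined_near z.
  have Vz := nbhs_singleton oV.
  apply: filterS oV => w Vw; have [L' HL'] := HV z w Vz Vw.
  by exists (L + L'); exact: joined_trans HL HL'.
- exists B; last by rewrite setTI.
  move=> z clz; have [V oV HV] := joined_near z.
  have [w [[L HL] Vw]] := clz V oV.
  have [L' HL'] := HV w z Vw (nbhs_singleton oV).
  by exists (L + L'); exact: joined_trans HL HL'.
Qed.

Lemma joined_has_inf x y : has_inf [set L | joined g x y L].
Proof.
split; first exact: joined_exists.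
by exists 0 => L /= /joined_ge0.
Qed.

Lemma geodesic_distance_le x y L : joined g x y L -> geodesic_distance g x y <= L.
Proof.
by move=> H; rewrite geodesic_distanceE; apply: ge_inf => //; exact: (joined_has_inf x y).2.
Qed.

Lemma geodesic_distance_ge x y l : (forall L, joined g x y L -> l <= L) ->
  l <= geodesic_distance g x y.
Proof.
move=> H; rewrite geodesic_distanceE; apply: lb_le_inf => //.
exact: (joined_has_inf x y).1.
Qed.

(** By [exit_length], a path from [x] that ends outside the chart ball of radius [e] has length at
    least [lam * e]. *)
Lemma geodesic_distance_escape c o : chart_at o c -> exists r lam,
  [/\ 0 < r, 0 < lam & forall x z e, chart_ball c o r x -> 0 < e <= r ->
    geodesic_distance g x z < lam * e -> chart_ball c x e z].
Proof.
move=> co; have [lam [K [lam0 _ [U oU HU]]]] := riem_comparison g co.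
have [ac dco] := co.
have [r1 r10 cl1] := chart_closed_ball (@manifold_hausdorff _ _ M) dco.
have [r2 r20 H2] := chart_local dco oU.
(* A ball of radius [e <= r] around a point within [r] of [o] lies within [2 * r] of [o], where
   closedness and the metric comparison both hold. *)
pose r := Num.min r1 r2 / 3.
have r0 : 0 < r by rewrite divr_gt0// lt_min r10.
have [rr1 rr2] : 2 * r <= r1 /\ 2 * r < r2.
  have : Num.min r1 r2 <= r1 /\ Num.min r1 r2 <= r2 by rewrite !ge_min !lexx orbT.
  by move: r0; rewrite /r => ? []; split; lra.
exists r, lam; split=> // x z e [dx xo] /andP[e0 er] dist_lt.
have near_o w : `|chart_map c w - chart_map c x| <= e ->
    `|chart_map c w - chart_map c o| <= 2 * r.
  move=> wx; have := ler_distD (chart_map c x) (chart_map c w) (chart_map c o); lra.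
apply: contrapT => nb; move: dist_lt; apply/negP; rewrite -leNgt.
apply: geodesic_distance_ge => L [a [b [gamma [gP ga gb ->]]]].
have B1 : closed [set w | chart_dom c w /\
    `|chart_map c w - chart_map c (gamma a)| <= e].
  rewrite ga => p clp.
  have [dp _] : [set w | chart_dom c w /\ `|chart_map c w - chart_map c o| <= 2 * r] p.
    apply: (cl1 _ rr1) => V pV; have [w [[dw wx] Vw]] := clp V pV.
    by exists w; split=> //; split=> //; exact: near_o.
  split=> //; apply/ler_addgt0Pr => q q0.
  have [w [[_ wx] [_ wp]]] := clp _ (chart_ball_nbhs dp q0).
  have := ler_distD (chart_map c w) (chart_map c p) (chart_map c x).
  by rewrite distrC in wp; lra.
have HU' p v : U p -> tangent_space p v -> lam * `|v c| <= Num.sqrt (g p v v).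
  by move=> Up tv; have /andP[] := HU p v Up tv.
apply: (exit_length ac lam0 HU' gP e0 _ B1); rewrite ?ga ?gb//.
move=> w dw /near_o wo; rewrite -(chart_invK dw).
have [|_ _ //] := H2 (chart_map c w) (chart_map_model dw).
exact: le_lt_trans rr2.
Qed.

Lemma geodesic_distance_is_metric : is_metric (geodesic_distance g).
Proof.
have d0 x y : 0 <= geodesic_distance g x y.
  by apply: geodesic_distance_ge => L; exact: joined_ge0.
have sym x y : geodesic_distance g x y <= geodesic_distance g y x.
  apply: geodesic_distance_ge => L H; apply: geodesic_distance_le.
  exact: joined_sym.
split.
- move=> x; apply: le_anti; rewrite d0 andbT.
  have [c ac xc] := atlas_cover x.
  have [r [K [r0 K0 HK]]] := chart_segment g (conj ac xc).
  have bx : chart_ball c x r x by split=> //; rewrite subrr normr0.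
  have [L HL] := HK x x bx bx; rewrite subrr normr0 mulr0.
  by apply: le_trans; exact: geodesic_distance_le.
- move=> x y dxy; have [c ac xc] := atlas_cover x.
  have [r [lam [r0 lam0 H]]] := geodesic_distance_escape (conj ac xc).
  have bx : chart_ball c x r x by split=> //; rewrite subrr normr0.
  (* The escape bound at radius [r] puts [y] into the chart; at a radius not exceeding its chart
     distance from [x] it then gives a contradiction unless the two agree. *)
  have [| |yc _] := H x y r bx; [by rewrite r0 lexx|by rewrite dxy mulr_gt0|].
  apply: (chart_map_inj xc yc); apply/eqP/negPn/negP => ne.
  have N0 : 0 < `|chart_map c y - chart_map c x|.
    by rewrite normr_gt0 subr_eq0 eq_sym.
  pose e := Num.min r `|chart_map c y - chart_map c x|.
  have e0 : 0 < e by rewrite lt_min r0.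
  have [| |_] := H x y e bx; [by rewrite e0 ge_min lexx|by rewrite dxy mulr_gt0|].
  by rewrite lt_min ltxx andbF.
- by move=> x y; apply: le_anti; rewrite !sym.
- move=> y x z; apply/ler_addgt0Pr => e e0.
  have e2 : 0 < e / 2 by rewrite divr_gt0.
  have [L HL Lxy] := inf_adherent e2 (joined_has_inf x y).
  have [L' HL' Lyz] := inf_adherent e2 (joined_has_inf y z).
  rewrite -!geodesic_distanceE in Lxy Lyz.
  have := geodesic_distance_le (joined_trans HL HL'); lra.
Qed.

Lemma geodesic_distance_bilipschitz o : exists c r L, [/\ chart_at o c, 0 < r, 0 < L &
  chart_bilipschitz (geodesic_distance g) c o r L].
Proof.
have [c ac oc] := atlas_cover o; have co := conj ac oc.
have [r1 [K [r10 K0 HK]]] := chart_segment g co.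
have [r2 [lam [r20 lam0 Hlam]]] := geodesic_distance_escape co.
have il0 : 0 < lam^-1 by rewrite invr_gt0.
pose r := Num.min r1 r2; have L0 : 0 < K + lam^-1 by exact: addr_gt0.
have [rr1 rr2] : r <= r1 /\ r <= r2 by rewrite !ge_min !lexx orbT.
exists c, r, (K + lam^-1); split=> //; first by rewrite lt_min r10.
split=> [x y [xc xo] [yc yo]|x z e [xc xo] /andP[e0 er] dxz].
  have [| |L HL] := HK x y; try by split=> //; exact: lt_le_trans rr1.
  move=> /le_trans h; apply: le_trans (geodesic_distance_le HL) _; apply: h.
  by rewrite ler_wpM2r// lerDl ltW.
apply: (Hlam x z e).
- by split=> //; exact: lt_le_trans rr2.
- by rewrite e0 (le_trans er).
apply: lt_le_trans dxz _; rewrite ler_pdivrMr// mulrDr [X in _ + X]mulrAC.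
by rewrite mulfV ?lt0r_neq0// mul1r lerDr !mulr_ge0// ltW.
Qed.

End GeodesicMetric.

Theorem theorem5p8 (R : realType) (m : nat) (M : C1_manifold R m)
    (g : riemannian_metric M) :
  compact [set: M] -> connected [set: M] ->
  exists dP : is_metric (geodesic_distance g),
    cube_decomposable (metric_space dP).
Proof.
move=> cM kM; exists (geodesic_distance_is_metric g kM).
exact: cube_decomposable_of_charts cM (geodesic_distance_bilipschitz g kM).
Qed.
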